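(* Let $(a,b)\subset\mathbb{R}$ be a finite interval, $n\in\mathbb{N}\cup\{0\}$, $m,r,l\in\mathbb{N}$, and $1\le p\le\infty$. Let $A_{0},\dots,A_{r-1}\in (W_p^n)^{m\times m}$ and, for each $k\in\mathbb{N}$, $A_{0}(\cdot,k),\dots,A_{r-1}(\cdot,k)\in (W_p^n)^{m\times m}$; put $$Ly:=y^{(r)}+\sum_{j=1}^r A_{r-j}\,y^{(r-j)},\qquad L(k)y:=y^{(r)}+\sum_{j=1}^r A_{r-j}(\cdot,k)\,y^{(r-j)},\qquad y\in (W_p^{n+r})^m,$$ and let $B,B(k)\colon (W_p^{n+r})^m\to\mathbb{C}^l$ ($k\in\mathbb{N}$) be continuous linear operators. If the operators $(L(k),B(k))\colon (W_p^{n+r})^m\to (W_p^n)^m\times\mathbb{C}^l$ converge strongly to $(L,B)\colon (W_p^{n+r})^m\to (W_p^n)^m\times\mathbb{C}^l$ as $k\to\infty$, then the characteristic matrices satisfy $$M(L(k),B(k))\to M(L,B)\quad\text{in }\mathbb{C}^{l\times rm}\text{ as }k\to\infty.$$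
   Context: Sobolev spaces: for an integer $s\ge 1$, $W_p^{s}=W_p^{s}([a,b];\mathbb{C})$ is the set of $y\in C^{s-1}([a,b];\mathbb{C})$ such that $y^{(s-1)}$ is absolutely continuous on $[a,b]$ and $y^{(s)}\in L_p[a,b]$; $W_p^0:=L_p([a,b];\mathbb{C})$. It is a Banach space with norm $\|y\|_{s,p}=\sum_{i=0}^{s}\|y^{(i)}\|_p$. $(W_p^{s})^m$ and $(W_p^{s})^{m\times m}$ denote the spaces of $\mathbb{C}^m$-valued (columns) and $\mathbb{C}^{m\times m}$-valued functions with all entries in $W_p^s$, normed by the sum of the norms of the entries. $(L,B)$ denotes the bounded operator $y\mapsto(Ly,By)$, and similarly $(L(k),B(k))$. Strong convergence $T_k\xrightarrow{s}T$ means $T_ky\to Ty$ in norm for every $y$. Characteristic matrix: for $i\in\{1,\dots,r\}$ let $Y_i\in (W_p^{n+r})^{m\times m}$ be the unique solution of the matrix Cauchy problem $$Y_i^{(r)}(t)+\sum_{j=1}^r A_{r-j}(t)Y_i^{(r-j)}(t)=O_m,\ t\in(a,b),\qquad Y_i^{(j-1)}(a)=\delta_{i,j}I_m,\ j\in\{1,\dots,r\}$$ (almost everywhere if $n=0$), where $O_m$ and $I_m$ are the zero and identity $m\times m$ matrices and $\delta_{i,j}$ is the Kronecker delta. Let $[BY_i]\in\mathbb{C}^{l\times m}$ be the matrix whose $j$-th column is $B$ applied to the $j$-th column of $Y_i$. Then $M(L,B):=\big([BY_1],\dots,[BY_r]\big)\in\mathbb{C}^{l\times rm}$. The matrix $M(L(k),B(k))$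 is defined in the same way, with $A_{r-j}(\cdot,k)$ and $B(k)$ in place of $A_{r-j}$ and $B$. *)

(* Defs.v *)
From HB Require Import structures.
From mathcomp Require Import all_boot all_order all_algebra.
From mathcomp Require Import all_classical all_reals all_analysis.
From mathcomp Require Export complex.
Export numFieldNormedType.Exports.

Set Implicit Arguments.
Unset Strict Implicit.
Unset Printing Implicit Defensive.

Import Order.TTheory GRing.Theory Num.Theory.

Local Open Scope classical_set_scope.
Local Open Scope ring_scope.
Local Open Scope complex_scope.

(* R[i] as a normed module over itself, with the topology of the modulus. *)
HB.instance Definition _ (R : realType) := NormedModule.copy R[i] R[i]^o.

(* Functions on [a, b] are represented by total functions on R: every notion
   below depends only on their values on [a, b]. *)

Section ScalarFunctions.
Variable R : realType.
Variables a b : R.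
Implicit Types (f y : R -> R[i]) (p : \bar R).

Definition cabs (z : R[i]) : R := complex.Re `|z|.

(* Difference quotients with t restricted to [a, b], so that the derivatives
   at the end points a and b are one-sided. *)
Definition diffquot f (x t : R) : R[i] := (f t - f x) / (t - x)%:C.

Definition derivable_on f (x : R) : Prop :=
  cvg (diffquot f x @ within `[a, b] x^').

Definition deriv_on f (x : R) : R[i] :=
  lim (diffquot f x @ within `[a, b] x^').

Definition derivn_on (i : nat) f : R -> R[i] := iter i deriv_on f.

Definition Ck_on (k : nat) y : Prop :=
  (forall (i : nat) (x : R), (i < k)%N -> x \in `[a, b] ->
     derivable_on (derivn_on i y) x) /\
  {within `[a, b], continuous (derivn_on k y)}.

Definition abs_cont_on f : Prop :=
  forall e : R, 0 < e -> exists2 d : R, 0 < d &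
    forall (N : nat) (u v : 'I_N -> R),
      (forall i, [/\ a <= u i, u i <= v i & v i <= b]) ->
      (forall i j, i != j -> v i <= u j \/ v j <= u i) ->
      \sum_(i < N) (v i - u i) < d ->
      \sum_(i < N) cabs (f (v i) - f (u i)) < e.

Definition Lpnorm p f : \bar R :=
  Lnorm (@lebesgue_measure R) p
    (EFin \o ((fun x => cabs (f x)) \_ `[a, b])).

(* Measurability is Borel measurability: every class of L_p([a, b]) has a
   Borel representative. *)
Definition Lp_on p f : Prop :=
  [/\ measurable_fun (`[a, b] : set R) (fun x => complex.Re (f x)),
      measurable_fun (`[a, b] : set R) (fun x => complex.Im (f x))
    & (Lpnorm p f < +oo)%E].

(* y^(s) is only defined almost everywhere (the third condition spells this
   out; it follows from absolute continuity); where y^(s-1) has no derivative,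
   derivn_on s y takes a default value. *)
Definition sobolev p (s : nat) y : Prop :=
  if s is s'.+1 then
    [/\ Ck_on s' y,
        abs_cont_on (derivn_on s' y),
        {ae @lebesgue_measure R, forall x, x \in `[a, b] ->
           derivable_on (derivn_on s' y) x}
      & Lp_on p (derivn_on s y)]
  else Lp_on p y.

Definition sobolev_norm p (s : nat) y : \bar R :=
  (\sum_(i < s.+1) Lpnorm p (derivn_on i y))%E.

End ScalarFunctions.

Section MatrixFunctions.
Variable R : realType.
Variables a b : R.
Implicit Types p : \bar R.

Definition sobolev_mx p (s m q : nat) (Y : R -> 'M[R[i]]_(m, q)) : Prop :=
  forall i j, sobolev a b p s (fun t => Y t i j).

Definition sobolev_mx_norm p (s m q : nat) (Y : R -> 'M[R[i]]_(m, q)) :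
    \bar R :=
  (\sum_(i < m) \sum_(j < q) sobolev_norm a b p s (fun t => Y t i j))%E.

Definition mxderivn (k m q : nat) (Y : R -> 'M[R[i]]_(m, q)) (t : R) :
    'M[R[i]]_(m, q) :=
  \matrix_(i, j) derivn_on a b k (fun t => Y t i j) t.

(* The family A lists A_0, ..., A_(r-1). With q = 1 this is the operator L on
   C^m-valued functions, with q = m it is its action on matrices. *)
Definition diffop (m r q : nat) (A : 'I_r -> R -> 'M[R[i]]_m)
    (Y : R -> 'M[R[i]]_(m, q)) (t : R) : 'M[R[i]]_(m, q) :=
  mxderivn r Y t + \sum_(j < r) A j t *m mxderivn j Y t.

(* Applied to z - y of norm 0, continuity forces B to depend only on the
   restriction of its argument to [a, b]. *)
Definition continuous_linear p (s m l : nat)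
    (B : (R -> 'cV[R[i]]_m) -> 'cV[R[i]]_l) : Prop :=
  (forall (c : R[i]) (y z : R -> 'cV[R[i]]_m),
     sobolev_mx p s y -> sobolev_mx p s z ->
     B (fun t => c *: y t + z t) = c *: B y + B z) /\
  (forall y : R -> 'cV[R[i]]_m, sobolev_mx p s y ->
     forall e : R, 0 < e -> exists2 d : R, 0 < d &
       forall z : R -> 'cV[R[i]]_m, sobolev_mx p s z ->
         (sobolev_mx_norm p s (fun t => z t - y t)%R < d%:E)%E ->
         \sum_(j < l) cabs (B z j 0 - B y j 0) < e).

Definition strong_cvg p (n m r l : nat)
    (A : 'I_r -> R -> 'M[R[i]]_m) (B : (R -> 'cV[R[i]]_m) -> 'cV[R[i]]_l)
    (Ak : nat -> 'I_r -> R -> 'M[R[i]]_m)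
    (Bk : nat -> (R -> 'cV[R[i]]_m) -> 'cV[R[i]]_l) : Prop :=
  forall y : R -> 'cV[R[i]]_m, sobolev_mx p (n + r) y ->
    ((fun k => sobolev_mx_norm p n
        (fun t => diffop (Ak k) y t - diffop A y t)) @ \oo --> 0%E) /\
    ((fun k => Bk k y) @ \oo --> B y).

Definition cauchy_problem p (n m r : nat) (A : 'I_r -> R -> 'M[R[i]]_m)
    (i : 'I_r) (Y : R -> 'M[R[i]]_m) : Prop :=
  [/\ sobolev_mx p (n + r) Y,
      (if n == 0%N
       then {ae @lebesgue_measure R, forall t, t \in `]a, b[ ->
               diffop A Y t = 0}
       else forall t, t \in `]a, b[ -> diffop A Y t = 0)
    & forall j : 'I_r, mxderivn j Y a = (i == j)%:R%:M].

(* "The" solution: it is unique on [a, b], and xget picks one of its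
   extensions to R. *)
Definition fundamental_solution p (n m r : nat) (A : 'I_r -> R -> 'M[R[i]]_m)
    (i : 'I_r) : R -> 'M[R[i]]_m :=
  xget (fun=> 0) [set Y | cauchy_problem p n A i Y].

Definition apply_cols (m l : nat) (B : (R -> 'cV[R[i]]_m) -> 'cV[R[i]]_l)
    (Y : R -> 'M[R[i]]_m) : 'M[R[i]]_(l, m) :=
  \matrix_(i, j) B (fun t => col j (Y t)) i 0.

Lemma sum_ord_const (r m : nat) : (\sum_(i < r) m = r * m)%N.
Proof. by rewrite sum_nat_const card_ord. Qed.

Definition charmx p (n m r l : nat) (A : 'I_r -> R -> 'M[R[i]]_m)
    (B : (R -> 'cV[R[i]]_m) -> 'cV[R[i]]_l) : 'M[R[i]]_(l, r * m) :=
  castmx (erefl l, sum_ord_const r m)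
    (\mxrow_(i < r) apply_cols B (fundamental_solution p n A i)).

End MatrixFunctions.

(* Main.v *)
(* Strong convergence, tested on the polynomials (t - a)^q / q! times basis
   vectors, already forces A_q(., k) -> A_q in W_p^n for every q < r. Let Y and
   Y^k be fundamental solutions of the limit and of the k-th equation with the
   same initial data. Then Y^k - Y solves the k-th equation with zero data and
   right-hand side sum_j (A_j - A_j(., k)) Y^(j), which tends to 0 in W_p^n, so
   Gronwall's inequality and an induction on the order of smoothness give
   Y^k -> Y in W_p^(n+r). Finally
     B(k) Y^k - B Y = (B(k) - B)(Y^k - Y) + B (Y^k - Y) + (B(k) - B) Y,
   where the first term tends to 0 because pointwise convergent continuous
   operators on a complete space are equicontinuous; a gliding hump shows this.
   Membership in W_p^s is handled through iterated primitives, which avoids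
   derivatives defined only almost everywhere. *)

From HB Require Import structures.
Require Import Defs.
From mathcomp Require Import all_boot all_order all_algebra.
From mathcomp Require Import all_classical all_reals all_analysis.
From mathcomp Require Import measurable_realfun ess_sup_inf.
From mathcomp Require Import ring lra.

Set Implicit Arguments.
Unset Strict Implicit.
Unset Printing Implicit Defensive.

Import Order.TTheory GRing.Theory Num.Theory.

Local Open Scope classical_set_scope.
Local Open Scope ring_scope.

(** Two obstacles shape the proof. For n = 0 the coefficients are merely integrable, so the equation
    holds only almost everywhere. The estimates on solutions therefore use kernels in L_1, with L_p
    entering through its inclusion in L_1, and the fundamental theorem of calculus is required for
    absolutely continuous functions. Second, the given norm involves [derivn_on s y], a pointwise
    derivative with a default value. Membership in the space requires this total function to be
    Borel, so the set of points of differentiability has to be shown measurable. Sizes are relations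
    (y has size at most c) instead of norms in the extended reals, and constants are quantified
    before the functions they serve, which gives uniformity in k. The gliding hump then asks only
    that series with geometrically decreasing sizes converge, so no quotient by null sets and no
    Banach space structure is built. The solution picked by [xget] is arbitrary: the estimates hold
    for every solution of the Cauchy problem. *)

Lemma ae_imp {R : realType} (P Q : R -> Prop) : (forall x, P x -> Q x) ->
  {ae @lebesgue_measure R, forall x, P x} ->
  {ae @lebesgue_measure R, forall x, Q x}.
Proof.
by move=> PQ; apply: filterS; first exact: (ae_filter_ringOfSetsType lebesgue_measure).
Qed.

Lemma ae_and {R : realType} (P Q : R -> Prop) :
  {ae @lebesgue_measure R, forall x, P x} ->
  {ae @lebesgue_measure R, forall x, Q x} ->
  {ae @lebesgue_measure R, forall x, P x /\ Q x}.
Proof.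
move=> aeP aeQ; apply: filterS2 aeP aeQ => //.
exact: (ae_filter_ringOfSetsType lebesgue_measure).
Qed.

(** The lock keeps conversion from unfolding the Lebesgue integral. *)
HB.lock Definition rint {R : realType} (a t : R) (f : R -> R) : R :=
  \int[@lebesgue_measure R]_(x in `[a, t]) f x.

(** * Integrals over [a, t] *)

Section RealIntegral.
Context {R : realType}.
Notation mu := (@lebesgue_measure R).
Implicit Types (f g h : R -> R) (a b t u v x : R).

Definition integrable_on a b f : Prop := mu.-integrable `[a, b] (EFin \o f).

Variables a b : R.
Hypothesis hab : a < b.
Local Notation L1 := (integrable_on a b).

Lemma L1D f g : L1 f -> L1 g -> L1 (fun x => f x + g x).
Proof. by move=> lf lg; apply: eq_integrable (integrableD _ lf lg). Qed.

Lemma L1Z k f : L1 f -> L1 (fun x => k * f x).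
Proof. by move=> lf; apply: eq_integrable (integrableZl _ k lf). Qed.

Lemma L1N f : L1 f -> L1 (fun x => - f x).
Proof. by move=> lf; apply: eq_integrable (integrableN lf). Qed.

Lemma L1B f g : L1 f -> L1 g -> L1 (fun x => f x - g x).
Proof. by move=> lf lg; exact: L1D lf (L1N lg). Qed.

Lemma L1_norm f : L1 f -> L1 (fun x => `|f x|).
Proof. by move=> lf; exact: (integrable_abse lf). Qed.

Lemma L1_measurable f : L1 f -> measurable_fun `[a, b] f.
Proof. by move=> lf; apply/measurable_EFinP; exact: measurable_int lf. Qed.

Lemma L1_le f g : measurable_fun `[a, b] f ->
  (forall x, x \in `[a, b] -> `|f x| <= g x) -> L1 g -> L1 f.
Proof.
move=> mf fg; apply: le_integrable => //; first exact/measurable_EFinP.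
move=> x /= xab; rewrite lee_fin; apply: le_trans (ler_norm _).
exact: fg.
Qed.

Lemma L1_cst k : L1 (fun=> k).
Proof.
apply/integrableP; split; first exact: measurable_cst.
by rewrite integral_cst//= lebesgue_measure_itv/= lte_fin hab -EFinD -EFinM ltry.
Qed.

Lemma L1_bnd f M : measurable_fun `[a, b] f ->
  (forall x, x \in `[a, b] -> `|f x| <= M) -> L1 f.
Proof. by move=> mf fM; apply: (L1_le mf fM); exact: L1_cst. Qed.

Lemma L1M f g M : L1 f -> measurable_fun `[a, b] g ->
  (forall x, x \in `[a, b] -> `|g x| <= M) -> L1 (fun x => f x * g x).
Proof.
move=> lf mg gM; apply: (@L1_le _ (fun x => M * `|f x|)); last first.
  exact/L1Z/L1_norm.
- by move=> x xab; rewrite normrM mulrC ler_wpM2r// gM.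
- by apply: measurable_funM => //; exact: L1_measurable.
Qed.

Lemma L1_sum (I : Type) (s : seq I) (P : pred I) (F : I -> R -> R) :
  (forall i, P i -> L1 (F i)) -> L1 (fun x => \sum_(i <- s | P i) F i x).
Proof.
move=> lF; elim: s => [|i s IH].
  by under eq_fun do rewrite big_nil; exact: L1_cst.
under eq_fun do rewrite big_cons.
by case Pi: (P i) => //; apply: L1D => //; exact: lF.
Qed.

Lemma L1_sub f u v : a <= u -> v <= b -> L1 f ->
  mu.-integrable `[u, v] (EFin \o f).
Proof.
move=> au vb; apply: integrableS => //; apply: subset_itv; rewrite bnd_simp//.
Qed.

Lemma rint0 f : rint a a f = 0.
Proof. by rewrite rint.unlock set_itv1 Rintegral_set1. Qed.

Lemma rintD f g t : t <= b -> L1 f -> L1 g ->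
  rint a t (fun x => f x + g x) = rint a t f + rint a t g.
Proof. by move=> tb lf lg; rewrite rint.unlock RintegralD//; exact: L1_sub. Qed.

Lemma rintB f g t : t <= b -> L1 f -> L1 g ->
  rint a t (fun x => f x - g x) = rint a t f - rint a t g.
Proof. by move=> tb lf lg; rewrite rint.unlock RintegralB//; exact: L1_sub. Qed.

Lemma rintZ k f t : t <= b -> L1 f ->
  rint a t (fun x => k * f x) = k * rint a t f.
Proof. by move=> tb lf; rewrite rint.unlock RintegralZl//; exact: L1_sub. Qed.

Lemma rint_sum (I : Type) (s : seq I) (P : pred I) (F : I -> R -> R) t :
  t <= b -> (forall i, P i -> L1 (F i)) ->
  rint a t (fun x => \sum_(i <- s | P i) F i x) =
  \sum_(i <- s | P i) rint a t (F i).
Proof.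
move=> tb lF; elim: s => [|i s IH].
  rewrite big_nil; under [X in rint _ _ X]eq_fun do rewrite big_nil.
  by rewrite rint.unlock Rintegral_cst// mul0r.
rewrite big_cons; under [X in rint _ _ X]eq_fun do rewrite big_cons.
case Pi: (P i) => //; rewrite rintD//; [by rewrite IH|exact: lF|exact: L1_sum].
Qed.

Lemma eq_rint f g t : t <= b -> (forall x, x \in `[a, b] -> f x = g x) ->
  rint a t f = rint a t g.
Proof.
move=> tb fg; rewrite rint.unlock; apply: eq_Rintegral => x; rewrite inE/= in_itv/= => /andP[ax xt].
by apply: fg; rewrite in_itv/= ax (le_trans xt).
Qed.

Lemma ae_eq_rint f g t : t <= b -> L1 f -> L1 g ->
  {ae mu, forall x, x \in `[a, b] -> f x = g x} ->
  rint a t f = rint a t g.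
Proof.
move=> tb lf lg fg; rewrite rint.unlock; congr fine; apply: ae_eq_integral => //.
- exact: (measurable_int _ (L1_sub _ tb lf)).
- exact: (measurable_int _ (L1_sub _ tb lg)).
- apply: ae_imp fg => x fgx; rewrite /= in_itv/= => /andP[ax xt].
  by rewrite fgx// in_itv/= ax (le_trans xt).
Qed.

Lemma rint_sub f u v : a <= u -> u <= v -> v <= b -> L1 f ->
  rint a v f - rint a u f = \int[mu]_(x in `]u, v]) f x.
Proof.
move=> au uv vb lf; rewrite rint.unlock Rintegral_itvB//.
exact: L1_sub.
Qed.

Lemma L1_sub' f u v : a <= u -> v <= b -> L1 f ->
  mu.-integrable `]u, v] (EFin \o f).
Proof.
move=> au vb lf; apply: integrableS (L1_sub au vb lf) => //.
by apply: subset_itv; rewrite bnd_simp.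
Qed.

Lemma rint_norm f u v : a <= u -> u <= v -> v <= b -> L1 f ->
  `|rint a v f - rint a u f| <= rint a v (fun x => `|f x|) - rint a u (fun x => `|f x|).
Proof.
move=> au uv vb lf; rewrite !rint_sub//; last exact: L1_norm.
by apply: le_normr_Rintegral => //; exact: L1_sub'.
Qed.

(** Increments from u to v, rather than integrals from a, are what [itv_principle] can add up over
    short adjacent intervals. *)
Lemma le_rint f g u v : a <= u -> u <= v -> v <= b -> L1 f -> L1 g ->
  (forall x, u < x <= v -> f x <= g x) ->
  rint a v f - rint a u f <= rint a v g - rint a u g.
Proof.
move=> au uv vb lf lg fg; rewrite !rint_sub//.
by apply: le_Rintegral => [||| x /=]; [|exact: L1_sub'..|rewrite in_itv/= => /fg].
Qed.

Lemma le_rint0 f g t : t \in `[a, b] -> L1 f -> L1 g ->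
  (forall x, x \in `[a, b] -> f x <= g x) -> rint a t f <= rint a t g.
Proof.
rewrite in_itv/= => /andP[ta tb] lf lg fg.
have := @le_rint f g a t (lexx a) ta tb lf lg; rewrite !rint0 !subr0; apply.
move=> x /andP[ax xt]; apply: fg; rewrite in_itv/= (ltW ax).
exact: le_trans tb.
Qed.

Lemma rint_ge0 f t : (forall x, x \in `[a, b] -> 0 <= f x) -> t <= b ->
   0 <= rint a t f.
Proof.
move=> f0 tb; rewrite rint.unlock; apply: Rintegral_ge0 => x /=; rewrite in_itv/= => /andP[ax xt].
by apply: f0; rewrite in_itv/= ax (le_trans xt).
Qed.

Lemma rint_cst k t : a <= t -> rint a t (fun=> k) = k * (t - a).
Proof.
move=> at_; rewrite rint.unlock Rintegral_cst//= lebesgue_measure_itv/= lte_fin.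
case: ltP => /= ta; first by [].
by have -> : t = a; [apply/le_anti; rewrite ta at_|rewrite subrr]. 
Qed.


(** Absolute continuity of the integral, for general measurable sets because [rint_rabs_cont]
    applies it to finite unions of intervals. *)
Lemma rint_small f : L1 f -> forall e : R, 0 < e -> exists2 d : R, 0 < d &
  forall E, measurable E -> E `<=` `[a, b] -> (mu E < d%:E)%E ->
    \int[mu]_(x in E) `|f x| < e.
Proof.
move=> lf e e0.
have lfT : mu.-integrable setT (EFin \o (f \_ `[a, b])).
  by rewrite -restrict_EFin; apply/integrable_restrict => //=; rewrite setTI.
have [d [d0 H]] := integral_normr_continuous lfT e0.
exists d => // E mE Eab Ed; apply: le_lt_trans (H E mE Ed).
rewrite le_eqVlt; apply/orP; left; apply/eqP.
apply: eq_Rintegral => x; rewrite inE => /Eab xab.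
by rewrite patchE mem_set.
Qed.

Lemma rint_cont f : L1 f -> forall e : R, 0 < e -> exists2 d : R, 0 < d &
  forall u v, a <= u -> u <= v -> v <= b -> v - u < d ->
    `|rint a v f - rint a u f| < e.
Proof.
move=> lf e e0; have [d d0 H] := rint_small lf e0; exists d => // u v au uv vb uvd.
apply: le_lt_trans (rint_norm au uv vb lf) _.
rewrite rint_sub//; last exact: L1_norm.
apply: H => //; first by apply: subset_itv; rewrite bnd_simp.
rewrite lebesgue_measure_itv/= lte_fin; case: ifP => _; last by rewrite lte_fin.
by rewrite -EFinD lte_fin.
Qed.

(** Cousin's lemma in relational form: a relation that can be concatenated and that holds on every
    short interval around each tag x holds on [a, t]. It stands in for compactness and the mean
    value theorem. The proof shows that the supremum of the reachable points is b. *)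
Lemma itv_principle (P : R -> R -> Prop) :
  (forall u v w, a <= u -> u <= v -> v <= w -> w <= b -> P u v -> P v w -> P u w) ->
  (forall x, x \in `[a, b] -> exists2 d : R, 0 < d &
     forall u v, a <= u -> u <= x -> x <= v -> v <= b -> v - u < d -> P u v) ->
  forall t, t \in `[a, b] -> P a t.
Proof.
move=> Ptrans Ploc.
(* Requiring [P a s] for all s up to t makes S an initial segment of [a, b]. *)
pose S := [set t | t \in `[a, b] /\ forall s, a <= s <= t -> P a s].
have Paa : P a a.
  have [|d d0 H] := Ploc a; first by rewrite in_itv/= lexx ltW.
  by apply: H; rewrite ?subrr// ltW.
have Sa : S a.
  split; first by rewrite in_itv/= lexx ltW.
  by move=> s /le_anti <-.
have Sub : ubound S b by move=> t [+ _]; rewrite in_itv/= => /andP[].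
have Ssup : has_sup S by split; [exists a|exists b].
set s := sup S.
have as_ : a <= s by apply: sup_upper_bound.
have sb : s <= b by apply: sup_le_ub => //; exists a.
have sab : s \in `[a, b] by rewrite in_itv/= as_.
have [d d0 H] := Ploc s sab.
have [t [tab tP] st] := sup_adherent d0 Ssup; rewrite -/s in st.
have ts : t <= s by apply: sup_upper_bound.
have at_ : a <= t by move: tab; rewrite in_itv/= => /andP[].
(* The interval [t, v] contains s and is shorter than d, so it is admissible for the tag s;
   transitivity through t gives the claim. *)
have HS v : s <= v -> v <= b -> v < t + d -> P a v.
  move=> sv vb vd; apply: (@Ptrans _ t) => //.
  - exact: le_trans sv.
  - by apply: tP; rewrite at_ lexx.
  - by apply: H => //; lra.
have {}HS v : a <= v -> v <= b -> v < t + d -> P a v.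
  move=> av vb vd; have [sv|vs] := leP s v; first exact: HS.
  have [v' [_ v'P] vv'] : exists2 v', S v' & v < v'.
    have /(sup_adherent) : 0 < s - v by rewrite subr_gt0.
    by move=> /(_ _ Ssup) [v' Sv']; rewrite -/s subKr; exists v'.
  by apply: v'P; rewrite av ltW.
have std : s < t + d by rewrite -ltrBlDr.
have bs : b <= s.
  rewrite leNgt; apply/negP => sb'.
  pose v := Num.min b ((s + (t + d)) / 2).
  have sv : s < v by rewrite lt_min sb'/=; lra.
  have vb : v <= b by rewrite ge_min lexx.
  have vtd : v < t + d by rewrite gt_min; apply/orP; right; lra.
  suff : v <= s by rewrite leNgt sv.
  apply: sup_upper_bound => //; split.
    by rewrite in_itv/= vb (le_trans as_ (ltW sv)).
  move=> w /andP[aw wv]; apply: HS => //; first exact: le_trans vb.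
  exact: le_lt_trans vtd.
move=> w; rewrite in_itv/= => /andP[aw wb]; apply: HS => //.
by apply: le_lt_trans std; apply: le_trans bs.
Qed.

(* For the weight e^(4H), H the primitive of h, the Volterra operator with
   kernel h is a contraction with ratio 1/2. *)
Lemma rint_expR h t : L1 h -> (forall x, x \in `[a, b] -> 0 <= h x) ->
  t \in `[a, b] ->
  rint a t (fun x => h x * expR (4 * rint a x h)) <=
  (expR (4 * rint a t h) - 1) / 2.
Proof.
move=> lh h0; set H := fun t => rint a t h.
have Hmono u v : a <= u -> u <= v -> v <= b -> H u <= H v.
  move=> au uv vb.
  have := @le_rint (fun=> 0) h _ _ au uv vb (L1_cst 0) lh.
  rewrite !rint_cst// ?(le_trans au)// !mul0r subrr subr_ge0; apply.
  move=> x /andP[ux xv]; apply: h0; rewrite in_itv/= (le_trans xv vb) andbT.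
  by apply: ltW; apply: le_lt_trans ux.
have H0 u : u \in `[a, b] -> 0 <= H u.
  rewrite in_itv/= => /andP[au ub]; rewrite -[leLHS](rint0 h); exact: Hmono.
have mE : measurable_fun `[a, b] (fun x => expR (4 * H x)).
  apply: measurableT_comp => //; apply: measurable_funM => //.
  apply: subspace_continuous_measurable_fun => //.
  by rewrite /H rint.unlock; exact: parameterized_integral_continuous (ltW hab) lh.
have lE : L1 (fun x => h x * expR (4 * H x)).
  apply: (@L1M _ _ (expR (4 * H b))) => // x xab.
  rewrite ger0_norm ?expR_ge0// ler_expR ler_wpM2l//.
  by move: xab; rewrite in_itv/= => /andP[ax xb]; apply: Hmono.
move=> tab.
pose P u v : Prop := rint a v (fun x => h x * expR (4 * H x)) -
   rint a u (fun x => h x * expR (4 * H x)) <= (expR (4 * H v) - expR (4 * H u)) / 2.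
suff : P a t by rewrite /P rint0 subr0 /H rint0 mulr0 expR0.
apply: (itv_principle _ _ tab) => [u v w _ _ _ _|x xab]; first by rewrite /P; lra.
(* If H grows by less than 1/8 on [u, v], then q < 1/2 and e^q <= 2. The integrand is then at most 2
   E h, and its integral 2 E (q / 4) is at most E (e^q - 1) / 2. The factor 4 in the weight is thus
   what produces the ratio 1/2. *)
have e0 : 0 < 8^-1 :> R by lra.
have [d d0 Hd] := rint_cont lh e0.
exists d => // u v au ux xv vb uvd; rewrite /P.
have uv : u <= v by apply: le_trans xv.
have {}Hd : H v - H u < 8^-1.
  by apply: le_lt_trans (Hd _ _ au uv vb uvd); exact: ler_norm.
have Huv := Hmono _ _ au uv vb.
set E := expR (4 * H u); set q := 4 * (H v - H u).
have E0 : 0 < E by exact: expR_gt0.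
have Eq : expR (4 * H v) = E * expR q by rewrite -expRD /q; congr expR; ring.
have q1 : 1 + q <= expR q by exact: expR_ge1Dx.
have Ev : expR (4 * H v) <= 2 * E.
  rewrite Eq mulrC ler_wpM2r ?(ltW E0)//.
  have : 1 + (- q) <= expR (- q) by exact: expR_ge1Dx.
  rewrite expRN => Nq.
  rewrite -[expR q]invrK -[2]invrK lef_pV2 ?posrE ?invr_gt0 ?expR_gt0//.
  by apply: le_trans Nq; rewrite /q; lra.
apply: (@le_trans _ _ (2 * E * H v - 2 * E * H u)); last first.
  by rewrite Eq; move: q1; rewrite /q; nra.
rewrite -!rintZ//; last exact: le_trans vb.
apply: le_rint => //; first exact: L1Z.
move=> y /andP[uy yv]; rewrite mulrC ler_wpM2r//.
  apply: h0; rewrite in_itv/= (le_trans yv vb) andbT.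
  by apply: ltW; apply: le_lt_trans uy.
apply: le_trans Ev; rewrite ler_expR ler_wpM2l//.
apply: Hmono => //; exact: le_trans (ltW uy).
Qed.

End RealIntegral.

(** * Absolute continuity and the fundamental theorem of calculus *)

Section RealDerivative.
Context {R : realType}.
Notation mu := (@lebesgue_measure R).
Implicit Types (f g h : R -> R) (t u v x : R).

Variables a b : R.

(** Derivative relative to [a, b] without quotients: t = x is harmless, end points need no separate
    treatment, and no default value enters. *)
Definition rhasder f x l := forall e : R, 0 < e -> exists2 d : R, 0 < d &
  forall t, t \in `[a, b] -> `|t - x| < d ->
    `|f t - f x - l * (t - x)| <= e * `|t - x|.

Definition rcont f x := forall e : R, 0 < e -> exists2 d : R, 0 < d &
  forall t, t \in `[a, b] -> `|t - x| < d -> `|f t - f x| < e.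

Definition rabs_cont f := forall e : R, 0 < e -> exists2 d : R, 0 < d &
  forall (N : nat) (u v : 'I_N -> R),
    (forall i, [/\ a <= u i, u i <= v i & v i <= b]) ->
    (forall i j, i != j -> v i <= u j \/ v j <= u i) ->
    \sum_(i < N) (v i - u i) < d ->
    \sum_(i < N) `|f (v i) - f (u i)| < e.

Hypothesis hab : a < b.
Local Notation L1 := (integrable_on a b).

Lemma rhasderD f g x l m : rhasder f x l -> rhasder g x m ->
  rhasder (fun t => f t + g t) x (l + m).
Proof.
move=> fl gm e e0; have e20 : 0 < e / 2 by rewrite divr_gt0.
have [d d0 Hd] := fl _ e20; have [d' d'0 Hd'] := gm _ e20.
exists (Num.min d d'); first by rewrite lt_min d0.
move=> t tab; rewrite lt_min => /andP[td td'].
have -> : f t + g t - (f x + g x) - (l + m) * (t - x) =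
  (f t - f x - l * (t - x)) + (g t - g x - m * (t - x)) by ring.
apply: le_trans (ler_normD _ _) _.
have := Hd t tab td; have := Hd' t tab td'; lra.
Qed.

Lemma rhasderZ k f x l : rhasder f x l -> rhasder (fun t => k * f t) x (k * l).
Proof.
move=> fl e e0; have k0 : 0 < 1 + `|k| by rewrite ltr_pwDl.
have [d d0 Hd] := fl _ (divr_gt0 e0 k0).
exists d => // t tab td.
have -> : k * f t - k * f x - k * l * (t - x) = k * (f t - f x - l * (t - x)) by ring.
rewrite normrM; apply: le_trans (ler_wpM2l (normr_ge0 _) (Hd t tab td)) _.
rewrite mulrA ler_wpM2r// mulrCA ler_piMr ?(ltW e0)// ler_pdivrMr// mul1r.
by rewrite ler_wpDl.
Qed.

Lemma rhasder_cst k x : rhasder (fun=> k) x 0.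
Proof.
move=> e e0; exists 1 => // t _ _.
by rewrite subrr mul0r subrr normr0 mulr_ge0// ltW.
Qed.

Lemma rhasderB f g x l m : rhasder f x l -> rhasder g x m ->
  rhasder (fun t => f t - g t) x (l - m).
Proof.
move=> fl gm; have := rhasderD fl (rhasderZ (-1) gm).
by under [X in rhasder X]eq_fun do rewrite mulN1r; rewrite mulN1r.
Qed.

Lemma rhasder_cont f x l : rhasder f x l -> rcont f x.
Proof.
move=> fl e e0; have [d d0 Hd] := fl 1 ltr01.
have l0 : 0 < 1 + `|l| by rewrite ltr_pwDl.
exists (Num.min d (e / (1 + `|l|))); first by rewrite lt_min d0 divr_gt0.
move=> t tab; rewrite lt_min => /andP[td]; rewrite ltr_pdivlMr// => te.
rewrite -(subrK (l * (t - x)) (f t - f x)).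
apply: le_lt_trans (ler_normD _ _) _; rewrite normrM.
have := Hd t tab td; nra.
Qed.

Lemma rhasderM f g x l m : rhasder f x l -> rhasder g x m ->
  rhasder (fun t => f t * g t) x (l * g x + f x * m).
Proof.
move=> fl gm e e0.
have K0 : 0 < 1 + `|g x| + `|f x| + `|m| by rewrite !ltr_pwDl.
set K := 1 + `|g x| + `|f x| + `|m| in K0.
have eK : 0 < Num.min 1 (e / (3 * K)) by rewrite lt_min ltr01 divr_gt0// mulr_gt0.
(* With D = |t - x|, the four terms of the expansion below are at most e' D times K, 1, |m| and |f
   x|, in total at most 3 K e' D. The bound e' <= 1 absorbs the term that is quadratic in e'. *)
set e' := Num.min 1 (e / (3 * K)) in eK.
have e'1 : e' <= 1 by rewrite ge_min lexx.
have e'e : e' * (3 * K) <= e by rewrite -ler_pdivlMr ?mulr_gt0// ge_min lexx orbT.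
have [d d0 Hd] := fl _ eK; have [d' d'0 Hd'] := gm _ eK.
have [d2 d20 Hd2] := rhasder_cont fl eK.
exists (Num.min d (Num.min d' d2)); first by rewrite !lt_min d0 d'0.
move=> t tab; rewrite !lt_min => /and3P[td td' td2].
have -> : f t * g t - f x * g x - (l * g x + f x * m) * (t - x) =
  (f t - f x - l * (t - x)) * g x + (f t - f x) * (g t - g x - m * (t - x)) +
  (f t - f x) * m * (t - x) + f x * (g t - g x - m * (t - x)) by ring.
have {}Hd := Hd t tab td; have {}Hd' := Hd' t tab td'; have {}Hd2 := ltW (Hd2 t tab td2).
set D := `|t - x| in Hd Hd' *.
have D0 : 0 <= D by exact: normr_ge0.
have H1 : `|(f t - f x - l * (t - x)) * g x| <= e' * D * K.
  rewrite normrM ler_pM//; rewrite /K; have := normr_ge0 (f x); have := normr_ge0 m; lra.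
have H2 : `|(f t - f x) * (g t - g x - m * (t - x))| <= e' * D.
  rewrite normrM; apply: le_trans (ler_pM _ _ Hd2 Hd') _ => //.
  by rewrite ler_piMl// mulr_ge0// ltW.
have H3 : `|(f t - f x) * m * (t - x)| <= e' * D * `|m|.
  rewrite !normrM -/D mulrAC ler_wpM2r// ler_wpM2r//.
have H4 : `|f x * (g t - g x - m * (t - x))| <= e' * D * `|f x|.
  by rewrite normrM mulrC ler_wpM2r.
apply: (@le_trans _ _ (e' * D * (3 * K))); last first.
  by rewrite mulrAC ler_wpM2r.
have H5 : e' * D * (1 + `|m| + `|f x|) <= e' * D * (2 * K).
  rewrite ler_wpM2l ?mulr_ge0 ?(ltW eK)// /K.
  have := normr_ge0 (f x); have := normr_ge0 m;  have := normr_ge0 (g x); lra.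
apply: le_trans (ler_normD _ _) _.
apply: le_trans (lerD (ler_normD _ _) (lexx _)) _.
apply: le_trans (lerD (lerD (ler_normD _ _) (lexx _)) (lexx _)) _.
have := H1; have := H2; have := H3; have := H4; have := H5; lra.
Qed.

Lemma rabs_contD f g : rabs_cont f -> rabs_cont g -> rabs_cont (fun t => f t + g t).
Proof.
move=> fl gm e e0; have e20 : 0 < e / 2 by rewrite divr_gt0.
have [d d0 Hd] := fl _ e20; have [d' d'0 Hd'] := gm _ e20.
exists (Num.min d d'); first by rewrite lt_min d0.
move=> N u v uv dj; rewrite lt_min => /andP[td td'].
have := ltrD (Hd N u v uv dj td) (Hd' N u v uv dj td').
rewrite -splitr -big_split/=; apply: le_lt_trans.
by apply: ler_sum => i _; rewrite opprD addrACA ler_normD.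
Qed.

Lemma rabs_cont_le f g M : 0 <= M ->
  (forall u v, u \in `[a, b] -> v \in `[a, b] -> `|g v - g u| <= M * `|f v - f u|) ->
  rabs_cont f -> rabs_cont g.
Proof.
move=> M0 gf fc e e0; have M1 : 0 < 1 + M by rewrite ltr_pwDl.
have [d d0 Hd] := fc _ (divr_gt0 e0 M1).
exists d => // N u v uv dj /(Hd N u v uv dj); rewrite ltr_pdivlMr// mulr_suml.
apply: le_lt_trans; apply: ler_sum => i _; have [au uivi vb] := uv i.
apply: le_trans (gf _ _ _ _) _; rewrite ?in_itv/=.
- by rewrite au (le_trans uivi).
- by rewrite vb (le_trans au).
- by rewrite mulrC ler_wpM2l// lerDr.
Qed.

Lemma rabs_contB f g : rabs_cont f -> rabs_cont g -> rabs_cont (fun t => f t - g t).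
Proof.
move=> fl gm; apply: rabs_contD => //; apply: (@rabs_cont_le g _ 1) => // u v _ _.
by rewrite mul1r -opprD normrN.
Qed.

Lemma rabs_contM f g M : rabs_cont f -> rabs_cont g ->
  (forall x, x \in `[a, b] -> `|f x| <= M) ->
  (forall x, x \in `[a, b] -> `|g x| <= M) ->
  rabs_cont (fun t => f t * g t).
Proof.
move=> fc gc fM gM.
have M0 : 0 <= M.
  by apply: le_trans (fM a _) => //; rewrite in_itv/= lexx ltW.
have K0 : 0 < 2 * (1 + M) by rewrite mulr_gt0// ltr_pwDl.
move=> e e0; have [d d0 Hd] := fc _ (divr_gt0 e0 K0).
have [d' d'0 Hd'] := gc _ (divr_gt0 e0 K0).
exists (Num.min d d'); first by rewrite lt_min d0.
move=> N u v uv dj; rewrite lt_min => /andP[td td'].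
have := ltrD (Hd N u v uv dj td) (Hd' N u v uv dj td').
rewrite -mulrDl ltr_pdivlMr// mulrCA -mulr2n mulr_natl ltrMn2r//=.
rewrite -big_split/= mulr_suml; apply: le_lt_trans.
apply: ler_sum => i _; have [au uivi vb] := uv i.
have uab : u i \in `[a, b] by rewrite in_itv/= au (le_trans uivi).
have vab : v i \in `[a, b] by rewrite in_itv/= vb (le_trans au).
have -> : f (v i) * g (v i) - f (u i) * g (u i) =
 (f (v i) - f (u i)) * g (v i) + f (u i) * (g (v i) - g (u i)) by ring.
apply: le_trans (ler_normD _ _) _; rewrite !normrM.
have := fM _ uab; have := gM _ vab.
have := normr_ge0 (f (v i) - f (u i)); have := normr_ge0 (g (v i) - g (u i)).
nra.
Qed.

Lemma rint_rabs_cont f : L1 f -> rabs_cont (fun t => rint a t f).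
Proof.
move=> lf e e0; have [d d0 Hd] := rint_small lf e0.
exists d => // N u v uv dj uvd.
(* Half-open intervals are disjoint even when the closed ones share an end point. *)
pose F (i : 'I_N) := `]u i, v i]%classic.
have mF i : measurable (F i) by exact: measurable_itv.
have tF : trivIset setT F.
  apply/trivIsetP => i j _ _ /dj; rewrite /F => vu.
  rewrite -subset0 => x [/=]; rewrite !in_itv/= => /andP[ux xv] /andP[uj xvj].
  case: vu => [vu|vu].
    by have := lt_le_trans uj (le_trans xv vu); rewrite ltxx.
  by have := lt_le_trans ux (le_trans xvj vu); rewrite ltxx.
have muF i : mu (F i) = (v i - u i)%:E.
  have [au uivi vb] := uv i.
  rewrite lebesgue_measure_itv/= lte_fin; case: ltP => [|vu]; first by rewrite EFinB.
  by have -> : v i = u i; [apply/le_anti; rewrite vu|rewrite subrr].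
pose D := \big[setU/set0]_(i < N) F i.
have mD : measurable D by exact: bigsetU_measurable.
have Dab : D `<=` `[a, b].
  rewrite /D -bigcup_seq => x [i _] /=; rewrite /F/= !in_itv/=.
  have [au uivi vb] := uv i => /andP[ux xv].
  by rewrite (le_trans xv vb) (le_trans au (ltW ux)).
have /(Hd D mD Dab) : (mu D < d%:E)%E.
  by rewrite measure_semi_additive_ord// (eq_bigr _ (fun i _ => muF i)) sumEFin lte_fin.
apply: le_lt_trans.
have lf' := L1_norm lf.
have mfD : measurable_fun D (fun x => `|f x|).
  by apply: measurable_funS (L1_measurable lf').
rewrite /Rintegral ge0_integral_bigsetU//; last 3 first.
- by rewrite /index_enum -enumT enum_uniq.
- exact: sub_trivIset tF.
- exact/measurable_EFinP.
rewrite -sum_fine; last first.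
  move=> i _; have [au uivi vb] := uv i.
  by apply: integrable_fin_num; [exact: measurable_itv|exact: (L1_sub' au vb lf')].
apply: ler_sum => i _; have [au uivi vb] := uv i.
by apply: le_trans (rint_norm au uivi vb lf) _; rewrite (rint_sub au uivi vb lf').
Qed.

(** For any slope e / (b - a), the bound on the increment is additive over adjacent intervals and
    holds on short intervals around each x, so [itv_principle] makes it global. *)
Lemma zero_der_cst f : (forall x, x \in `[a, b] -> rhasder f x 0) ->
  forall t, t \in `[a, b] -> f t = f a.
Proof.
move=> fd t tab; apply/eqP; rewrite -subr_eq0 -normr_le0.
apply/ler_addgt0Pl => e e0; rewrite addr0.
have e'0 : 0 < e / (b - a) by rewrite divr_gt0// subr_gt0.
pose P u v : Prop := `|f v - f u| <= e / (b - a) * (v - u).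
have : P a t.
  apply: (itv_principle hab _ _ tab) => [u v w _ _ _ _|x xab].
    rewrite /P => Puv Pvw; rewrite -(subrK (f v) (f w)) -addrA.
    by apply: le_trans (ler_normD _ _) _; lra.
  have [d d0 Hd] := fd x xab _ e'0; exists d => // u v au ux xv vb uvd.
  have := Hd u; have := Hd v; rewrite !in_itv/= !mul0r !subr0.
  rewrite au vb (le_trans au (le_trans ux xv)) (le_trans (le_trans ux xv) vb).
  rewrite [`|v - x|]ger0_norm ?subr_ge0// [`|u - x|]distrC.
  rewrite [`|x - u|]ger0_norm ?subr_ge0// [`|f u - f x|]distrC.
  move=> /(_ isT) Hv /(_ isT) Hu.
  have {}Hv : `|f v - f x| <= e / (b - a) * (v - x) by apply: Hv; lra.
  have {}Hu : `|f x - f u| <= e / (b - a) * (x - u) by apply: Hu; lra.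
  rewrite /P -(subrK (f x) (f v)) -addrA.
  by apply: le_trans (ler_normD _ _) _; lra.
rewrite /P => /le_trans; apply; rewrite mulrAC ler_pdivrMr ?subr_gt0//.
rewrite ler_wpM2l// ?(ltW e0)//.
by move: tab; rewrite in_itv/= => /andP[]; lra.
Qed.


(* The exceptional null set is covered by an open set of small measure; the
   intervals tagged in it are controlled by absolute continuity. *)
Lemma ae_zero_der_cst f : rabs_cont f ->
  {ae mu, forall x, x \in `[a, b] -> rhasder f x 0} ->
  forall t, t \in `[a, b] -> f t = f a.
Proof.
move=> fac [N [mN N0' subN]] t tab.
have N0 : mu N = 0%E by exact: N0'.
apply/eqP; rewrite -subr_eq0 -normr_le0.
apply/ler_addgt0Pl => e e0; rewrite addr0.
have e20 : 0 < e / 2 by rewrite divr_gt0.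
have e'0 : 0 < e / 2 / (b - a) by rewrite divr_gt0// subr_gt0.
have [d d0 Hac] := fac _ e20.
have [U [oU NU muU]] : exists U, [/\ open U, N `<=` U & (mu (U `\` N) < d%:E)%E].
  apply: lebesgue_regularity_outer => //; apply: le_lt_trans (ltry 0).
  by rewrite le_eqVlt; apply/orP; left; apply/eqP; exact: N0.
have mU : measurable U by exact: open_measurable.
have {}muU : (mu U < d%:E)%E.
  apply: le_lt_trans muU; rewrite -[leRHS]adde0 -N0 -measureU//; last 2 first.
  - exact: measurableD.
  - by rewrite setDE -setIA setICl setI0.
  apply: le_measure; rewrite ?inE//; [apply: measurableU => //; exact: measurableD|].
  by move=> x Ux; have [Nx|Nx] := pselect (N x); [right|left].
have lU : L1 \1_U.
  apply: (L1_bnd hab (M := 1)) => [|x _]; first exact: measurable_indic.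
  by rewrite indicE; case: (x \in U); rewrite ?normr1 ?normr0.
pose m t := rint a t \1_U.
(* The family collects the intervals whose tags lie in U. Its total length is at most the measure of
   U in [u, v], a bound that survives concatenation, and the rest of the increment of f has slope at
   most e / 2 / (b - a). *)
pose P u v : Prop := exists (n : nat) (us vs : 'I_n -> R),
  [/\ forall i, [/\ u <= us i, us i <= vs i & vs i <= v],
      forall i j, i != j -> vs i <= us j \/ vs j <= us i,
      \sum_(i < n) (vs i - us i) <= m v - m u &
      `|f v - f u| <= e / 2 / (b - a) * (v - u) + \sum_(i < n) `|f (vs i) - f (us i)|].
have : P a t.
  apply: (itv_principle hab _ _ tab) => [u v w au uv vw wb|x xab].
    move=> [n1 [u1 [v1 [H1 D1 S1 F1]]]] [n2 [u2 [v2 [H2 D2 S2 F2]]]].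
    exists (n1 + n2)%N.
    exists (fun i => match fintype.split i with inl j => u1 j | inr j => u2 j end).
    exists (fun i => match fintype.split i with inl j => v1 j | inr j => v2 j end).
    split.
    - move=> i; case: splitP => j _; [have [] := H1 j|have [] := H2 j] => ? ? ?.
        by split => //; apply: le_trans vw.
      by split => //; apply: le_trans uv _.
    - move=> i j; case: splitP => i' ii'; case: splitP => j' jj' ij.
      + by apply: D1; apply: contra_neq ij => ij; apply/val_inj; rewrite /= ii' jj' ij.
      + by left; have [_ _ h1] := H1 i'; have [h2 _ _] := H2 j'; exact: le_trans h2.
      + by right; have [_ _ h1] := H1 j'; have [h2 _ _] := H2 i'; exact: le_trans h2.
      + by apply: D2; apply: contra_neq ij => ij; apply/val_inj; rewrite /= ii' jj' ij.
    - rewrite big_split_ord/=.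
      under eq_bigr do rewrite (unsplitK (inl _)).
      under [X in _ + X]eq_bigr do rewrite (unsplitK (inr _)).
      by move: S1 S2; lra.
    - rewrite big_split_ord/=.
      under eq_bigr do rewrite (unsplitK (inl _)).
      under [X in _ <= _ + (_ + X)]eq_bigr do rewrite (unsplitK (inr _)).
      rewrite -(subrK (f v) (f w)) -addrA.
      apply: le_trans (ler_normD _ _) _; move: F1 F2; lra.
  (* Around a tag in U a short interval lies inside U and enters the family whole. A tag outside U
     avoids the null set N, so the derivative there is 0 and the empty family suffices. *)
  have [xU|xU] := pselect (U x).
    have [d' /= d'0 Hd'] := (nbhs_ballP _ _).1 (open_nbhs_nbhs (conj oU xU)).
    exists d' => // u v au ux xv vb uvd.
    exists 1%N, (fun=> u), (fun=> v); rewrite !big_ord1; split => //.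
    - by split => //; exact: le_trans xv.
    - by move=> i j; rewrite !ord1.
    - have -> : v - u = rint a v (fun=> 1) - rint a u (fun=> 1).
        rewrite !rint_cst ?(le_trans au (le_trans ux xv))//; lra.
      apply: (le_rint au (le_trans ux xv) vb (L1_cst hab 1) lU).
      move=> y /andP[uy yv]; rewrite indicE mem_set//; apply: Hd'.
      rewrite /ball/= ltr_norml; apply/andP; split; lra.
    - by rewrite lerDr mulr_ge0// ?subr_ge0 ?(le_trans ux xv)// ltW.
  have xd : rhasder f x 0.
    by apply: contrapT => xd; apply/xU/NU/subN => /= /(_ xab).
  have [d' d'0 Hd] := xd _ e'0; exists d' => // u v au ux xv vb uvd.
  exists 0%N, (fun=> 0), (fun=> 0); rewrite !big_ord0 addr0; split => //.
  - by case.
  - by case.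
  - rewrite subr_ge0 -subr_ge0.
    have := @le_rint _ a b (fun=> 0) \1_U u v au (le_trans ux xv) vb (L1_cst hab 0) lU.
    rewrite !rint_cst// ?(le_trans au (le_trans ux xv))// !mul0r subrr.
    by apply => y _; rewrite indicE.
  have := Hd u; have := Hd v; rewrite !in_itv/= !mul0r !subr0.
  rewrite au vb (le_trans au (le_trans ux xv)) (le_trans (le_trans ux xv) vb).
  rewrite [`|v - x|]ger0_norm ?subr_ge0// [`|u - x|]distrC.
  rewrite [`|x - u|]ger0_norm ?subr_ge0// [`|f u - f x|]distrC.
  move=> /(_ isT) Hv /(_ isT) Hu.
  have {}Hv : `|f v - f x| <= e / 2 / (b - a) * (v - x) by apply: Hv; lra.
  have {}Hu : `|f x - f u| <= e / 2 / (b - a) * (x - u) by apply: Hu; lra.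
  rewrite -(subrK (f x) (f v)) -addrA.
  by apply: le_trans (ler_normD _ _) _; lra.
move=> [n [us [vs [H1 D1 S1 F1]]]].
have /andP[at_ tb] : a <= t <= b by move: tab; rewrite in_itv.
have mtd : m t - m a < d.
  rewrite {2}/m rint0 subr0 /m rint.unlock -lte_fin fineK; last first.
    apply: integrable_fin_num => //; exact: L1_sub lU.
  apply: le_lt_trans muU; rewrite integral_indic//.
  by apply: le_measure; rewrite ?inE//; exact: measurableI.
have {}H1 i : [/\ a <= us i, us i <= vs i & vs i <= b].
  by have [? ? h] := H1 i; split => //; exact: le_trans tb.
have := Hac n us vs H1 D1 (le_lt_trans S1 mtd).
have : e / 2 / (b - a) * (t - a) <= e / 2.
  by rewrite mulrAC ler_pdivrMr ?subr_gt0// ler_wpM2l ?(ltW e20)//; lra.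
lra.
Qed.

Lemma ae_neq c : {ae mu, forall x : R, x != c}.
Proof.
exists [set c]; split => //; first exact: lebesgue_measure_set1.
by move=> x /= /negP; rewrite negbK => /eqP.
Qed.

Lemma rint_der_ae f : L1 f ->
  {ae mu, forall x, x \in `[a, b] -> rhasder (fun t => rint a t f) x (f x)}.
Proof.
move=> lf; pose g := f \_ `[a, b].
have lg : mu.-integrable setT (EFin \o g).
  by rewrite /g -restrict_EFin; apply/integrable_restrict => //=; rewrite setTI.
have := @FTC1 R g (BLeft a) _ (open_integrable_locally openT lg).
move=> /(_ (fun y => integrableS _ _ (@subsetT _ _) lg)) H.
(* The point a joins the exceptional set because [FTC1] concerns points strictly beyond the lower
   limit of integration. *)
apply: ae_imp (ae_and (ae_neq a) (H measurableT (fun y => measurable_itv _))) => {H} x [xa Hx] xab.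
have [|dF dFg] := Hx.
  by rewrite lte_fin lt_neqAle eq_sym xa; move: xab; rewrite in_itv/= => /andP[].
move=> {Hx}.
have Fg t : t \in `[a, b] -> rint a t f = \int[mu]_(s in `[a, t]) g s.
  rewrite in_itv/= => /andP[at_ tb]; rewrite rint.unlock; apply: eq_Rintegral => s.
  rewrite inE/= in_itv/= => /andP[as_ st]; rewrite /g patchE mem_set//=.
  by rewrite in_itv/= as_ (le_trans st).
have E : (fun h : R => h^-1 *: (((fun y => \int[mu]_(s in `[a, y]) g s) \o shift x) (h *: 1)
   - \int[mu]_(s in `[a, x]) g s)) =
   (fun h : R => h^-1 *: (\int[mu]_(s in `[a, h + x]) g s - \int[mu]_(s in `[a, x]) g s)).
  by apply/funext => h /=; rewrite [h *: 1]mulr1.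
move: dF dFg; rewrite /derivable E /derive1 => cF limF.
have {}cF : (fun h : R => h^-1 *: (\int[mu]_(s in `[a, h + x]) g s -
   \int[mu]_(s in `[a, x]) g s)) @ 0^' --> g x by rewrite -limF; exact: cF.
move=> e e0; have /cvgrPdist_le/(_ _ e0) := cF.
rewrite near_withinE => /nbhs_ballP[d /= d0 Hd]; exists d => // t tab td.
have gx : g x = f x by rewrite /g patchE mem_set.
have [->|tx] := eqVneq t x; first by rewrite !subrr mulr0 subrr normr0 mulr0.
have := Hd (t - x); rewrite /ball/= sub0r normrN subr_eq0 subrK => /(_ td tx).
rewrite -!Fg// gx => H.
have tx0 : 0 < `|t - x| by rewrite normr_gt0 subr_eq0.
rewrite -(ler_pM2r tx0) -normrM mulrBl in H.
rewrite -normrN opprB; apply: le_trans H; rewrite le_eqVlt; apply/orP; left.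
by apply/eqP; congr Num.norm; rewrite /GRing.scale/=; field; rewrite subr_eq0.
Qed.

Lemma rint_der_cont f x : L1 f -> x \in `[a, b] -> rcont f x ->
  rhasder (fun t => rint a t f) x (f x).
Proof.
move=> lf xab fc e e0; have [d d0 Hd] := fc _ e0; exists d => // t tab td.
have lB : L1 (fun s => f s - f x) by apply: L1B => //; exact: L1_cst.
have key u v : u \in `[a, b] -> v \in `[a, b] -> u <= v ->
    (forall s, u <= s <= v -> `|s - x| < d) ->
    `|rint a v f - rint a u f - f x * (v - u)| <= e * (v - u).
  rewrite !in_itv/= => /andP[au ub] /andP[av vb] uv uvd.
  have -> : f x * (v - u) = rint a v (fun=> f x) - rint a u (fun=> f x).
    by rewrite !rint_cst//; ring.
  have -> : rint a v f - rint a u f - (rint a v (fun=> f x) - rint a u (fun=> f x)) =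
      rint a v (fun s => f s - f x) - rint a u (fun s => f s - f x).
    by rewrite !(rintB (b := b))//; [ring|exact: L1_cst..].
  apply: le_trans (rint_norm au uv vb lB) _.
  have -> : e * (v - u) = rint a v (fun=> e) - rint a u (fun=> e).
    by rewrite !rint_cst//; ring.
  apply: (le_rint au uv vb (L1_norm lB) (L1_cst hab e)).
  move=> s /andP[us sv]; apply/ltW/Hd; last by apply: uvd; rewrite sv ltW.
  by rewrite in_itv/= (le_trans sv)// (le_trans au)// ltW.
have [xt|tx] := leP x t.
  rewrite [`|t - x|]ger0_norm ?subr_ge0//; apply: key => // s /andP[xs st].
  move: td; rewrite !ger0_norm ?subr_ge0//; lra.
rewrite [`|t - x|]ltr0_norm ?subr_lt0// opprB.
have -> : rint a t f - rint a x f - f x * (t - x) =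
   - (rint a x f - rint a t f - f x * (x - t)) by ring.
rewrite normrN.
apply: key => //; first exact: ltW.
move=> s /andP[xs st]; move: td; rewrite distrC [`|s - x|]distrC.
rewrite !ger0_norm ?subr_ge0//; [lra|exact: ltW].
Qed.

Lemma FTC_rabs_cont f g : rabs_cont f -> L1 g ->
  {ae mu, forall x, x \in `[a, b] -> rhasder f x (g x)} ->
  forall t, t \in `[a, b] -> f t = f a + rint a t g.
Proof.
move=> fac lg fg t tab.
have := @ae_zero_der_cst (fun t => f t - rint a t g) _ _ t tab.
rewrite rint0 subr0 => <-; first by rewrite subrK.
  by apply: rabs_contB => //; exact: rint_rabs_cont.
apply: ae_imp (ae_and fg (rint_der_ae lg)) => x [fx gx] xab.
by rewrite -(subrr (g x)); apply: rhasderB; [exact: fx|exact: gx].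
Qed.

Lemma FTC_cont f g : L1 g -> (forall x, x \in `[a, b] -> rcont g x) ->
  (forall x, x \in `[a, b] -> rhasder f x (g x)) ->
  forall t, t \in `[a, b] -> f t = f a + rint a t g.
Proof.
move=> lg gc fg t tab.
have := @zero_der_cst (fun t => f t - rint a t g) _ t tab.
rewrite rint0 subr0 => <-; first by rewrite subrK.
move=> x xab; rewrite -(subrr (g x)).
by apply: rhasderB; [exact: fg|apply: rint_der_cont => //; exact: gc].
Qed.

Lemma rint_rcont f x : L1 f -> x \in `[a, b] -> rcont (fun t => rint a t f) x.
Proof.
move=> lf; rewrite in_itv/= => /andP[ax xb] e e0.
have [d d0 Hd] := rint_cont lf e0; exists d => // t; rewrite in_itv/= => /andP[at_ tb].
have [xt|tx] := leP x t; first by rewrite ger0_norm ?subr_ge0// => ?; exact: Hd.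
rewrite ltr0_norm ?subr_lt0// opprB => ?; rewrite distrC; apply: Hd => //.
exact: ltW.
Qed.

Lemma rint_bnd f t : L1 f -> t \in `[a, b] ->
  `|rint a t f| <= rint a b (fun x => `|f x|).
Proof.
move=> lf; rewrite in_itv/= => /andP[at_ tb].
have := rint_norm (lexx a) at_ tb lf; rewrite !rint0 !subr0 => /le_trans; apply.
have := le_rint at_ tb (lexx b) (L1_cst hab 0) (L1_norm lf).
rewrite !rint_cst// ?(ltW hab)// !mul0r subrr subr_ge0; apply => x _; exact: normr_ge0.
Qed.

Lemma rcont_measurable f : (forall x, x \in `[a, b] -> rcont f x) ->
  measurable_fun `[a, b] f.
Proof.
move=> fc; apply: subspace_continuous_measurable_fun => //.
apply/subspace_continuousP => x /= xab; apply/cvgrPdist_lt => e e0.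
have [d d0 Hd] := fc x xab _ e0.
rewrite near_withinE; apply/nbhs_ballP; exists d => //= t; rewrite /ball/= => xt tab.
by rewrite distrC; apply: Hd => //; rewrite distrC.
Qed.

(** Leibniz rule in integral form. The functions f and g are controlled on [a, b] only, so the proof
    works with [F] and [G], which agree with them there and are given by the integral formula. *)
Lemma rintM f g f' g' : L1 f' -> L1 g' ->
  (forall t, t \in `[a, b] -> f t = f a + rint a t f') ->
  (forall t, t \in `[a, b] -> g t = g a + rint a t g') ->
  L1 (fun t => f' t * g t + f t * g' t) /\
  forall t, t \in `[a, b] ->
    f t * g t = f a * g a + rint a t (fun t => f' t * g t + f t * g' t).
Proof.
move=> lf lg ff gg.
pose F t := f a + rint a t f'; pose G t := g a + rint a t g'.
pose M := `|f a| + rint a b (fun x => `|f' x|) + (`|g a| + rint a b (fun x => `|g' x|)).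
have I0 h : 0 <= rint a b (fun x => `|h x|) by apply: rint_ge0.
have FM x : x \in `[a, b] -> `|F x| <= M.
  move=> xab; apply: le_trans (ler_normD _ _) _.
  have := rint_bnd lf xab; rewrite /M; have := I0 g'; have := normr_ge0 (g a); lra.
have GM x : x \in `[a, b] -> `|G x| <= M.
  move=> xab; apply: le_trans (ler_normD _ _) _.
  have := rint_bnd lg xab; rewrite /M; have := I0 f'; have := normr_ge0 (f a); lra.
have cac k h : L1 h -> rabs_cont (fun t => k + rint a t h).
  move=> lh; apply: (@rabs_cont_le (fun t => rint a t h) _ 1 ler01).
    by move=> u v _ _; rewrite mul1r opprD addrACA subrr add0r.
  exact: rint_rabs_cont.
have mh k h : L1 h -> measurable_fun `[a, b] (fun t => k + rint a t h).
  move=> lh; apply: measurable_funD => //; apply: rcont_measurable => x xab.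
  exact: rint_rcont.
have lFG : L1 (fun t => f' t * G t + F t * g' t).
  apply: L1D; first by apply: (L1M lf _ GM); exact: mh.
  under eq_fun do rewrite mulrC; apply: (L1M lg _ FM); exact: mh.
have lfg : L1 (fun t => f' t * g t + f t * g' t).
  apply: eq_integrable lFG => // x; rewrite inE/= => xab.
  by rewrite /F /G -ff// -gg.
split=> // t tab.
have aab : a \in `[a, b] by rewrite in_itv/= lexx ltW.
rewrite (ff t)// (gg t)// -/(F t) -/(G t).
rewrite (@FTC_rabs_cont (fun t => F t * G t) (fun t => f' t * G t + F t * g' t))//.
- rewrite /F /G !rint0 !addr0; congr +%R.
  move: tab; rewrite in_itv/= => /andP[_ tb]; apply: eq_rint tb _ => x xab.
  by rewrite /F /G -ff// -gg.
- by apply: rabs_contM FM GM; exact: cac.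
- apply: ae_imp (ae_and (rint_der_ae lf) (rint_der_ae lg)) => x [f'x g'x] xab.
  apply: rhasderM; rewrite -[X in rhasder _ _ X]add0r.
    by apply: rhasderD; [exact: rhasder_cst|exact: f'x].
  by apply: rhasderD; [exact: rhasder_cst|exact: g'x].
Qed.

End RealDerivative.

(** * Gronwall's inequality and linear systems *)

Section LinearSystems.
Context {R : realType}.
Notation mu := (@lebesgue_measure R).
Variables a b : R.
Hypothesis hab : a < b.
Local Notation L1 := (integrable_on a b).
Implicit Types (t u v x : R).

Lemma rcontD (f g : R -> R) x : rcont a b f x -> rcont a b g x ->
  rcont a b (fun t => f t + g t) x.
Proof.
move=> fl gm e e0; have e20 : 0 < e / 2 by rewrite divr_gt0.
have [d d0 Hd] := fl _ e20; have [d' d'0 Hd'] := gm _ e20.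
exists (Num.min d d'); first by rewrite lt_min d0.
move=> t tab; rewrite lt_min => /andP[td td'].
rewrite opprD addrACA; apply: le_lt_trans (ler_normD _ _) _.
have := Hd t tab td; have := Hd' t tab td'; lra.
Qed.

Lemma rcont_cst k x : rcont a b (fun=> k) x.
Proof. by move=> e e0; exists 1 => // t _ _; rewrite subrr normr0. Qed.

Lemma primitive_rcont k (f : R -> R) x : L1 f -> x \in `[a, b] ->
  rcont a b (fun t => k + rint a t f) x.
Proof. by move=> lf xab; apply: rcontD; [exact: rcont_cst|exact: rint_rcont]. Qed.

(** The telescoping series converges absolutely. Asking only for bounded partial sums serves both
    the Picard iteration and the completeness of L_p. *)
Lemma bounded_increments_cvg (s : R ^nat) (M : R) :
  (forall n, \sum_(k < n) `|s k.+1 - s k| <= M) -> cvgn s.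
Proof.
move=> sM; have : cvgn (series (telescope s)).
  apply: normed_cvg; apply: nondecreasing_is_cvgn.
    apply/nondecreasing_seqP => n.
    rewrite [leRHS](_ : _ = [normed series (telescope s)] n + `|telescope s n|).
      by rewrite lerDl.
    exact: big_nat_recr.
  exists M => _ [n _ <-]; apply: le_trans (sM n).
  rewrite [leLHS](_ : _ = \sum_(k < n) `|telescope s k|)//; exact: big_mkord.
rewrite telescopeK => /cvg_ex[l sl]; apply/cvg_ex; exists (s 0 + l).
apply: cvg_trans (cvgD (cvg_cst (s 0)) sl); apply: near_eq_cvg.
by apply: nearW => n /=; rewrite /GRing.add_fun/= addrC subrK.
Qed.

Lemma cvgn_sum (I : Type) (s : seq I) (F : nat -> I -> R) (l : I -> R) :
  (forall i, F n i @[n --> \oo] --> l i) ->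
  \sum_(i <- s) F n i @[n --> \oo] --> \sum_(i <- s) l i.
Proof.
move=> Fl; elim: s => [|i s IH].
  by rewrite big_nil; under eq_fun do rewrite big_nil; exact: cvg_cst.
by rewrite big_cons; under eq_fun do rewrite big_cons; exact: cvgD.
Qed.

Lemma rint_dominated (F : nat -> R -> R) (f g : R -> R) t :
  (forall n, measurable_fun `[a, b] (F n)) ->
  (forall x, x \in `[a, b] -> F n x @[n --> \oo] --> f x) ->
  (forall n x, x \in `[a, b] -> `|F n x| <= g x) -> L1 g -> t <= b ->
  rint a t (F n) @[n --> \oo] --> rint a t f.
Proof.
move=> mF Ff Fg lg tb.
have sub : `[a, t] `<=` `[a, b] by apply: subset_itv; rewrite bnd_simp.
have mf : measurable_fun `[a, b] f by apply: measurable_fun_cvg Ff.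
have [] := @dominated_convergence _ _ _ mu `[a, t] (measurable_itv _)
  (fun n => EFin \o F n) (EFin \o f) (EFin \o g).
- by move=> n; apply/measurable_EFinP; exact: measurable_funS (mF n).
- by apply/measurable_EFinP; exact: measurable_funS mf.
- by apply/nearW => x /sub xab; apply/cvg_EFin; [exact: nearW|exact: Ff].
- exact: L1_sub lg.
- by apply/nearW => x n /sub xab; rewrite /= lee_fin; exact: Fg.
move=> lf _ H; rewrite rint.unlock /Rintegral; apply: fine_cvg.
by rewrite fineK//; exact: integrable_fin_num.
Qed.

(* The supremum of phi e^(-4H) is at most c plus half of itself. *)
Lemma gronwall (h phi : R -> R) (c : R) : L1 h -> (forall x, x \in `[a, b] -> 0 <= h x) ->
  measurable_fun `[a, b] phi ->
  (exists M : R, forall x, x \in `[a, b] -> `|phi x| <= M) -> 0 <= c ->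
  (forall t, t \in `[a, b] -> phi t <= c + rint a t (fun x => h x * phi x)) ->
  forall t, t \in `[a, b] -> phi t <= 2 * c * expR (4 * rint a b h).
Proof.
move=> lh h0 mphi [M phiM] c0 Hphi.
pose H t := rint a t h.
have H0 x : x \in `[a, b] -> 0 <= H x.
  by rewrite in_itv/= => /andP[_ xb]; exact: rint_ge0 h0 xb.
have E1 x : x \in `[a, b] -> 1 <= expR (4 * H x).
  by move=> /H0 Hx; rewrite -[leLHS]expR0 ler_expR mulr_ge0.
pose S := [set phi x * expR (- (4 * H x)) | x in `[a, b]].
have supS : has_sup S.
  split; first by exists (phi a * expR (- (4 * H a))); exists a => //=; rewrite in_itv/= lexx ltW.
  exists M => _ [x xab <-]; rewrite expRN -[leRHS]mulr1.
  have M0 : 0 <= M by exact: le_trans (phiM _ xab).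
  have : (expR (4 * H x))^-1 <= 1 by rewrite invf_le1 ?expR_gt0// E1.
  have : phi x <= M by apply: le_trans (phiM _ xab); exact: ler_norm.
  have : 0 <= (expR (4 * H x))^-1 by rewrite invr_ge0 expR_ge0.
  nra.
set m := sup S.
have phim x : x \in `[a, b] -> phi x <= m * expR (4 * H x).
  move=> xab; rewrite -ler_pdivrMr ?expR_gt0// -expRN.
  by apply: sup_upper_bound => //; exists x.
have lhE : L1 (fun x => h x * expR (4 * H x)).
  apply: (@L1M _ _ _ _ _ (expR (4 * rint a b (fun x => `|h x|)))) => //.
    apply: measurableT_comp => //; apply: measurable_funM => //.
    apply: rcont_measurable => x xab; exact: rint_rcont.
  move=> x xab; rewrite ger0_norm ?expR_ge0// ler_expR ler_wpM2l//.
  by apply: le_trans (ler_norm _) _; exact: rint_bnd.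
have lhphi : L1 (fun x => h x * phi x) by apply: L1M phiM.
(* The integral term is at most m (E - 1) / 2 by [rint_expR]; dividing by E >= 1 gives m <= c + m /
   2. Absorbing m / 2 is legitimate because m is finite, phi being bounded. As phi may be negative,
   the sign of m is treated separately. *)
have key : 0 <= m -> m <= 2 * c.
  move=> m0; suff : m <= c + m / 2 by lra.
  apply: sup_le_ub; first by case: supS.
  move=> _ [x /= xab0 <-]; have xab : x \in `[a, b] := xab0.
  rewrite expRN ler_pdivrMr ?expR_gt0//.
  apply: le_trans (Hphi _ xab) _.
  apply: (@le_trans _ _ (c + m * rint a x (fun x => h x * expR (4 * H x)))).
    have /andP[ax xb] : a <= x <= b by move: xab; rewrite in_itv.
    rewrite lerD2l -(rintZ _ xb)//; apply: (le_rint0 xab) => //; first exact: L1Z.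
    by move=> y yab; rewrite mulrCA ler_wpM2l ?h0 ?phim.
  have := rint_expR hab lh h0 xab; rewrite -/(H x) => HE.
  have := E1 _ xab; set E := expR _ in HE *; move=> E1'.
  set I := rint _ _ _ in HE *; nra.
move=> t tab.
have Hmb : expR (4 * H t) <= expR (4 * rint a b h).
  rewrite ler_expR ler_wpM2l//; move: tab; rewrite in_itv/= => /andP[at_ tb].
  have := le_rint at_ tb (lexx b) (L1_cst hab 0) lh.
  rewrite !rint_cst// ?(ltW hab)// !mul0r subrr subr_ge0; apply => x /andP[tx xb].
  by apply: h0; rewrite in_itv/= xb (le_trans at_)// ltW.
have E0 : 0 < expR (4 * H t) by exact: expR_gt0.
have [m0|m0] := leP 0 m.
  by have := phim _ tab; have := key m0; nra.
by have := phim _ tab; nra.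
Qed.

(* Picard iteration: u_(k+1) - u_k is bounded by C 2^-k e^(4H). *)
Lemma linear_system_exists (I : finType) (Q : I -> I -> R -> R) (u0 : I -> R) :
  (forall i j, L1 (Q i j)) ->
  exists u : I -> R -> R,
    (forall i, L1 (fun x => \sum_j Q i j x * u j x)) /\
    (forall i x, x \in `[a, b] -> rcont a b (u i) x) /\
    forall i t, t \in `[a, b] ->
      u i t = u0 i + rint a t (fun x => \sum_j Q i j x * u j x).
Proof.
move=> lQ.
pose h x : R := \sum_i \sum_j `|Q i j x|.
have lh : L1 h by apply: L1_sum => // i _; apply: L1_sum => // j _; exact: L1_norm.
have h0 x : 0 <= h x by apply: sumr_ge0 => i _; apply: sumr_ge0.
pose E t := expR (4 * rint a t h).
have mE : measurable_fun `[a, b] E.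
  apply: measurableT_comp => //; apply: measurable_funM => //.
  by apply: rcont_measurable => x xab; exact: rint_rcont.
have Emax : exists M : R, forall x, x \in `[a, b] -> E x <= M.
  exists (expR (4 * rint a b (fun x => `|h x|))) => x xab.
  rewrite ler_expR ler_wpM2l//.
  by apply: le_trans (ler_norm _) _; exact: rint_bnd.
have [M EM] := Emax.
have E1 x : x \in `[a, b] -> 1 <= E x.
  rewrite in_itv/= => /andP[_ xb]; rewrite -[leLHS]expR0 ler_expR mulr_ge0//.
  exact: rint_ge0.
have lhE : L1 (fun x => h x * E x).
  apply: (L1M lh mE) => x xab; rewrite ger0_norm ?expR_ge0//; exact: EM.
(* The iteration starts at 0, so its first increment is u0, and the factor 2 makes |u0 i| <= C / 2.
   Every later step gains another 1/2 from [rint_expR], and the geometric sums stay below C. *)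
pose C := \sum_i `|u0 i| * 2 .
pose T (u : I -> R -> R) i t := u0 i + rint a t (fun x => \sum_j Q i j x * u j x).
pose U k := iter k T (fun i _ => 0).
have C0 : 0 <= C by apply: sumr_ge0 => i _; rewrite mulr_ge0.
have lQu (u : I -> R -> R) i : (forall j, measurable_fun `[a, b] (u j)) ->
    (exists K : R, forall j x, x \in `[a, b] -> `|u j x| <= K) ->
    L1 (fun x => \sum_j Q i j x * u j x).
  by move=> mu0 [K uK]; apply: L1_sum => // j _; apply: (L1M (lQ i j)) => //; exact: uK.
have Tprop (u : I -> R -> R) : (forall j, measurable_fun `[a, b] (u j)) ->
    (exists K : R, forall j x, x \in `[a, b] -> `|u j x| <= K) ->
    (forall j, measurable_fun `[a, b] (T u j)) /\
    (exists K : R, forall j x, x \in `[a, b] -> `|T u j x| <= K).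
  move=> mu0 uK; split.
    move=> j; apply: rcont_measurable => x xab; apply: primitive_rcont => //.
    exact: lQu.
  exists (\sum_j (`|u0 j| + rint a b (fun x => `|\sum_i Q j i x * u i x|))) => j x xab.
  rewrite (bigD1 j)//= -[leLHS]addr0; apply: lerD.
    apply: le_trans (ler_normD _ _) _; rewrite lerD2l; apply: rint_bnd => //.
    exact: lQu.
  by apply: sumr_ge0 => i _; rewrite addr_ge0// (rint_ge0 (b := b)).
have US k i t : U k.+1 i t = u0 i + rint a t (fun x => \sum_j Q i j x * U k j x).
  by [].
have Uprop k : (forall j, measurable_fun `[a, b] (U k j)) /\
    (exists K : R, forall j x, x \in `[a, b] -> `|U k j x| <= K).
  elim: k => [|k [mk Kk]]; last exact: Tprop.
  by split; [move=> j; exact: measurable_cst|exists 0 => j x _; rewrite normr0].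
have Ustep k i t : t \in `[a, b] -> `|U k.+1 i t - U k i t| <= C / 2 ^+ k.+1 * E t.
  elim: k i t => [|k IH] i t tab.
    rewrite subr0 /U/= /T.
    have -> : (fun x => \sum_j Q i j x * 0) = fun=> 0.
      by apply/funext => x; rewrite big1// => j _; rewrite mulr0.
    have /andP[at_ _] : a <= t <= b by move: tab; rewrite in_itv.
    rewrite rint_cst// mul0r addr0 expr1.
    apply: (@le_trans _ _ (C / 2)).
      rewrite /C (bigD1 i)//= mulrDl mulfK// lerDl divr_ge0//.
      by apply: sumr_ge0 => j _; rewrite mulr_ge0.
    by rewrite ler_peMr ?divr_ge0// E1.
  have /andP[at_ tb] : a <= t <= b by move: tab; rewrite in_itv.
  have [mk Kk] := Uprop k; have [mk1 Kk1] := Uprop k.+1.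
  have -> : U k.+2 i t - U k.+1 i t =
     rint a t (fun x => \sum_j Q i j x * U k.+1 j x - \sum_j Q i j x * U k j x).
    rewrite (rintB tb (lQu _ i mk1 Kk1) (lQu _ i mk Kk)) (US k.+1 i) (US k i).
    by rewrite opprD addrACA subrr add0r.
  have lB : L1 (fun x => \sum_j Q i j x * U k.+1 j x - \sum_j Q i j x * U k j x).
    by apply: L1B; exact: lQu.
  have := rint_norm (lexx a) at_ tb lB; rewrite !rint0 !subr0 => /le_trans; apply.
  apply: (@le_trans _ _ (rint a t (fun x => C / 2 ^+ k.+1 * (h x * E x)))).
    apply: (le_rint0 tab); [exact: L1_norm|exact: L1Z|].
    move=> x xab; rewrite -sumrB.
    apply: le_trans (ler_norm_sum _ _ _) _.
    apply: (@le_trans _ _ (\sum_j `|Q i j x| * (C / 2 ^+ k.+1 * E x))).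
      by apply: ler_sum => j _; rewrite -mulrBr normrM ler_wpM2l// IH.
    rewrite -mulr_suml mulrCA ler_wpM2l ?divr_ge0 ?exprn_ge0//.
    rewrite ler_wpM2r ?expR_ge0//.
    rewrite /h [leRHS](bigD1 i)//= lerDl; apply: sumr_ge0 => j _; exact: sumr_ge0.
  have -> : C / 2 ^+ k.+2 * E t = C / 2 ^+ k.+1 * (E t / 2).
    by rewrite [2 ^+ k.+2]exprS; field; rewrite expf_neq0.
  rewrite (rintZ _ tb)// ler_wpM2l ?divr_ge0 ?exprn_ge0//.
  have := rint_expR hab lh (fun x _ => h0 x) tab; rewrite -/(E t).
  have -> : (fun x => h x * expR (4 * rint a x h)) = (fun x => h x * E x) by [].
  by have := expR_ge0 (4 * rint a t h); rewrite -/(E t); lra.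
have geo k : \sum_(i < k) C / 2 ^+ i.+1 <= C.
  suff -> : \sum_(i < k) C / 2 ^+ i.+1 = C - C / 2 ^+ k.
    by rewrite gerBl divr_ge0// exprn_ge0.
  elim: k => [|k IH]; first by rewrite big_ord0 expr0 divr1 subrr.
  rewrite big_ord_recr/= IH exprS; field.
  by rewrite expf_neq0.
have Ubnd k i t : t \in `[a, b] -> `|U k i t| <= C * E t.
  move=> tab; have -> : U k i t = \sum_(j < k) (U j.+1 i t - U j i t).
    elim: k => [|k IH]; first by rewrite big_ord0.
    by rewrite big_ord_recr/= -IH; rewrite addrC subrK.
  apply: le_trans (ler_norm_sum _ _ _) _.
  apply: (@le_trans _ _ (\sum_(j < k) C / 2 ^+ j.+1 * E t)).
    by apply: ler_sum => j _; exact: Ustep.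
  by rewrite -mulr_suml ler_wpM2r ?expR_ge0.
have Ucvg i t : t \in `[a, b] -> cvgn (fun k => U k i t).
  move=> tab; apply: (@bounded_increments_cvg _ (C * E t)) => n.
  apply: (@le_trans _ _ (\sum_(j < n) C / 2 ^+ j.+1 * E t)).
    by apply: ler_sum => j _; exact: Ustep.
  by rewrite -mulr_suml ler_wpM2r ?expR_ge0.
pose u i t := limn (fun k => U k i t).
have Uu i t : t \in `[a, b] -> U k i t @[k --> \oo] --> u i t by move=> /Ucvg; apply.
have mu i : measurable_fun `[a, b] (u i).
  by apply: (@measurable_fun_cvg _ _ _ _ (fun k => U k i)) => [k|x]; [have [] := Uprop k|exact: Uu].
have ubnd i t : t \in `[a, b] -> `|u i t| <= C * M.
  move=> tab; have Un : `|U k i t| @[k --> \oo] --> `|u i t| by apply: cvg_norm; exact: Uu.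
  rewrite -(cvg_lim _ Un)//; apply: limr_le; first by apply/cvg_ex; exists `|u i t|.
  apply: nearW => k; apply: le_trans (Ubnd k i t tab) _; rewrite ler_wpM2l//; exact: EM.
have lQuu i : L1 (fun x => \sum_j Q i j x * u j x) by apply: lQu => //; exists (C * M).
have fix_u i t : t \in `[a, b] -> u i t = u0 i + rint a t (fun x => \sum_j Q i j x * u j x).
  move=> tab; have /andP[at_ tb] : a <= t <= b by move: tab; rewrite in_itv.
  have U1 : U k.+1 i t @[k --> \oo] --> u i t by rewrite (cvg_shiftS (fun k => U k i t)); exact: Uu.
  apply: (cvg_unique _ U1) => //; rewrite [X in X @ _]/=.
  apply: cvgD; first exact: cvg_cst.
  apply: (rint_dominated _ _ _ (L1Z C lhE) tb).
  - by move=> k; have [mk Kk] := Uprop k; exact: L1_measurable (lQu _ i mk Kk).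
  - by move=> x xab; apply: cvgn_sum => j; apply: cvgM; [exact: cvg_cst|exact: Uu].
  - move=> k x xab; apply: le_trans (ler_norm_sum _ _ _) _.
    apply: (@le_trans _ _ (\sum_j `|Q i j x| * (C * E x))).
      by apply: ler_sum => j _; rewrite normrM ler_wpM2l// Ubnd.
    rewrite -mulr_suml mulrCA ler_wpM2l// ler_wpM2r ?expR_ge0//.
    by rewrite /h [leRHS](bigD1 i)//= lerDl; apply: sumr_ge0 => j _; exact: sumr_ge0.
exists u; split => //; split => // i x xab.
move=> e e0; have [d d0 Hd] := primitive_rcont (u0 i) (lQuu i) xab e0.
by exists d => // t tab td; rewrite !fix_u//; exact: Hd.
Qed.

End LinearSystems.

Local Open Scope complex_scope.

(** * Complex-valued functions and L_p norms *)

Section ComplexModulus.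
Context {R : realType}.
Implicit Types z w : R[i].

Lemma cabsE z : cabs z = Num.sqrt (complex.Re z ^+ 2 + complex.Im z ^+ 2).
Proof. by rewrite /cabs normc_def. Qed.

Lemma cabsC z : (cabs z)%:C = `|z|.
Proof. by rewrite cabsE normc_def. Qed.

Lemma cabs_ge0 z : 0 <= cabs z.
Proof. by rewrite cabsE sqrtr_ge0. Qed.

Lemma cabs0 : cabs (0 : R[i]) = 0.
Proof. by rewrite /cabs normr0. Qed.

Lemma cabsN z : cabs (- z) = cabs z.
Proof. by rewrite /cabs normrN. Qed.

Lemma cabsM z w : cabs (z * w) = cabs z * cabs w.
Proof. by apply: complexI; rewrite rmorphM/= !cabsC normrM. Qed.

Lemma cabsD z w : cabs (z + w) <= cabs z + cabs w.
Proof. by rewrite -lecR rmorphD/= !cabsC ler_normD. Qed.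

Lemma cabsB z w : cabs (z - w) <= cabs z + cabs w.
Proof. by rewrite -[cabs w]cabsN cabsD. Qed.

Lemma cabs_distC z w : cabs (z - w) = cabs (w - z).
Proof. by rewrite -cabsN opprB. Qed.

Lemma cabs_real (x : R) : cabs x%:C = `|x|.
Proof. by rewrite cabsE/= expr0n/= addr0 sqrtr_sqr. Qed.

Lemma cabs_Re z : `|complex.Re z| <= cabs z.
Proof. by rewrite cabsE -sqrtr_sqr ler_wsqrtr// lerDl sqr_ge0. Qed.

Lemma cabs_Im z : `|complex.Im z| <= cabs z.
Proof. by rewrite cabsE -sqrtr_sqr ler_wsqrtr// lerDr sqr_ge0. Qed.

Lemma cabs_le_Re_Im z : cabs z <= `|complex.Re z| + `|complex.Im z|.
Proof.
rewrite cabsE -[leRHS]ger0_norm ?addr_ge0// -sqrtr_sqr ler_wsqrtr//.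
rewrite sqrrD !real_normK ?num_real// lerD2r lerDl.
by rewrite mulrn_wge0// mulr_ge0.
Qed.

Lemma cabs_sum (I : Type) (s : seq I) (P : pred I) (F : I -> R[i]) :
  cabs (\sum_(i <- s | P i) F i) <= \sum_(i <- s | P i) cabs (F i).
Proof.
elim/big_rec2 : _ => [|i y z _ H]; first by rewrite cabs0.
by apply: le_trans (cabsD _ _) _; rewrite lerD2l.
Qed.

Lemma cReD z w : complex.Re (z + w) = complex.Re z + complex.Re w.
Proof. by case: z; case: w. Qed.
Lemma cImD z w : complex.Im (z + w) = complex.Im z + complex.Im w.
Proof. by case: z; case: w. Qed.
Lemma cReN z : complex.Re (- z) = - complex.Re z.
Proof. by case: z. Qed.
Lemma cImN z : complex.Im (- z) = - complex.Im z.
Proof. by case: z. Qed.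
Lemma cReM z w : complex.Re (z * w) = complex.Re z * complex.Re w - complex.Im z * complex.Im w.
Proof. by case: z; case: w. Qed.
Lemma cImM z w : complex.Im (z * w) = complex.Re z * complex.Im w + complex.Im z * complex.Re w.
Proof. by case: z; case: w => a b c d; rewrite /= addrC. Qed.
Lemma Re_sum (I : Type) (s : seq I) (P : pred I) (F : I -> R[i]) :
  complex.Re (\sum_(i <- s | P i) F i) = \sum_(i <- s | P i) complex.Re (F i).
Proof. by apply: (big_morph _ cReD). Qed.
Lemma Im_sum (I : Type) (s : seq I) (P : pred I) (F : I -> R[i]) :
  complex.Im (\sum_(i <- s | P i) F i) = \sum_(i <- s | P i) complex.Im (F i).
Proof. by apply: (big_morph _ cImD). Qed.

End ComplexModulus.

Section LpNorm.
Context {R : realType}.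
Notation mu := (@lebesgue_measure R).
Variables a b : R.
Hypothesis hab : a < b.
Implicit Types (f g : R -> R[i]) (p : \bar R) (c : R).
Local Notation L1 := (integrable_on a b).
Local Notation Lpnorm := (Lpnorm a b).

Definition cmeas f := measurable_fun `[a, b] (fun x => complex.Re (f x)) /\
  measurable_fun `[a, b] (fun x => complex.Im (f x)).

Lemma measurable_sqrt : measurable_fun setT (@Num.sqrt R).
Proof. by apply: continuous_measurable_fun; exact: sqrt_continuous. Qed.

Lemma cmeas_cabs f : cmeas f -> measurable_fun `[a, b] (fun x => cabs (f x)).
Proof.
move=> [mr mi]; under [X in measurable_fun _ X]eq_fun do rewrite cabsE.
apply: measurableT_comp; first exact: measurable_sqrt.
by apply: measurable_funD; apply: measurable_funX.
Qed.

Lemma cmeas_cst z : cmeas (fun=> z).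
Proof. by split; exact: measurable_cst. Qed.

Lemma cmeasD f g : cmeas f -> cmeas g -> cmeas (fun x => f x + g x).
Proof.
move=> [? ?] [? ?]; split.
  by under [X in measurable_fun _ X]eq_fun do rewrite cReD; exact: measurable_funD.
by under [X in measurable_fun _ X]eq_fun do rewrite cImD; exact: measurable_funD.
Qed.

Lemma cmeasM f g : cmeas f -> cmeas g -> cmeas (fun x => f x * g x).
Proof.
move=> [? ?] [? ?]; split.
  by under [X in measurable_fun _ X]eq_fun do rewrite cReM; apply: measurable_funB; exact: measurable_funM.
by under [X in measurable_fun _ X]eq_fun do rewrite cImM; apply: measurable_funD; exact: measurable_funM.
Qed.

Lemma cmeasN f : cmeas f -> cmeas (fun x => - f x).
Proof.
by move=> mf; under eq_fun do rewrite -mulN1r; apply: cmeasM => //; exact: cmeas_cst.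
Qed.

Lemma cmeasB f g : cmeas f -> cmeas g -> cmeas (fun x => f x - g x).
Proof. by move=> mf mg; apply: cmeasD => //; exact: cmeasN. Qed.

Lemma cmeas_sum (I : Type) (s : seq I) (F : I -> R -> R[i]) :
  (forall i, cmeas (F i)) -> cmeas (fun x => \sum_(i <- s) F i x).
Proof.
move=> mF; elim: s => [|i s IH].
  by under eq_fun do rewrite big_nil; exact: cmeas_cst.
by under eq_fun do rewrite big_cons; exact: cmeasD.
Qed.

Lemma cmeas_eq f g : (forall x, x \in `[a, b] -> f x = g x) -> cmeas f -> cmeas g.
Proof.
move=> fg [mr mi]; split; [apply: eq_measurable_fun mr|apply: eq_measurable_fun mi] => x;
  by rewrite inE/= => xab; rewrite fg.
Qed.

Lemma cmeas_powR f (r : R) : cmeas f ->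
  measurable_fun `[a, b] (fun x => (cabs (f x) `^ r)%:E).
Proof.
move=> mf; apply/measurable_EFinP.
apply: (@measurableT_comp _ _ _ _ _ _ (@powR R ^~ r)) => //.
exact: cmeas_cabs.
Qed.

Lemma cmeas_restrict f : cmeas f -> measurable_fun setT ((fun x => cabs (f x)) \_ `[a, b]).
Proof. by move=> /cmeas_cabs mf; apply/(measurable_restrictT _ _).1. Qed.

(** Norms are only ever compared with finite bounds, which removes the root and the value +oo from
    later arguments. *)
Lemma Lpnorm_fin_leP (r : R) f c : 0 < r -> 0 <= c ->
  (Lpnorm r%:E f <= c%:E)%E <->
  (\int[mu]_(x in `[a, b]) (cabs (f x) `^ r)%:E <= (c `^ r)%:E)%E.
Proof.
move=> r0 c0; rewrite /Defs.Lpnorm unlock.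
have -> : (\int[mu]_x (`|(EFin \o (fun x => cabs (f x)) \_ `[a, b]) x| `^ r))%E =
  (\int[mu]_(x in `[a, b]) (cabs (f x) `^ r)%:E)%E.
  rewrite [RHS]integral_mkcond; apply: eq_integral => x _.
  rewrite /= !patchE; case: ifPn => _; first by rewrite ger0_norm ?cabs_ge0.
  by rewrite normr0 powR0// gt_eqF.
set I := (X in (X `^ _ <= _)%E).
have I0 : (0 <= I)%E by apply: integral_ge0 => x _; rewrite lee_fin powR_ge0.
have pos (x : \bar R) : (0 <= x)%E -> x \in `[0%E, +oo%E] by rewrite in_itv/= leey andbT.
split=> H.
  change (I <= (c `^ r)%:E)%E.
  have -> : I = ((I `^ r^-1) `^ r)%E by rewrite -poweRrM mulVf ?gt_eqF// poweRe1.
  rewrite -poweR_EFin; apply: gt0_ler_poweR; rewrite ?(ltW r0) ?pos ?poweR_ge0 ?lee_fin//.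
have -> : c%:E = ((c `^ r)%:E `^ r^-1)%E.
  by rewrite poweR_EFin -powRrM mulfV ?gt_eqF// powRr1.
by apply: gt0_ler_poweR; rewrite ?pos ?lee_fin ?powR_ge0// ?invr_ge0 ltW.
Qed.

Lemma Lpnorm_oo_leP f c : 0 <= c -> (Lpnorm +oo f <= c%:E)%E <->
  {ae mu, forall x, x \in `[a, b] -> cabs (f x) <= c}.
Proof.
move=> c0; rewrite /Defs.Lpnorm unlock.
have -> : (0 < mu setT)%E.
  apply: (@lt_le_trans _ _ (mu `[a, b])); last by apply: le_measure; rewrite ?inE.
  by rewrite lebesgue_measure_itv/= lte_fin hab -EFinD lte_fin subr_gt0.
have E x : ((abse \o (EFin \o (fun x => cabs (f x)) \_ `[a, b])) x <= c%:E)%E <->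
   (x \in `[a, b] -> cabs (f x) <= c).
  rewrite /= patchE; case: ifPn => xab.
    rewrite lee_fin ger0_norm ?cabs_ge0//; split => // ->//.
    by move: xab; rewrite inE.
  by rewrite normr0 lee_fin c0; split => // _ xab'; move: xab; rewrite notin_setE/=.
split=> [/ess_supP|] H; last apply/ess_supP; apply: ae_imp H => x /E//.
Qed.

Lemma Lpnorm_le_ae p f g c : (1 <= p)%E -> 0 <= c -> cmeas f -> cmeas g ->
  {ae mu, forall x, x \in `[a, b] -> cabs (f x) <= cabs (g x)} ->
  (Lpnorm p g <= c%:E)%E -> (Lpnorm p f <= c%:E)%E.
Proof.
case: p => [r||]//=; rewrite ?lee_fin => p1 c0 mf mg fg.
  have r0 : 0 < r by exact: lt_le_trans p1.
  move=> /(Lpnorm_fin_leP _ r0 c0) H; apply/Lpnorm_fin_leP => //.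
  apply: le_trans H; apply: ae_ge0_le_integral => //.
  - by move=> x _; rewrite lee_fin powR_ge0.
  - exact: cmeas_powR.
  - by move=> x _; rewrite lee_fin powR_ge0.
  - exact: cmeas_powR.
  - apply: ae_imp fg => x fg /fg; rewrite lee_fin => fgx.
    by apply: ge0_ler_powR => //; rewrite ?(ltW r0)// nnegrE cabs_ge0.
move=> /(Lpnorm_oo_leP _ c0) H; apply/Lpnorm_oo_leP => //.
by apply: ae_imp (ae_and fg H) => x [h1 h2] xab; apply: le_trans (h1 xab) (h2 xab).
Qed.

Lemma Lpnorm_le p f g c : (1 <= p)%E -> 0 <= c -> cmeas f -> cmeas g ->
  (forall x, x \in `[a, b] -> cabs (f x) <= cabs (g x)) ->
  (Lpnorm p g <= c%:E)%E -> (Lpnorm p f <= c%:E)%E.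
Proof. by move=> p1 c0 mf mg fg; apply: Lpnorm_le_ae => //; exact: aeW. Qed.

Lemma LpnormZ p f k c : (1 <= p)%E -> 0 <= c -> cmeas f ->
  (Lpnorm p f <= c%:E)%E -> (Lpnorm p (fun x => (k : R[i]) * f x)%R <= (cabs k * c)%:E)%E.
Proof.
have k0 := cabs_ge0 k.
case: p => [r||]//=; rewrite ?lee_fin => p1 c0 mf.
  have r0 : 0 < r by exact: lt_le_trans p1.
  move=> /(Lpnorm_fin_leP _ r0 c0) H; apply/Lpnorm_fin_leP => //.
    by rewrite mulr_ge0.
  under eq_integral do rewrite cabsM powRM ?cabs_ge0// EFinM.
  rewrite ge0_integralZl_EFin//; last 3 first.
  - by move=> x _; rewrite lee_fin powR_ge0.
  - exact: cmeas_powR.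
  - exact: powR_ge0.
  by rewrite powRM// EFinM lee_wpmul2l// lee_fin powR_ge0.
move=> /(Lpnorm_oo_leP _ c0) H; apply/Lpnorm_oo_leP; first by rewrite mulr_ge0.
by apply: ae_imp H => x h2 xab; rewrite cabsM ler_wpM2l// h2.
Qed.

Lemma LpnormD p f g : (1 <= p)%E -> cmeas f -> cmeas g ->
  (Lpnorm p (fun x => f x + g x)%R <= Lpnorm p f + Lpnorm p g)%E.
Proof.
move=> p1 mf mg.
pose u := (fun x => cabs (f x)) \_ `[a, b]; pose v := (fun x => cabs (g x)) \_ `[a, b].
have mu_ : measurable_fun setT u by exact: cmeas_restrict.
have mv_ : measurable_fun setT v by exact: cmeas_restrict.
apply: le_trans (eminkowski mu mu_ mv_ p1).
(* The real function |f| + |g| is read as a complex one so that [Lpnorm_le] applies; the case of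
   infinite norm is settled apart. *)
pose h x := ((u x + v x)%:C : R[i]).
have Eh : EFin \o (u \+ v)%R = EFin \o ((fun x => cabs (h x)) \_ `[a, b]).
  apply/funext => x /=; congr EFin; rewrite /h patchE cabs_real /u /v !patchE.
  by case: ifPn => _; rewrite ?addr0// ger0_norm// addr_ge0// cabs_ge0.
rewrite Eh -/(Lpnorm p h).
have mh : cmeas h.
  by split; [apply: measurable_funTS; exact: measurable_funD|exact: measurable_cst].
have [->|] := eqVneq (Lpnorm p h) +oo%E; first by rewrite leey.
rewrite -ltey => hoo.
have hfin : Lpnorm p h \is a fin_num by rewrite ge0_fin_numE// Lnorm_ge0.
rewrite -(fineK hfin); apply: (Lpnorm_le (g := h)) => //.
- by rewrite fine_ge0// Lnorm_ge0.
- exact: cmeasD.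
- move=> x xab; rewrite /h cabs_real /u /v !patchE mem_set//.
  by rewrite ger0_norm ?addr_ge0 ?cabs_ge0// cabsD.
- by rewrite fineK.
Qed.

(* t <= 1 + t^r replaces Hölder's inequality *)
Lemma Lpnorm_rint p f c : (1 <= p)%E -> 0 <= c -> cmeas f ->
  (Lpnorm p f <= c%:E)%E ->
  L1 (fun x => cabs (f x)) /\ rint a b (fun x => cabs (f x)) <= (b - a + 1) * c.
Proof.
move=> p1 c0 mf fc.
(* Scaling by c' requires c' > 0, so a bound c = 0 is reached as a limit. In (b - a + 1) c', the
   summand b - a comes from the constant 1 in t <= 1 + t^r, and the last 1 from the integral of
   t^r. *)
suff H c' : 0 < c' -> (Lpnorm p f <= c'%:E)%E ->
  (\int[mu]_(x in `[a, b]) (cabs (f x))%:E <= ((b - a + 1) * c')%:E)%E.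
  have lf : L1 (fun x => cabs (f x)).
    apply/integrableP; split; first by apply/measurable_EFinP; exact: cmeas_cabs.
    under eq_integral do rewrite /= ger0_norm ?cabs_ge0//.
    have c1 : 0 < c + 1 by rewrite ltr_wpDl.
    apply: le_lt_trans (H _ c1 _) _; last by rewrite ltry.
    by apply: le_trans fc _; rewrite lee_fin lerDl.
  split=> //; have ba : 0 < b - a + 1 by rewrite addr_gt0// subr_gt0.
  apply/ler_addgt0Pl => e e0.
  have c1 : 0 < c + e / (b - a + 1) by rewrite ltr_wpDl// divr_gt0.
  have := H _ c1; rewrite mulrDr mulrCA mulfV ?gt_eqF// mulr1 [e + _]addrC.
  move=> H'; rewrite -lee_fin; rewrite rint.unlock /Rintegral fineK; last exact: integrable_fin_num.
  by apply: H'; apply: le_trans fc _; rewrite lee_fin lerDl divr_ge0// ltW.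
move=> c'0 {}fc; case: p p1 fc => [r||]//=; rewrite ?lee_fin => p1.
  have r0 : 0 < r by exact: lt_le_trans p1.
  move=> /(Lpnorm_fin_leP _ r0 (ltW c'0)) H.
  apply: (@le_trans _ _ (\int[mu]_(x in `[a, b]) (c'%:E + (c' / c' `^ r)%:E * (cabs (f x) `^ r)%:E))%E).
    apply: ge0_le_integral => //.
    - by move=> x _; rewrite lee_fin cabs_ge0.
    - by apply/measurable_EFinP; exact: cmeas_cabs.
    - apply/measurable_EFinP; apply: measurable_funD => //; apply: measurable_funM => //.
      by apply/measurable_EFinP; exact: cmeas_powR.
    - move=> x _; rewrite -EFinM -EFinD lee_fin.
      have -> : c' / c' `^ r * cabs (f x) `^ r = c' * (cabs (f x) / c') `^ r.
        rewrite powRM ?cabs_ge0 ?invr_ge0 ?(ltW c'0)// -[c'^-1]powR_inv1 ?(ltW c'0)//.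
        by rewrite -powRrM mulN1r powRN; ring.
      set t := _ / _; have -> : cabs (f x) = c' * t by rewrite mulrC mulfVK// gt_eqF.
      have := powR_ge0 t r; have [t1|t1] := leP t 1; first by nra.
      by have := le1r_powR (ltW t1) p1; nra.
  rewrite ge0_integralD//; last 3 first.
  - by move=> x _; rewrite lee_fin ltW.
  - by move=> x _; rewrite mule_ge0// lee_fin ?divr_ge0 ?powR_ge0// ltW.
  - apply/measurable_EFinP; apply: measurable_funM => //.
    by apply/measurable_EFinP; exact: cmeas_powR.
  rewrite integral_cst//= lebesgue_measure_itv/= lte_fin hab -EFinD -EFinM.
  rewrite ge0_integralZl_EFin//; last 3 first.
  - by move=> x _; rewrite lee_fin powR_ge0.
  - exact: cmeas_powR.
  - by rewrite divr_ge0 ?powR_ge0// ltW.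
  rewrite [in leRHS]mulrDl mul1r EFinD mulrC leeD2l//.
  have -> : c'%:E = ((c' / c' `^ r)%:E * (c' `^ r)%:E)%E.
    by rewrite -EFinM mulfVK// gt_eqF// powR_gt0.
  by rewrite lee_wpmul2l// lee_fin divr_ge0 ?powR_ge0// ltW.
move=> /(Lpnorm_oo_leP _ (ltW c'0)) H.
apply: (@le_trans _ _ (\int[mu]_(x in `[a, b]) c'%:E)%E).
  apply: ae_ge0_le_integral => //.
  - by move=> x _; rewrite lee_fin cabs_ge0.
  - by apply/measurable_EFinP; exact: cmeas_cabs.
  - by move=> x _; rewrite lee_fin ltW.
rewrite integral_cst//= lebesgue_measure_itv/= lte_fin hab -EFinD -EFinM lee_fin.
by rewrite mulrC ler_wpM2r ?(ltW c'0)// lerDl.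
Qed.

Lemma Lpnorm_cst1 p : (1 <= p)%E -> exists2 C, 0 < C & (Lpnorm p (fun=> 1)%R <= C%:E)%E.
Proof.
move=> p1; have ba : 0 < b - a by rewrite subr_gt0.
have E1 : cabs (1 : R[i]) = 1 by rewrite (cabs_real 1) normr1.
case: p p1 => [r||]//=; rewrite ?lee_fin => p1.
  have r0 : 0 < r by exact: lt_le_trans p1.
  exists ((b - a) `^ r^-1); first by rewrite powR_gt0.
  apply/Lpnorm_fin_leP => //; first exact: powR_ge0.
  under eq_integral do rewrite E1 powR1.
  rewrite integral_cst//= lebesgue_measure_itv/= lte_fin hab -EFinD -EFinM mul1r lee_fin.
  by rewrite -powRrM mulVf ?gt_eqF// powRr1// ltW.
exists 1 => //; apply/Lpnorm_oo_leP => //; apply: aeW => x _.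
by rewrite E1.
Qed.

(** Lower semicontinuity: Fatou's lemma for finite p, a countable union of null sets for p = +oo. *)
Lemma Lpnorm_lsc p (F : nat -> R -> R[i]) f c : (1 <= p)%E -> 0 <= c ->
  (forall n, cmeas (F n)) -> cmeas f ->
  {ae mu, forall x, x \in `[a, b] -> cabs (F n x) @[n --> \oo] --> cabs (f x)} ->
  (forall n, (Lpnorm p (F n) <= c%:E)%E) -> (Lpnorm p f <= c%:E)%E.
Proof.
move=> p1 c0 mF mf Ff Fc; case: p p1 Fc => [r||]//=; rewrite ?lee_fin => p1.
  have r0 : 0 < r by exact: lt_le_trans p1.
  move=> H; have {}H n := (Lpnorm_fin_leP (F n) r0 c0).1 (H n).
  apply/Lpnorm_fin_leP => //.
  pose G n x := (cabs (F n x) `^ r)%:E.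
  have mG n : measurable_fun `[a, b] (G n).
    exact: cmeas_powR.
  have G0 n x : `[a, b]%classic x -> (0 <= G n x)%E by rewrite lee_fin powR_ge0.
  apply: (@le_trans _ _ (\int[mu]_(x in `[a, b]) (limn_einf (G^~ x)))%E); last first.
    apply: le_trans (@fatou _ _ _ mu `[a, b]%classic (measurable_itv _) G mG G0) _.
    rewrite limn_einf_lim; apply: lime_le; first exact: is_cvg_einfs.
    apply: nearW => n; apply: le_trans (H n); apply: ereal_inf_lbound.
    by exists n => //=.
  apply: ae_ge0_le_integral => //.
  - by move=> x _; rewrite lee_fin powR_ge0.
  - exact: cmeas_powR.
  - move=> x xab; rewrite limn_einf_lim; apply: lime_ge; first exact: is_cvg_einfs.
    by apply: nearW => n; apply: le_ereal_inf_tmp => _ [m _ <-]; exact: G0.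
  - apply: (emeasurable_fun_cvg (fun n x => einfs (G^~ x) n)) => [n|x _].
      exact: measurable_fun_einfs.
    by rewrite limn_einf_lim; exact: is_cvg_einfs.
  - apply: ae_imp Ff => x Ffx xab.
    (* Continuity of the power is taken from its derivability at positive arguments; where f
       vanishes, nonnegativity of the powers is enough. *)
    have [fx0|fx0] := ltP 0 (cabs (f x)); last first.
      have -> : cabs (f x) = 0 by apply/le_anti; rewrite fx0 cabs_ge0.
      rewrite powR0 ?gt_eqF// limn_einf_lim; apply: lime_ge; first exact: is_cvg_einfs.
      by apply: nearW => n; apply: le_ereal_inf_tmp => _ [m _ <-]; exact: G0.
    suff GL : G n x @[n --> \oo] --> (cabs (f x) `^ r)%:E.
      have Gc : cvgn (G^~ x) by apply/cvg_ex; eexists; exact: GL.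
      by rewrite (is_cvg_limn_einfE Gc) (cvg_lim _ GL).
    have cpow : {for cabs (f x), continuous (fun t : R => t `^ r)}.
      apply: differentiable_continuous; apply/derivable1_diffP.
      by apply: derivable_powR; rewrite in_itv/= fx0.
    apply: cvg_EFin; first exact: nearW.
    exact: (continuous_cvg _ cpow (Ffx xab)).
move=> H; have {}H n := (Lpnorm_oo_leP (F n) c0).1 (H n).
apply/Lpnorm_oo_leP => //.
apply: ae_imp (ae_and Ff (ae_foralln H)) => x [Ffx Hx] xab.
rewrite -(cvg_lim _ (Ffx xab))//; apply: limr_le.
  by apply/cvg_ex; eexists; exact: Ffx.
by apply: nearW => n; exact: Hx.
Qed.

End LpNorm.

(** * Integrals and primitives of complex-valued functions *)

Section ComplexIntegral.
Context {R : realType}.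
Notation mu := (@lebesgue_measure R).
Variables a b : R.
Hypothesis hab : a < b.
Implicit Types (f g : R -> R[i]) (p : \bar R) (c : R).
Local Notation L1 := (integrable_on a b).
Local Notation cmeas := (cmeas a b).

Definition cint t f : R[i] :=
  rint a t (fun x => complex.Re (f x)) +i* rint a t (fun x => complex.Im (f x)).

Definition cL1 f := L1 (fun x => complex.Re (f x)) /\ L1 (fun x => complex.Im (f x)).

Lemma cL1_cmeas f : cL1 f -> cmeas f.
Proof. by move=> [lr li]; split; exact: L1_measurable. Qed.

Lemma cmeas_cL1 f : cmeas f -> L1 (fun x => cabs (f x)) -> cL1 f.
Proof.
move=> [mr mi] lf; split; apply: L1_le lf => // x _; [exact: cabs_Re|exact: cabs_Im].
Qed.

Lemma cL1_cabs f : cL1 f -> L1 (fun x => cabs (f x)).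
Proof.
move=> lf; have [lr li] := lf; apply: L1_le (L1D (L1_norm lr) (L1_norm li)).
  exact: cmeas_cabs (cL1_cmeas lf).
by move=> x _; rewrite ger0_norm ?cabs_ge0// cabs_le_Re_Im.
Qed.

Lemma cmeas_bnd_cL1 f M : cmeas f -> (forall x, x \in `[a, b] -> cabs (f x) <= M) -> cL1 f.
Proof.
move=> mf fM; apply: cmeas_cL1 => //; apply: (@L1_bnd _ _ _ hab _ M); first exact: cmeas_cabs.
by move=> x xab; rewrite ger0_norm ?cabs_ge0// fM.
Qed.

Lemma cL1D f g : cL1 f -> cL1 g -> cL1 (fun x => f x + g x).
Proof.
move=> [? ?] [? ?]; split.
  by under [X in L1 X]eq_fun do rewrite cReD; exact: L1D.
by under [X in L1 X]eq_fun do rewrite cImD; exact: L1D.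
Qed.

Lemma cL1Z k f : cL1 f -> cL1 (fun x => k * f x).
Proof.
move=> [? ?]; split.
  by under [X in L1 X]eq_fun do rewrite cReM; apply: L1B; exact: L1Z.
by under [X in L1 X]eq_fun do rewrite cImM; apply: L1D; exact: L1Z.
Qed.

Lemma cL1_cst k : cL1 (fun=> k).
Proof. by split; exact: L1_cst. Qed.

Lemma cL1_sum (I : Type) (s : seq I) (F : I -> R -> R[i]) :
  (forall i, cL1 (F i)) -> cL1 (fun x => \sum_(i <- s) F i x).
Proof.
move=> mF; elim: s => [|i s IH].
  by under eq_fun do rewrite big_nil; exact: cL1_cst.
by under eq_fun do rewrite big_cons; exact: cL1D.
Qed.

Lemma cint0 f : cint a f = 0.
Proof. by rewrite /cint !rint0. Qed.

Lemma cintD f g t : t <= b -> cL1 f -> cL1 g ->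
  cint t (fun x => f x + g x) = cint t f + cint t g.
Proof.
move=> tb [? ?] [? ?]; rewrite /cint.
under [X in rint a t X +i* _]eq_fun do rewrite cReD.
under [X in _ +i* rint a t X]eq_fun do rewrite cImD.
by rewrite !(rintD tb).
Qed.

Lemma cintZ k f t : t <= b -> cL1 f -> cint t (fun x => k * f x) = k * cint t f.
Proof.
move=> tb [? ?]; rewrite /cint.
under [X in rint a t X +i* _]eq_fun do rewrite cReM.
under [X in _ +i* rint a t X]eq_fun do rewrite cImM.
rewrite (rintB tb) ?(rintD tb) ?(rintZ _ tb)//; try exact: L1Z.
by case: k => x y /=; congr (_ +i* _).
Qed.

Lemma cintN f t : t <= b -> cL1 f -> cint t (fun x => - f x) = - cint t f.
Proof.
by move=> tb lf; rewrite -mulN1r -(cintZ _ tb)//; congr cint; apply/funext => x; rewrite mulN1r.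
Qed.

Lemma cL1N f : cL1 f -> cL1 (fun x => - f x).
Proof. by move=> lf; under eq_fun do rewrite -mulN1r; exact: cL1Z. Qed.

Lemma cintB f g t : t <= b -> cL1 f -> cL1 g ->
  cint t (fun x => f x - g x) = cint t f - cint t g.
Proof. by move=> tb lf lg; rewrite cintD ?cintN//; exact: cL1N. Qed.

Lemma cint_sum (I : Type) (s : seq I) (F : I -> R -> R[i]) t : t <= b ->
  (forall i, cL1 (F i)) ->
  cint t (fun x => \sum_(i <- s) F i x) = \sum_(i <- s) cint t (F i).
Proof.
move=> tb lF; elim: s => [|i s IH].
  rewrite big_nil; under [X in cint t X]eq_fun do rewrite big_nil.
  by rewrite /cint; congr (_ +i* _); rewrite rint.unlock Rintegral_cst// mul0r.
rewrite big_cons; under [X in cint t X]eq_fun do rewrite big_cons.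
by rewrite cintD// ?IH//; exact: cL1_sum.
Qed.

Lemma ae_eq_cint f g t : t <= b -> cL1 f -> cL1 g ->
  {ae mu, forall x, x \in `[a, b] -> f x = g x} -> cint t f = cint t g.
Proof.
move=> tb [? ?] [? ?] fg; congr (_ +i* _); apply: (ae_eq_rint tb) => //;
  by apply: ae_imp fg => x fg xab; rewrite fg.
Qed.

(** The factor 2 comes from estimating the real and imaginary parts separately; it recurs in all
    later constants. *)
Lemma cint_bnd f t : cL1 f -> t \in `[a, b] ->
  cabs (cint t f) <= 2 * rint a t (fun x => cabs (f x)).
Proof.
move=> lf tab; have [lr li] := lf; apply: le_trans (cabs_le_Re_Im _) _ => /=.
have lc := cL1_cabs lf.
have /andP[at_ tb] : a <= t <= b by move: tab; rewrite in_itv.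
have Hr := rint_norm (lexx a) at_ tb lr; have Hi := rint_norm (lexx a) at_ tb li.
rewrite !rint0 !subr0 in Hr Hi.
have Hr' : rint a t (fun x => `|complex.Re (f x)|) <= rint a t (fun x => cabs (f x)).
  by apply: (le_rint0 tab _ lc) => [|x _]; [exact: L1_norm|exact: cabs_Re].
have Hi' : rint a t (fun x => `|complex.Im (f x)|) <= rint a t (fun x => cabs (f x)).
  by apply: (le_rint0 tab _ lc) => [|x _]; [exact: L1_norm|exact: cabs_Im].
lra.
Qed.

Definition primitive f g := forall t, t \in `[a, b] -> f t = f a + cint t g.

Lemma primitive_ReIm f g : primitive f g ->
  (forall t, t \in `[a, b] ->
     complex.Re (f t) = complex.Re (f a) + rint a t (fun x => complex.Re (g x))) /\
  (forall t, t \in `[a, b] ->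
     complex.Im (f t) = complex.Im (f a) + rint a t (fun x => complex.Im (g x))).
Proof. by move=> fg; split => t tab; rewrite {1}fg// ?cReD ?cImD. Qed.

Lemma primitive_cmeas f g : cL1 g -> primitive f g -> cmeas f.
Proof.
move=> [lr li] /primitive_ReIm[fr fi]; split; apply: rcont_measurable => x xab e e0.
  have [d d0 Hd] := primitive_rcont (complex.Re (f a)) lr xab e0.
  by exists d => // t tab td; rewrite (fr t)// (fr x)//; exact: Hd.
have [d d0 Hd] := primitive_rcont (complex.Im (f a)) li xab e0.
by exists d => // t tab td; rewrite (fi t)// (fi x)//; exact: Hd.
Qed.

Lemma primitiveM f g f' g' : cL1 f' -> cL1 g' -> primitive f f' -> primitive g g' ->
  cL1 (fun t => f' t * g t + f t * g' t) /\
  primitive (fun t => f t * g t) (fun t => f' t * g t + f t * g' t).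
Proof.
move=> [lfr lfi] [lgr lgi] /primitive_ReIm[fr fi] /primitive_ReIm[gr gi].
have [l1 e1] := rintM hab lfr lgr fr gr.
have [l2 e2] := rintM hab lfi lgi fi gi.
have [l3 e3] := rintM hab lfr lgi fr gi.
have [l4 e4] := rintM hab lfi lgr fi gr.
have rE : (fun t => complex.Re (f' t * g t + f t * g' t)) = fun t =>
  (complex.Re (f' t) * complex.Re (g t) + complex.Re (f t) * complex.Re (g' t)) -
  (complex.Im (f' t) * complex.Im (g t) + complex.Im (f t) * complex.Im (g' t)).
  by apply/funext => t; rewrite cReD !cReM; ring.
have iE : (fun t => complex.Im (f' t * g t + f t * g' t)) = fun t =>
  (complex.Re (f' t) * complex.Im (g t) + complex.Re (f t) * complex.Im (g' t)) +
  (complex.Im (f' t) * complex.Re (g t) + complex.Im (f t) * complex.Re (g' t)).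
  by apply/funext => t; rewrite cImD !cImM; ring.
split; first by split; [rewrite rE; exact: L1B|rewrite iE; exact: L1D].
move=> t tab; have /andP[at_ tb] : a <= t <= b by move: tab; rewrite in_itv.
rewrite /cint rE iE [X in X +i* _](rintB tb)// [X in _ +i* X](rintD tb)//.
apply/eqP; rewrite eq_complex; apply/andP; split; apply/eqP.
  by rewrite cReD !cReM e1// e2//=; ring.
by rewrite cImD !cImM e3// e4//=; ring.
Qed.

End ComplexIntegral.

Lemma cvg_cabsB {R : realType} (u : nat -> R[i]) (l w : R[i]) :
  complex.Re (u n) @[n --> \oo] --> complex.Re l ->
  complex.Im (u n) @[n --> \oo] --> complex.Im l ->
  cabs (u n - w) @[n --> \oo] --> cabs (l - w).
Proof.
move=> ur ui; under eq_fun do rewrite cabsE; rewrite cabsE.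
apply: continuous_cvg; first exact: sqrt_continuous.
apply: cvgD; rewrite expr2; under eq_fun do rewrite expr2.
  suff H : complex.Re (u n - w) @[n --> \oo] --> complex.Re (l - w) by exact: cvgM.
  by rewrite cReD; under eq_fun do rewrite cReD; apply: cvgD => //; exact: cvg_cst.
suff H : complex.Im (u n - w) @[n --> \oo] --> complex.Im (l - w) by exact: cvgM.
by rewrite cImD; under eq_fun do rewrite cImD; apply: cvgD => //; exact: cvg_cst.
Qed.

(** * Completeness of L_p for geometrically dominated series *)

Section LpComplete.
Context {R : realType}.
Notation mu := (@lebesgue_measure R).
Variables a b : R.
Hypothesis hab : a < b.
Implicit Types (f g : R -> R[i]) (c : R).
Local Notation L1 := (integrable_on a b).
Local Notation cmeas := (cmeas a b).
Local Notation Lpnorm := (Lpnorm a b).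
Variable p : \bar R.
Hypothesis p1 : (1 <= p)%E.

(** First half of the Riesz-Fischer argument, run in L_1 for all p at once: [Lpnorm_rint] makes the
    integrals of the |f_i| summable, so the sum of the |f_i| is integrable and hence finite almost
    everywhere. *)
Lemma Lp_ae_summable (f : nat -> R -> R[i]) (c : nat -> R) :
  (forall i, cmeas (f i)) -> (forall i, (Lpnorm p (f i) <= (c i)%:E)%E) ->
  (forall i, c i.+1 <= c i / 2) ->
  {ae mu, forall x, x \in `[a, b] ->
     exists M : R, forall n, \sum_(i < n) cabs (f i x) <= M}.
Proof.
move=> mf fc cc.
have c0 i : 0 <= c i by rewrite -lee_fin; apply: le_trans (fc i); exact: Lnorm_ge0.
have H i := Lpnorm_rint hab p1 (c0 i) (mf i) (fc i).
pose u i x := (cabs (f i x))%:E.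
have mu_ i : measurable_fun `[a, b] (u i) by apply/measurable_EFinP; exact: cmeas_cabs.
have u0 i x : `[a, b]%classic x -> (0 <= u i x)%E by rewrite lee_fin cabs_ge0.
have Iu i : (\int[mu]_(x in `[a, b]) u i x <= ((b - a + 1) * c i)%:E)%E.
  have [li Hi] := H i; move: Hi; rewrite -lee_fin; apply: le_trans.
  by rewrite rint.unlock /Rintegral fineK//; exact: integrable_fin_num.
have lS : mu.-integrable `[a, b] (fun x => (\sum_(i <oo) u i x)%E).
  apply/integrableP; split.
    apply: (emeasurable_fun_cvg (fun n x => \sum_(0 <= i < n) u i x)%E) => [n|x xab].
      exact: emeasurable_sum.
    by apply: is_cvg_nneseries => i _ _; exact: u0.
  under eq_integral => x.
    rewrite inE => xab; rewrite gee0_abs; last by apply: nneseries_ge0 => n _ _; exact: u0.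
    over.
  rewrite integral_nneseries//; apply: le_lt_trans (ltry ((b - a + 1) * (2 * c 0%N))).
  apply: lime_le.
    by apply: is_cvg_nneseries => n _ _; apply: integral_ge0; exact: u0.
  apply: nearW => n; rewrite big_mkord.
  apply: (@le_trans _ _ (\sum_(i < n) ((b - a + 1) * c i)%:E)%E).
    by apply: lee_sum => i _.
  rewrite sumEFin lee_fin -mulr_sumr ler_wpM2l//.
    by rewrite addr_ge0// subr_ge0 ltW.
  (* Halving gives c i <= 2 c i - 2 c (i + 1), so the sum telescopes. *)
  suff : \sum_(i < n) c i <= 2 * c 0%N - 2 * c n by have := c0 n; lra.
  elim: n => [|n IH]; first by rewrite big_ord0 subrr.
  by rewrite big_ord_recr/=; have := cc n; lra.
apply: ae_imp (integrable_ae _ lS) => // x Hx xab.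
have Sfin := Hx xab; exists (fine (\sum_(i <oo) u i x)) => n.
rewrite -lee_fin fineK// -sumEFin -(big_mkord xpredT (fun i => u i x)).
by apply: nneseries_lim_ge => *; rewrite lee_fin cabs_ge0.
Qed.

(** The explicit bound on the tails is the form of completeness that the gliding hump consumes. It
    follows from [Lpnorm_lsc], the differences of partial sums being bounded uniformly. *)
Lemma Lp_complete (f : nat -> R -> R[i]) (c : nat -> R) :
  (forall i, cmeas (f i)) -> (forall i, (Lpnorm p (f i) <= (c i)%:E)%E) ->
  (forall i, c i.+1 <= c i / 2) ->
  exists F, cmeas F /\ forall J,
    (Lpnorm p (fun x => F x - \sum_(i < J) f i x)%R <= (2 * c J)%:E)%E.
Proof.
move=> mf fc cc; have aeS := Lp_ae_summable mf fc cc.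
have c0 i : 0 <= c i by rewrite -lee_fin; apply: le_trans (fc i); exact: Lnorm_ge0.
pose S (P : R[i] -> R) n x := P (\sum_(i < n) f i x).
(* An upper limit is defined and measurable everywhere, including the null set where the series
   diverges. *)
pose FP P x := fine (limn_esup (fun n => (S P n x)%:E)).
pose F x := FP (@complex.Re R) x +i* FP (@complex.Im R) x.
have mS n : cmeas (fun x => \sum_(i < n) f i x) by exact: cmeas_sum.
have mFP P : (forall n, measurable_fun `[a, b] (S P n)) -> measurable_fun `[a, b] (FP P).
  move=> mSP; apply: measurableT_comp; first exact: fine_measurable.
  apply: measurable_fun_limn_esup => n; apply/measurable_EFinP; exact: mSP.
have mF : cmeas F.
  by split; apply: mFP => n; have [] := mS n.
exists F; split => // J.
have aeP : {ae mu, forall x, x \in `[a, b] ->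
    S (@complex.Re R) n x @[n --> \oo] --> complex.Re (F x) /\
    S (@complex.Im R) n x @[n --> \oo] --> complex.Im (F x)}.
  apply: ae_imp aeS => x Hx /Hx[M HM].
  have key P : (forall z w, P (z + w) = P z + P w) -> (forall z, `|P z| <= cabs z) ->
      S P n x @[n --> \oo] --> FP P x.
    move=> PD Pc; have Sc : cvgn (fun n => S P n x).
      apply: (@bounded_increments_cvg _ _ M) => n; apply: le_trans (HM n).
      by apply: ler_sum => i _; rewrite /S big_ord_recr/= PD addrC addKr.
    suff -> : FP P x = limn (fun n => S P n x) by exact: Sc.
    have SE : (fun n => (S P n x)%:E) @ \oo --> (limn (fun n => S P n x))%:E.
      by apply: cvg_EFin; [exact: nearW|exact: Sc].
    by rewrite /FP is_cvg_limn_esupE; [rewrite (cvg_lim _ SE)|apply/cvg_ex; eexists; exact: SE].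
  by split; apply: key; [exact: cReD|exact: cabs_Re|exact: cImD|exact: cabs_Im].
apply: (@Lpnorm_lsc _ a b hab p (fun n x => \sum_(i < J + n) f i x - \sum_(i < J) f i x)) => //.
- by rewrite mulr_ge0.
- by move=> n; apply: cmeasB.
- exact: cmeasB.
- apply: ae_imp aeP => x Hx /Hx[Hr Hi].
  by apply: cvg_cabsB; under eq_fun do rewrite addnC; [rewrite -(cvg_shiftn J) in Hr|rewrite -(cvg_shiftn J) in Hi].
move=> n; suff : (Lpnorm p (fun x => \sum_(i < J + n) f i x - \sum_(i < J) f i x)%R <=
    (2 * c J - 2 * c (J + n)%N)%:E)%E.
  by move=> /le_trans; apply; rewrite lee_fin gerBl mulr_ge0.
elim: n => [|n IH].
  rewrite addn0 subrr (_ : (fun x => _) = fun=> 0); last by apply/funext => x; rewrite subrr.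
  have [C C0 HC] := Lpnorm_cst1 hab p1.
  have := @LpnormZ _ a b hab p _ 0 C p1 (ltW C0) (cmeas_cst a b 1) HC.
  by rewrite cabs0 !mul0r.
rewrite addnS (_ : (fun x => _) = fun x =>
  (\sum_(i < J + n) f i x - \sum_(i < J) f i x) + f (J + n)%N x); last first.
  by apply/funext => x; rewrite big_ord_recr/= addrAC.
apply: le_trans (LpnormD hab p1 _ _) _ => //; first exact: cmeasB.
apply: le_trans (leeD IH (fc _)) _.
by rewrite -EFinD lee_fin; have := cc (J + n)%N; lra.
Qed.

End LpComplete.

(** * Sobolev spaces through iterated primitives *)

Section SobolevBound.
Context {R : realType}.
Notation mu := (@lebesgue_measure R).
Variables a b : R.
Hypothesis hab : a < b.
Implicit Types (f g y z : R -> R[i]) (c d : R) (s : nat).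
Local Notation cmeas := (cmeas a b).
Local Notation cL1 := (cL1 a b).
Local Notation Lpnorm := (Lpnorm a b).
Local Notation primitive := (primitive a b).
Local Notation cint := (cint a).
Variable p : \bar R.
Hypothesis p1 : (1 <= p)%E.

(* y belongs to W_p^s with norm at most c, for the norm
   max (|y(a)|, ..., |y^(s-1)(a)|, ||y^(s)||_p) *)
Fixpoint sob s y c : Prop :=
  if s is s'.+1 then
    cabs (y a) <= c /\ exists2 g, sob s' g c & primitive y g
  else cmeas y /\ (Lpnorm p y <= c%:E)%E.

Let aab : a \in `[a, b]. Proof. by rewrite in_itv/= lexx ltW. Qed.

Lemma sob_ext s y z c : (forall x, x \in `[a, b] -> y x = z x) ->
  sob s y c -> sob s z c.
Proof.
case: s => [|s] yz /=.
  move=> [my yc]; split; first exact: cmeas_eq my.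
  have c0 : 0 <= c by rewrite -lee_fin; apply: le_trans yc; exact: Lnorm_ge0.
  apply: (Lpnorm_le hab p1 c0 _ my _ yc); first exact: cmeas_eq my.
  by move=> x xab; rewrite yz.
move=> [ya [g gc yg]]; split; first by rewrite -yz.
by exists g => // t tab; rewrite -!yz// yg.
Qed.

Lemma sob_ge0 s y c : sob s y c -> 0 <= c.
Proof.
case: s => [[_ yc]|s [ya _]].
  by rewrite -lee_fin; apply: le_trans yc; exact: Lnorm_ge0.
by apply: le_trans ya; exact: cabs_ge0.
Qed.

Lemma sob_le s y c d : c <= d -> sob s y c -> sob s y d.
Proof.
move=> cd; elim: s y => [|s IH] y /=.
  by move=> [my yc]; split => //; apply: le_trans yc _; rewrite lee_fin.
move=> [ya [g gc yg]]; split; first exact: le_trans cd.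
by exists g => //; exact: IH.
Qed.

(** An L_1 bound is what can pass through the induction, since order 0 allows no pointwise bound.
    One order higher it becomes the sup bound [sob_sup]: the initial value contributes c and the
    integral at most 2 K c. *)
Lemma sob_L1_sup s : exists2 K, 1 <= K & forall y c, sob s y c ->
  cL1 y /\ rint a b (fun x => cabs (y x)) <= K * c.
Proof.
elim: s => [|s [K K1 IH]].
  exists (b - a + 1); first by rewrite lerDr subr_ge0 ltW.
  move=> y c yc; have c0 := sob_ge0 yc; have [my {}yc] := yc.
  by have [ly Hy] := Lpnorm_rint hab p1 c0 my yc; split=> //; exact: cmeas_cL1.
have ba : 0 < b - a by rewrite subr_gt0.
exists ((1 + 2 * K) * (b - a) + 1); first by rewrite lerDr mulr_ge0 ?(ltW ba)//; lra.
move=> y c yc; have c0 := sob_ge0 yc; have [ya [g gc yg]] := yc.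
have [lg Hg] := IH _ _ gc.
have ybnd x : x \in `[a, b] -> cabs (y x) <= (1 + 2 * K) * c.
  move=> xab; rewrite yg//; apply: le_trans (cabsD _ _) _.
  have /andP[ax xb] : a <= x <= b by move: xab; rewrite in_itv.
  have H1 := cint_bnd lg xab.
  have H2 : rint a x (fun x => cabs (g x)) <= rint a b (fun x => cabs (g x)).
    apply: le_trans (ler_norm _) _; apply: le_trans (rint_bnd hab (cL1_cabs lg) xab) _.
    by rewrite le_eqVlt; apply/orP; left; apply/eqP; apply: (eq_rint (lexx b)) => ? _; rewrite ger0_norm ?cabs_ge0.
  have := Hg; lra.
have my := primitive_cmeas lg yg.
have ly : cL1 y by exact: cmeas_bnd_cL1 ybnd.
split=> //.
apply: (@le_trans _ _ (rint a b (fun=> (1 + 2 * K) * c))).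
  have bab : b \in `[a, b] by rewrite in_itv/= lexx ltW.
  apply: (le_rint0 bab); [exact: cL1_cabs|exact: L1_cst|exact: ybnd].
rewrite rint_cst ?(ltW hab)// mulrAC ler_wpM2r//; lra.
Qed.

Lemma sob_cL1 s y c : sob s y c -> cL1 y.
Proof. by have [K _ H] := sob_L1_sup s => /H[]. Qed.

Lemma sob_cmeas s y c : sob s y c -> cmeas y.
Proof. by move=> /sob_cL1/cL1_cmeas. Qed.

Lemma cint_sup f t : cL1 f -> t \in `[a, b] ->
  cabs (cint t f) <= 2 * rint a b (fun x => cabs (f x)).
Proof.
move=> lf tab; apply: le_trans (cint_bnd lf tab) _; rewrite ler_wpM2l//.
apply: le_trans (ler_norm _) _; apply: le_trans (rint_bnd hab (cL1_cabs lf) tab) _.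
rewrite le_eqVlt; apply/orP; left; apply/eqP.
by apply: (eq_rint (lexx b)) => ? _; rewrite ger0_norm ?cabs_ge0.
Qed.

Lemma sob_sup s : exists2 K, 1 <= K & forall y c, sob s.+1 y c ->
  forall t, t \in `[a, b] -> cabs (y t) <= K * c.
Proof.
have [K K1 H] := sob_L1_sup s; exists (1 + 2 * K); first by lra.
move=> y c [ya [g gc yg]] t tab; have [lg Hg] := H _ _ gc.
rewrite yg//; apply: le_trans (cabsD _ _) _.
have := cint_sup lg tab; lra.
Qed.

Lemma sobD s y z c d : sob s y c -> sob s z d -> sob s (fun x => y x + z x) (c + d).
Proof.
elim: s y z => [|s IH] y z /=.
  move=> [my yc] [mz zd]; split; first exact: cmeasD.
  by apply: le_trans (LpnormD hab p1 my mz) _; rewrite EFinD; exact: leeD.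
move=> [ya [g gc yg]] [za [h hd zh]]; split.
  by apply: le_trans (cabsD _ _) _; exact: lerD.
exists (fun x => g x + h x); first exact: IH.
move=> t tab; have /andP[at_ tb] : a <= t <= b by move: tab; rewrite in_itv.
by rewrite (cintD tb (sob_cL1 gc) (sob_cL1 hd)) yg// zh// addrACA.
Qed.

Lemma sobZ s k y c : sob s y c -> sob s (fun x => k * y x) (cabs k * c).
Proof.
elim: s y => [|s IH] y yc; have c0 := sob_ge0 yc.
  have [my {}yc] := yc; split; first by apply: cmeasM => //; exact: cmeas_cst.
  exact: LpnormZ.
have [ya [g gc yg]] := yc; split; first by rewrite cabsM ler_wpM2l ?cabs_ge0.
exists (fun x => k * g x); first exact: IH.
move=> t tab; have /andP[at_ tb] : a <= t <= b by move: tab; rewrite in_itv.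
by rewrite (cintZ _ tb (sob_cL1 gc)) yg// mulrDr.
Qed.

Lemma sobN s y c : sob s y c -> sob s (fun x => - y x) c.
Proof.
move=> /(sobZ (-1)); rewrite cabsN (cabs_real 1) normr1 mul1r.
by apply: sob_ext => x _; rewrite mulN1r.
Qed.

Lemma sobB s y z c d : sob s y c -> sob s z d -> sob s (fun x => y x - z x) (c + d).
Proof. by move=> yc zd; apply: sobD => //; exact: sobN. Qed.

Lemma sob_cst s : exists2 K, 1 <= K & forall k, sob s (fun=> k) (K * cabs k).
Proof.
elim: s => [|s [K K1 IH]].
  have [C C0 HC] := Lpnorm_cst1 hab p1; exists (C + 1); first by rewrite lerDr ltW.
  move=> k; split; first exact: cmeas_cst.
  have := LpnormZ hab k p1 (ltW C0) (cmeas_cst a b 1) HC; rewrite mulr1 => /le_trans; apply.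
  by rewrite lee_fin mulrC ler_wpM2r ?cabs_ge0// lerDl.
exists 1 => // k; split; first by rewrite mul1r.
exists (fun=> 0).
  by apply: sob_le (IH 0); rewrite cabs0 mulr0 mul1r cabs_ge0.
move=> t tab; have /andP[at_ tb] : a <= t <= b by move: tab; rewrite in_itv.
by rewrite -[fun=> 0](_ : (fun=> 0 * 0) = _) ?(cintZ _ tb (cL1_cst hab 0)) ?mul0r ?addr0// mul0r.
Qed.

Lemma sob0 s : sob s (fun=> 0) 0.
Proof. by have [K _ H] := sob_cst s; have := H 0; rewrite cabs0 mulr0. Qed.

Lemma sob_sum (I : Type) (r : seq I) s (F : I -> R -> R[i]) (c : I -> R) :
  (forall i, sob s (F i) (c i)) ->
  sob s (fun x => \sum_(i <- r) F i x) (\sum_(i <- r) c i).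
Proof.
move=> Fc; elim: r => [|i r IH].
  by under eq_fun do rewrite big_nil; rewrite big_nil; exact: sob0.
by under eq_fun do rewrite big_cons; rewrite big_cons; exact: sobD.
Qed.

Lemma sob_int s k g c : cabs k <= c -> sob s g c -> sob s.+1 (fun t => k + cint t g) c.
Proof.
move=> kc gc; split; first by rewrite cint0 addr0.
by exists g => // t tab; rewrite cint0 addr0.
Qed.

Lemma sob_pred s : exists2 K, 1 <= K & forall y c, sob s.+1 y c -> sob s y (K * c).
Proof.
elim: s => [|s [K K1 IH]].
  have [K K1 H] := sob_sup 0; have [C C1 HC] := sob_cst 0.
  exists (C * K); first by rewrite mulr_ege1.
  move=> y c yc; have c0 := sob_ge0 yc; have [_ Hc] := HC (K * c)%:C.
  have Kc0 : 0 <= K * c by rewrite mulr_ge0//; lra.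
  split; first exact: sob_cmeas yc.
  apply: (Lpnorm_le hab p1 _ (sob_cmeas yc) (cmeas_cst a b (K * c)%:C)).
  - by rewrite -mulrA mulr_ge0//; lra.
  - by move=> x xab; rewrite cabs_real ger0_norm//; exact: H yc _ xab.
  - by move: Hc; rewrite cabs_real ger0_norm// mulrA.
exists K => // y c yc; have c0 := sob_ge0 yc; have [ya [g gc yg]] := yc; split.
  by apply: le_trans ya _; rewrite ler_peMl.
by exists g => //; exact: IH.
Qed.

Lemma sob_incl s s' : (s <= s')%N ->
  exists2 K, 1 <= K & forall y c, sob s' y c -> sob s y (K * c).
Proof.
move=> /subnK <-; elim: (s' - s)%N => [|n [K K1 IH]].
  by exists 1 => // y c; rewrite mul1r.
have [K' K'1 H] := sob_pred (n + s); exists (K * K'); first by rewrite mulr_ege1.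
by move=> y c /H/IH; rewrite mulrA.
Qed.

(* W^s W^(s+1) is contained in W^s, and W^(s+1) is an algebra: the two
   statements are proved by a simultaneous induction *)
Let sob_mul_succ s :
  (exists2 K, 1 <= K & forall f g c d, sob s f c -> sob s.+1 g d ->
     sob s (fun x => f x * g x) (K * c * d)) ->
  exists2 K, 1 <= K & forall f g c d, sob s.+1 f c -> sob s.+1 g d ->
     sob s.+1 (fun x => f x * g x) (K * c * d).
Proof.
move=> [K K1 H]; exists (2 * K); first by lra.
move=> f g c d fc gd; have c0 := sob_ge0 fc; have d0 := sob_ge0 gd.
have [fa [f' f'c ff']] := fc; have [ga [g' g'd gg']] := gd.
have [lfg fgP] := primitiveM hab (sob_cL1 f'c) (sob_cL1 g'd) ff' gg'.
have cd0 : 0 <= c * d by rewrite mulr_ge0.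
split.
  rewrite cabsM; apply: le_trans (ler_pM _ _ fa ga) _; rewrite ?cabs_ge0//.
  by rewrite -mulrA ler_peMl//; lra.
exists (fun t => f' t * g t + f t * g' t) => //.
have -> : 2 * K * c * d = K * c * d + K * d * c by ring.
apply: sobD; first exact: H.
by under eq_fun do rewrite mulrC; exact: H.
Qed.

Lemma sob_mul s : exists2 K, 1 <= K & forall f g c d, sob s f c -> sob s.+1 g d ->
  sob s (fun x => f x * g x) (K * c * d).
Proof.
elim: s => [|s IH].
  have [K K1 H] := sob_sup 0; exists K => // f g c d fc gd.
  have c0 := sob_ge0 fc; have d0 := sob_ge0 gd.
  have Kd0 : 0 <= K * d by rewrite mulr_ge0//; lra.
  have [mf {}fc] := fc; have mg := sob_cmeas gd.
  split; first exact: cmeasM.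
  (* The factor g is bounded by K d, so the product is compared with a constant multiple of f. *)
  have mKf : cmeas (fun x => (K * d)%:C * f x) by apply: cmeasM => //; exact: cmeas_cst.
  apply: (Lpnorm_le hab p1 _ (cmeasM mf mg) mKf).
  - by rewrite -mulrA mulrCA mulr_ge0// mulr_ge0//; lra.
  - move=> x xab; rewrite !cabsM mulrC ler_wpM2r ?cabs_ge0// cabs_real ger0_norm//.
    exact: H gd _ xab.
  - have := LpnormZ hab (K * d)%:C p1 c0 mf fc.
    by rewrite cabs_real ger0_norm// mulrAC.
have [K2 K21 H2] := sob_mul_succ IH; have [K3 K31 H3] := sob_pred s.+1.
exists (K2 * K3); first by rewrite mulr_ege1.
move=> f g c d fc /H3 gd; have := H2 _ _ _ _ fc gd.
by rewrite [K2 * K3 * c]mulrAC -!mulrA.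
Qed.

Lemma sob_alg s : exists2 K, 1 <= K & forall f g c d, sob s.+1 f c -> sob s.+1 g d ->
  sob s.+1 (fun x => f x * g x) (K * c * d).
Proof. exact: sob_mul_succ (sob_mul s). Qed.

Lemma csum_cvg (z : nat -> R[i]) (c : nat -> R) :
  (forall i, cabs (z i) <= c i) -> (forall i, c i.+1 <= c i / 2) ->
  exists l, forall J, cabs (l - \sum_(i < J) z i) <= 2 * c J.
Proof.
move=> zc cc; have c0 i : 0 <= c i by apply: le_trans (zc i); exact: cabs_ge0.
have tail J n : \sum_(i < n) c (J + i)%N <= 2 * c J.
  suff : \sum_(i < n) c (J + i)%N <= 2 * c J - 2 * c (J + n)%N by have := c0 (J + n)%N; lra.
  elim: n => [|n IH]; first by rewrite big_ord0 addn0 subrr.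
  by rewrite big_ord_recr/= addnS; have := cc (J + n)%N; lra.
pose S n := \sum_(i < n) z i.
have key (P : R[i] -> R) : (forall z w : R[i], P (z + w) = P z + P w) ->
    (forall z : R[i], `|P z| <= cabs z) -> cvgn (fun n => P (S n)).
  move=> PD Pc; apply: (@bounded_increments_cvg _ _ (2 * c 0%N)) => n.
  apply: le_trans (tail 0%N n); apply: ler_sum => i _.
  by rewrite /S big_ord_recr/= PD addrC addKr; apply: le_trans (Pc _) (zc _).
have Sr := key _ cReD (@cabs_Re R); have Si := key _ cImD (@cabs_Im R).
exists (limn (fun n => complex.Re (S n)) +i* limn (fun n => complex.Im (S n))) => J.
set l := _ +i* _.
have H : cabs (S (n + J)%N - S J) @[n --> \oo] --> cabs (l - S J).
  by apply: cvg_cabsB; rewrite /= (cvg_shiftn J (fun n => _ (S n))).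
rewrite -(cvg_lim _ H)//; apply: limr_le; first by apply/cvg_ex; eexists; exact: H.
apply: nearW => n; have -> : S (n + J)%N - S J = \sum_(i < n) z (J + i)%N.
  rewrite addnC; elim: n => [|n IH]; first by rewrite addn0 big_ord0 subrr.
  by rewrite addnS big_ord_recr/= -IH /S big_ord_recr/= addrAC.
apply: le_trans (cabs_sum _ _ _) _; apply: le_trans (tail J n).
by apply: ler_sum => i _.
Qed.

(** Initial values and derivatives are summed separately; the primitive of the summed derivatives,
    started at the summed initial values, is the limit. *)
Lemma sob_complete s (z : nat -> R -> R[i]) (c : nat -> R) :
  (forall i, sob s (z i) (c i)) -> (forall i, c i.+1 <= c i / 2) ->
  exists y, forall J, sob s (fun x => y x - \sum_(i < J) z i x) (2 * c J).
Proof.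
move=> zc cc; elim: s z zc => [|s IH] z zc.
  have [F [mF HF]] := Lp_complete hab p1 (fun i => (zc i).1) (fun i => (zc i).2) cc.
  exists F => J; split=> //; apply: cmeasB => //; apply: cmeas_sum => i.
  exact: (zc i).1.
have /choice[g Hg] : forall i, exists g, sob s g (c i) /\ primitive (z i) g.
  by move=> i; have [_ [g]] := zc i; exists g.
have [G HG] := IH g (fun i => (Hg i).1).
have [l Hl] := csum_cvg (fun i => (zc i).1) cc.
exists (fun t => l + cint t G) => J.
have lG : cL1 G.
  have := sob_cL1 (HG 0%N); congr cL1; apply/funext => x.
  by rewrite big_ord0 subr0.
apply: sob_ext (sob_int (Hl J) (HG J)) => t tab.
have /andP[at_ tb] : a <= t <= b by move: tab; rewrite in_itv.
have lg i : cL1 (g i) by exact: sob_cL1 (Hg i).1.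
have lS : cL1 (fun x => \sum_(i < J) g i x) by exact: cL1_sum.
rewrite (cintB tb lG lS) (cint_sum hab _ tb (fun i : 'I_J => lg i)).
have -> : \sum_(i < J) z i t = \sum_(i < J) z i a + \sum_(i < J) cint t (g i).
  by rewrite -big_split/=; apply: eq_bigr => i _; exact: (Hg i).2.
by rewrite opprD addrACA.
Qed.

End SobolevBound.

(** * Derivatives on [a, b] *)

Section DerivOn.
Context {R : realType}.
Notation mu := (@lebesgue_measure R).
Variables a b : R.
Hypothesis hab : a < b.
Implicit Types (f g y z : R -> R[i]) (x t : R).
Local Notation rhasder := (rhasder a b).
Local Notation rcont := (rcont a b).

Definition chasder f x l := rhasder (fun t => complex.Re (f t)) x (complex.Re l) /\
  rhasder (fun t => complex.Im (f t)) x (complex.Im l).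

Definition ccont f x := rcont (fun t => complex.Re (f t)) x /\
  rcont (fun t => complex.Im (f t)) x.

Lemma chasderP f x l : chasder f x l <-> forall e : R, 0 < e -> exists2 d : R, 0 < d &
  forall t, t \in `[a, b] -> `|t - x| < d ->
    cabs (f t - f x - l * (t - x)%:C) <= e * `|t - x|.
Proof.
have rE t : complex.Re (f t - f x - l * (t - x)%:C) =
    complex.Re (f t) - complex.Re (f x) - complex.Re l * (t - x).
  by rewrite !cReD !cReN cReM/= mulr0 subr0.
have iE t : complex.Im (f t - f x - l * (t - x)%:C) =
    complex.Im (f t) - complex.Im (f x) - complex.Im l * (t - x).
  by rewrite !cImD !cImN cImM/= mulr0 add0r.
split=> [[fr fi] e e0|H].
  have e20 : 0 < e / 2 by rewrite divr_gt0.
  have [d d0 Hd] := fr _ e20; have [d' d'0 Hd'] := fi _ e20.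
  exists (Num.min d d'); first by rewrite lt_min d0.
  move=> t tab; rewrite lt_min => /andP[td td'].
  apply: le_trans (cabs_le_Re_Im _) _; rewrite rE iE.
  have := Hd t tab td; have := Hd' t tab td'; lra.
split=> e e0; have [d d0 Hd] := H _ e0; exists d => // t tab td; apply: le_trans (Hd t tab td).
  by rewrite -rE cabs_Re.
by rewrite -iE cabs_Im.
Qed.

Lemma pos_complex (e : R[i]) : 0 < e -> exists2 r : R, 0 < r & e = r%:C.
Proof. by case: e => x y; rewrite ltcE/= => /andP[/eqP -> x0]; exists x. Qed.

Lemma cvg_diffquotP f x l : (diffquot f x @ within `[a, b] x^' --> l) <-> chasder f x l.
Proof.
have E t : t != x -> cabs (l - diffquot f x t) * `|t - x| = cabs (f t - f x - l * (t - x)%:C).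
  move=> tx; rewrite -cabs_real -cabsM cabs_distC mulrBl /diffquot mulfVK//.
  by rewrite (inj_eq (@complexI _)) subr_eq0.
split=> [/cvgrPdist_le H|/chasderP H].
  apply/chasderP => e e0; have eC : 0 < e%:C by rewrite ltcR.
  have := H _ eC; rewrite near_withinE => /nbhs_ballP[d /= d0 Hd].
  exists d => // t tab td; have [->|tx] := eqVneq t x.
    by rewrite !subrr mulr0 subrr cabs0 normr0 mulr0.
  rewrite -E// ler_wpM2r// -lecR cabsC; apply: Hd => //.
  by rewrite /ball/= distrC.
apply/cvgrPdist_le => _ /pos_complex[e e0 ->].
have [d d0 Hd] := H _ e0.
rewrite near_withinE; apply/nbhs_ballP; exists d => //= t xt tx tab.
rewrite -cabsC lecR; have tx0 : 0 < `|t - x| by rewrite normr_gt0 subr_eq0.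
rewrite -(ler_pM2r tx0) E//; apply: Hd => //.
by rewrite distrC.
Qed.

(** Since a < b, every point of [a, b] is an accumulation point of it. This makes limits of
    difference quotients unique, so that [lim] computes the derivative. *)
Lemma within_itv_proper x : x \in `[a, b] -> ProperFilter (within `[a, b] x^').
Proof.
move=> xab; apply: Build_ProperFilter.
move=> /nbhs_ballP[d /= d0 Hd].
have [t [tab tx td]] : exists t, [/\ t \in `[a, b], t != x & `|x - t| < d].
  move: xab; rewrite in_itv/= => /andP[ax xb].
  have [xlb|bx] := ltP x b.
    have m0 : 0 < Num.min d (b - x) by rewrite lt_min d0 subr_gt0.
    have md : Num.min d (b - x) <= d by rewrite ge_min lexx.
    have mb : Num.min d (b - x) <= b - x by rewrite ge_min lexx orbT.
    set m := Num.min _ _ in m0 md mb.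
    exists (x + m / 2); rewrite in_itv/=; split.
    - by apply/andP; split; lra.
    - by rewrite gt_eqF//; lra.
    - have -> : x - (x + m / 2) = - (m / 2) by lra.
      by rewrite normrN gtr0_norm; lra.
  have ax' : a < x by exact: lt_le_trans bx.
  have m0 : 0 < Num.min d (x - a) by rewrite lt_min d0 subr_gt0.
  have md : Num.min d (x - a) <= d by rewrite ge_min lexx.
  have mb : Num.min d (x - a) <= x - a by rewrite ge_min lexx orbT.
  set m := Num.min _ _ in m0 md mb.
  exists (x - m / 2); rewrite in_itv/=; split.
  - by apply/andP; split; lra.
  - by rewrite lt_eqF//; lra.
  - have -> : x - (x - m / 2) = m / 2 by lra.
    by rewrite gtr0_norm; lra.
exact: Hd tx tab.
Qed.

Lemma chasder_deriv_on f x l : x \in `[a, b] -> chasder f x l ->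
  derivable_on a b f x /\ deriv_on a b f x = l.
Proof.
move=> xab /cvg_diffquotP H; split; first by apply/cvg_ex; exists l.
have PF := within_itv_proper xab.
by apply: cvg_lim H; exact: norm_hausdorff.
Qed.

Lemma derivable_on_chasder f x : derivable_on a b f x -> chasder f x (deriv_on a b f x).
Proof. by move=> H; apply/cvg_diffquotP; exact: H. Qed.

(** The default is the same constant at every such point, which is what keeps [deriv_on] Borel in
    [deriv_on_cmeas]. *)
Lemma deriv_on_default f x : ~ derivable_on a b f x -> deriv_on a b f x = point.
Proof. by move=> H; apply: dvgP. Qed.

Lemma diffquot_eq f g x : x \in `[a, b] -> (forall t, t \in `[a, b] -> f t = g t) ->
  diffquot f x @ within `[a, b] x^' = diffquot g x @ within `[a, b] x^'.
Proof.
move=> xab fg; have H h k : (forall t, t \in `[a, b] -> h t = k t) ->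
    diffquot h x @ within `[a, b] x^' --> diffquot k x @ within `[a, b] x^'.
  move=> hk; apply: near_eq_cvg; rewrite near_withinE; apply: nearW => t tab.
  by rewrite /diffquot !hk.
apply/seteqP; split; apply: H => t tab; rewrite fg//.
Qed.

Lemma derivable_on_eq f g x : x \in `[a, b] -> (forall t, t \in `[a, b] -> f t = g t) ->
  derivable_on a b f x -> derivable_on a b g x.
Proof. by move=> xab fg; rewrite /derivable_on (diffquot_eq xab fg). Qed.

Lemma deriv_on_eq f g x : x \in `[a, b] -> (forall t, t \in `[a, b] -> f t = g t) ->
  deriv_on a b f x = deriv_on a b g x.
Proof. by move=> xab fg; rewrite /deriv_on (diffquot_eq xab fg). Qed.

Lemma derivn_on_eq i f g x : x \in `[a, b] -> (forall t, t \in `[a, b] -> f t = g t) ->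
  derivn_on a b i f x = derivn_on a b i g x.
Proof.
elim: i x => [|i IH] x xab fg; first exact: fg.
by apply: deriv_on_eq => // t tab; exact: IH.
Qed.

Lemma derivn_onSr i f : derivn_on a b i.+1 f = derivn_on a b i (deriv_on a b f).
Proof. by rewrite /derivn_on iterSr. Qed.

Lemma ccontP f : {within `[a, b], continuous f} <-> forall x, x \in `[a, b] -> ccont f x.
Proof.
split=> [/subspace_continuousP H x xab|H].
  have /cvgrPdist_lt {}H := H x xab.
  have {}H e : 0 < e -> exists2 d : R, 0 < d & forall t, t \in `[a, b] ->
      `|t - x| < d -> cabs (f t - f x) < e.
    move=> e0; have eC : 0 < e%:C by rewrite ltcR.
    have := H _ eC; rewrite near_withinE => /nbhs_ballP[d /= d0 Hd].
    exists d => // t tab td; rewrite cabs_distC -ltcR cabsC.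
    by apply: Hd => //; rewrite /ball/= distrC.
  split=> e e0; have [d d0 Hd] := H _ e0; exists d => // t tab td;
    apply: le_lt_trans (Hd t tab td).
    by rewrite -cReN -cReD cabs_Re.
  by rewrite -cImN -cImD cabs_Im.
apply/subspace_continuousP => x xab; apply/cvgrPdist_lt => _ /pos_complex[e e0 ->].
have [Hr Hi] := H x xab; have e20 : 0 < e / 2 by rewrite divr_gt0.
have [d d0 Hd] := Hr _ e20; have [d' d'0 Hd'] := Hi _ e20.
rewrite near_withinE; apply/nbhs_ballP; exists (Num.min d d') => /=.
  by rewrite lt_min d0.
move=> t; rewrite /ball/= distrC lt_min => /andP[td td'] tab.
rewrite -cabsC ltcR cabs_distC; apply: le_lt_trans (cabs_le_Re_Im _) _.
rewrite cReD cReN cImD cImN; have := Hd t tab td; have := Hd' t tab td'; lra.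
Qed.

Lemma chasder_ccont f x l : chasder f x l -> ccont f x.
Proof. by move=> [/rhasder_cont ? /rhasder_cont ?]. Qed.

Lemma abs_cont_onP f : abs_cont_on a b f <->
  rabs_cont a b (fun t => complex.Re (f t)) /\ rabs_cont a b (fun t => complex.Im (f t)).
Proof.
split=> [H|[Hr Hi] e e0].
  split=> e e0; have [d d0 Hd] := H _ e0; exists d => // N u v uv dj uvd;
    apply: le_lt_trans (Hd N u v uv dj uvd); apply: ler_sum => i _.
    by rewrite -cReN -cReD cabs_Re.
  by rewrite -cImN -cImD cabs_Im.
have e20 : 0 < e / 2 by rewrite divr_gt0.
have [d d0 Hd] := Hr _ e20; have [d' d'0 Hd'] := Hi _ e20.
exists (Num.min d d'); first by rewrite lt_min d0.
move=> N u v uv dj; rewrite lt_min => /andP[td td'].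
have := ltrD (Hd N u v uv dj td) (Hd' N u v uv dj td').
rewrite -splitr -big_split/=; apply: le_lt_trans; apply: ler_sum => i _.
by apply: le_trans (cabs_le_Re_Im _) _; rewrite cReD cReN cImD cImN.
Qed.

End DerivOn.

(** * Borel measurability of derivatives and of the set of differentiability *)

Section DerivMeasurable.
Context {R : realType}.
Notation mu := (@lebesgue_measure R).
Variables a b : R.
Hypothesis hab : a < b.
Implicit Types (x t : R).
Local Notation rhasder := (rhasder a b).
Local Notation rcont := (rcont a b).

(** Clamping by [minn] puts every index pair in [a, b], so countable intersections over all i and j
    carry no side condition. *)
Definition grid (i j : nat) : R := a + (b - a) * ((minn i j.+1)%:R / j.+1%:R).

Lemma grid_itv i j : grid i j \in `[a, b].
Proof.
have ba : 0 < b - a by rewrite subr_gt0.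
have g0 : 0 <= (minn i j.+1)%:R / j.+1%:R :> R by rewrite divr_ge0.
have g1 : (minn i j.+1)%:R / j.+1%:R <= 1 :> R.
  by rewrite ler_pdivrMr ?ltr0n// mul1r ler_nat geq_minr.
rewrite in_itv/= /grid; apply/andP; split; first by rewrite lerDl mulr_ge0// ltW.
by rewrite -lerBrDl ler_piMr// ltW.
Qed.

Lemma grid_dense t (e : R) : t \in `[a, b] -> 0 < e -> exists i j, `|grid i j - t| < e.
Proof.
move=> tab e0; have ba : 0 < b - a by rewrite subr_gt0.
have /andP[at_ tb] : a <= t <= b by move: tab; rewrite in_itv.
pose j := Num.truncn ((b - a) / e).
have jlt : (b - a) / e < j.+1%:R by exact: truncnS_gt.
pose s := (t - a) / (b - a).
have s0 : 0 <= s by rewrite divr_ge0 ?subr_ge0// ltW.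
have s1 : s <= 1 by rewrite ler_pdivrMr// mul1r lerD2r.
pose i := Num.truncn (s * j.+1%:R).
have sj0 : 0 <= s * j.+1%:R by rewrite mulr_ge0.
have iL : i%:R <= s * j.+1%:R by rewrite truncn_le.
have iU : s * j.+1%:R < i.+1%:R by exact: truncnS_gt.
have ij : (i <= j.+1)%N.
  by rewrite -(ler_nat R); apply: le_trans iL _; rewrite ler_piMl.
exists i, j; rewrite /grid (minn_idPl ij).
have -> : t = a + (b - a) * s by rewrite /s mulrCA mulfV ?gt_eqF// mulr1 addrC subrK.
have j0 : 0 < j.+1%:R :> R by rewrite ltr0n.
have -> : a + (b - a) * (i%:R / j.+1%:R) - (a + (b - a) * s) =
   - ((b - a) * ((s * j.+1%:R - i%:R) / j.+1%:R)).
  by field; rewrite gt_eqF.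
rewrite normrN ger0_norm; last by rewrite mulr_ge0 ?(ltW ba)// divr_ge0 ?subr_ge0// ltW.
rewrite mulrA ltr_pdivrMr//; apply: (@le_lt_trans _ _ (b - a)).
  by rewrite ler_piMr ?(ltW ba)//; move: iU; rewrite -natr1; lra.
by rewrite mulrC -ltr_pdivrMr.
Qed.

(* Borel measurability of the derivative: L is the upper limit of difference
   quotients along a sequence, and differentiability at x is tested on a
   countable dense set of increments. *)
Lemma deriv_measurable (g : R -> R) : (forall x, x \in `[a, b] -> rcont g x) ->
  exists L : R -> R, [/\ measurable_fun `[a, b] L,
    measurable (`[a, b] `&` [set x | rhasder g x (L x)]) &
    forall x l, a <= x < b -> rhasder g x l -> L x = l].
Proof.
move=> gc.
pose tn (n : nat) x := x + (b - x) / n.+2%:R.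
(* The increments point towards b and stay in [a, b]; at b they vanish, hence the restriction x < b
   in the last clause. The inverse is written as a power, for which measurability is available. *)
pose q n x := (g (tn n x) - g x) * ((b - x) / n.+2%:R) `^ (-1).
have tnab n x : x \in `[a, b] -> tn n x \in `[a, b].
  rewrite !in_itv/= => /andP[ax xb]; rewrite /tn; apply/andP; split.
    by apply: le_trans ax _; rewrite lerDl divr_ge0// subr_ge0.
  by rewrite -lerBrDl ler_pdivrMr ?ltr0n// ler_peMr ?subr_ge0// ler1n.
have mg : measurable_fun `[a, b] g by exact: rcont_measurable.
have mq n : measurable_fun `[a, b] (q n).
  apply: measurable_funM; first apply: measurable_funB => //.
    apply: rcont_measurable => x xab e e0.
    have [d d0 Hd] := gc _ (tnab n x xab) e e0; exists d => // t tab td.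
    apply: Hd; first exact: tnab.
    have -> : tn n t - tn n x = (t - x) * (1 - n.+2%:R^-1) by rewrite /tn; ring.
    have n1 : n.+2%:R^-1 <= 1 :> R by rewrite invf_le1 ?ltr0n// ler1n.
    have n0 : 0 <= n.+2%:R^-1 :> R by rewrite invr_ge0.
    rewrite normrM [`|1 - _|]ger0_norm ?subr_ge0//; apply: le_lt_trans td.
    by rewrite ler_piMr//; lra.
  apply: (measurableT_comp (measurable_powR _)).
  by apply: measurable_funM => //; apply: measurable_funB.
pose L x := fine (limn_esup (fun n => (q n x)%:E)).
have mL : measurable_fun `[a, b] L.
  apply: measurableT_comp; first exact: fine_measurable.
  by apply: measurable_fun_limn_esup => n; apply/measurable_EFinP.
have Lu x l : a <= x < b -> rhasder g x l -> L x = l.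
  move=> /andP[ax xb] gl; suff ql : q n x @[n --> \oo] --> l.
    have qE : (q n x)%:E @[n --> \oo] --> l%:E by apply: cvg_EFin; [exact: nearW|exact: ql].
    by rewrite /L is_cvg_limn_esupE; [rewrite (cvg_lim _ qE)|apply/cvg_ex; eexists; exact: qE].
  apply/cvgrPdist_le => e e0; have [d d0 Hd] := gl _ e0.
  have [N _ HN] : \forall n \near \oo, (b - x) / n.+2%:R < d.
    exists (Num.truncn ((b - x) / d)) => // n /= Nn.
    rewrite ltr_pdivrMr ?ltr0n// mulrC -ltr_pdivrMr//.
    apply: lt_le_trans (truncnS_gt _) _; rewrite ler_nat ltnS.
    exact: leq_trans Nn _.
  exists N => // n /HN nd.
  have bx : 0 < (b - x) / n.+2%:R by rewrite divr_gt0// subr_gt0.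
  have tx : tn n x - x = (b - x) / n.+2%:R by rewrite /tn addrC addKr.
  have xab : x \in `[a, b] by rewrite in_itv/= ax ltW.
  have := Hd (tn n x) (tnab n x xab); rewrite tx (gtr0_norm bx) => /(_ nd).
  rewrite /q powR_inv1 ?(ltW bx)//.
  have -> : l - (g (tn n x) - g x) / ((b - x) / n.+2%:R) =
      - ((g (tn n x) - g x - l * ((b - x) / n.+2%:R)) / ((b - x) / n.+2%:R)).
    move: bx; set h := (b - x) / _ => h0.
    by field; rewrite gt_eqF.
  by rewrite normrN normrM normfV (gtr0_norm bx) ler_pdivrMr.
exists L; split => //.
pose S k n i j := `[a, b] `&` [set x | `|grid i j - x| < n.+1%:R^-1 ->
   `|g (grid i j) - g x - L x * (grid i j - x)| <= k.+1%:R^-1 * `|grid i j - x|].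
have -> : `[a, b] `&` [set x | rhasder g x (L x)] =
   \bigcap_k \bigcup_n \bigcap_i \bigcap_j S k n i j.
  apply/seteqP; split=> [x [xab gx] k _|x Hx].
    have k0 : 0 < k.+1%:R^-1 :> R by rewrite invr_gt0 ltr0n.
    have [d d0 Hd] := gx _ k0.
    pose n := Num.truncn d^-1; exists n => // i _ j _; split => // xd.
    apply: Hd; first exact: grid_itv.
    apply: lt_trans xd _; rewrite -[ltRHS]invrK ltf_pV2 ?posrE ?ltr0n ?invr_gt0//.
    exact: truncnS_gt.
  have xab : x \in `[a, b] by have [n _ /(_ 0%N I 0%N I)[]] := Hx 0%N I.
  split => // e e0; pose k := Num.truncn e^-1.
  have ke : k.+1%:R^-1 < e.
    by rewrite -[ltRHS]invrK ltf_pV2 ?posrE ?ltr0n ?invr_gt0//; exact: truncnS_gt.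
  have [n _ Hn] := Hx k I; exists n.+1%:R^-1; first by rewrite invr_gt0 ltr0n.
  move=> t tab td; apply/ler_addgt0Pl => r r0.
  pose K := 1 + `|L x| + e.
  have K0 : 0 < K by rewrite /K; have := normr_ge0 (L x); lra.
  have [d d0 Hd] := gc t tab (r / 2) (divr_gt0 r0 (ltr0n _ 2)).
  (* A grid point s within m of t changes g by less than r / 2, stays within 1 / (n + 1) of x, and
     satisfies (1 + |L x| + e) |s - t| < r / 2. Together these bound the loss in passing from s to t
     by r. *)
  pose m := Num.min d (Num.min (n.+1%:R^-1 - `|t - x|) (r / 2 / K)).
  have m0 : 0 < m by rewrite !lt_min d0 subr_gt0 td !divr_gt0.
  have [i [j ijm]] := grid_dense tab m0.
  have [md mn mr] : [/\ `|grid i j - t| < d, `|grid i j - t| < n.+1%:R^-1 - `|t - x| &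
      `|grid i j - t| < r / 2 / K].
    by split; apply: lt_le_trans ijm _; rewrite /m !ge_min lexx ?orbT.
  have sx : `|grid i j - x| <= `|grid i j - t| + `|t - x|.
    by apply: le_trans (ler_normD _ _); rewrite addrA subrK.
  have [_ /=] := Hn i I j I; have snx : `|grid i j - x| < n.+1%:R^-1.
    by apply: le_lt_trans sx _; rewrite -ltrBrDr.
  move=> /(_ snx) H; have Hg := Hd _ (grid_itv i j) md.
  have -> : g t - g x - L x * (t - x) =
    (g (grid i j) - g x - L x * (grid i j - x)) - (g (grid i j) - g t) +
    L x * (grid i j - t) by ring.
  apply: le_trans (ler_normD _ _) _.
  apply: le_trans (lerD (ler_normB _ _) (lexx _)) _; rewrite normrM.
  have H2 : k.+1%:R^-1 * `|grid i j - x| <= e * (`|grid i j - t| + `|t - x|).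
    by apply: ler_pM => //; exact: ltW.
  have H3 : `|grid i j - t| * K < r / 2 by rewrite -ltr_pdivlMr.
  apply: (@le_trans _ _ (e * (`|grid i j - t| + `|t - x|) + r / 2 + `|L x| * `|grid i j - t|)).
    by rewrite lerD2r lerD//; [exact: le_trans H2|exact: ltW].
  have -> : e * (`|grid i j - t| + `|t - x|) + r / 2 + `|L x| * `|grid i j - t| =
      (`|grid i j - t| * K - `|grid i j - t|) + r / 2 + e * `|t - x| by rewrite /K; ring.
  rewrite lerD2r [leRHS](splitr r) lerD2r; apply: le_trans (ltW H3).
  by rewrite gerBl.
apply: bigcapT_measurable => k; apply: bigcupT_measurable => n.
apply: bigcapT_measurable => i; apply: bigcapT_measurable => j.
(* The implication becomes a boolean function of x, so that measurability of boolean combinations of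
   comparisons applies. *)
have -> : S k n i j = `[a, b] `&` (fun x => ~~ (`|grid i j - x| < n.+1%:R^-1) ||
   (`|g (grid i j) - g x - L x * (grid i j - x)| <= k.+1%:R^-1 * `|grid i j - x|)) @^-1` [set true].
  apply/seteqP; split => x [xab] /= H; split=> //=; first by apply/orP; case: ltP H => _ H; [right; exact: H|left].
  by move=> h; move: H; rewrite h.
have mdist : measurable_fun `[a, b] (fun x => `|grid i j - x|).
  by apply: measurableT_comp => //; apply: measurable_funB.
have mfun : measurable_fun `[a, b] (fun x => ~~ (`|grid i j - x| < n.+1%:R^-1) ||
   (`|g (grid i j) - g x - L x * (grid i j - x)| <= k.+1%:R^-1 * `|grid i j - x|)).
  apply: measurable_or; first by apply: measurable_neg; apply: measurable_fun_ltr.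
  apply: measurable_fun_ler; last by apply: measurable_funM.
  apply: measurableT_comp => //; apply: measurable_funB; first by apply: measurable_funB.
  by apply: measurable_funM => //; apply: measurable_funB.
exact: mfun.
Qed.

End DerivMeasurable.

(** * The two descriptions of Sobolev spaces *)

Section SobolevSob.
Context {R : realType}.
Notation mu := (@lebesgue_measure R).
Variables a b : R.
Hypothesis hab : a < b.
Implicit Types (f g y z : R -> R[i]) (c d : R) (s : nat) (x t : R).
Local Notation cmeas := (cmeas a b).
Local Notation cL1 := (cL1 a b).
Local Notation Lpnorm := (Lpnorm a b).
Local Notation primitive := (primitive a b).
Local Notation cint := (cint a).
Local Notation rhasder := (rhasder a b).
Local Notation rcont := (rcont a b).
Local Notation chasder := (chasder a b).
Local Notation ccont := (ccont a b).
Local Notation deriv_on := (deriv_on a b).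
Local Notation derivn_on := (derivn_on a b).
Local Notation derivable_on := (derivable_on a b).

Let aab : a \in `[a, b]. Proof. by rewrite in_itv/= lexx ltW. Qed.

Lemma ccont_cmeas f : (forall x, x \in `[a, b] -> ccont f x) -> cmeas f.
Proof. by move=> fc; split; apply: rcont_measurable => x /fc[]. Qed.

Lemma rcont_L1 (f : R -> R) : (forall x, x \in `[a, b] -> rcont f x) -> integrable_on a b f.
Proof.
move=> fc; apply: continuous_compact_integrable; first exact: segment_compact.
apply/subspace_continuousP => x /= xab; apply/cvgrPdist_lt => e e0.
have [d d0 Hd] := fc x xab _ e0.
rewrite near_withinE; apply/nbhs_ballP; exists d => //= t; rewrite /ball/= => xt tab.
by rewrite distrC; apply: Hd => //; rewrite distrC.
Qed.

Lemma ccont_cL1 f : (forall x, x \in `[a, b] -> ccont f x) -> cL1 f.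
Proof. by move=> fc; split; apply: rcont_L1 => x /fc[]. Qed.

(** [Lp_on] demands measurability of the total function, default values included, even though they
    occur only on a null set in the application to [sobolev]. *)
Lemma deriv_on_cmeas f : (forall x, x \in `[a, b] -> ccont f x) -> cmeas (deriv_on f).
Proof.
move=> fc.
have [Lr [mLr mDr uLr]] := deriv_measurable hab (fun x xab => (fc x xab).1).
have [Li [mLi mDi uLi]] := deriv_measurable hab (fun x xab => (fc x xab).2).
set Dr := (X in measurable X) in mDr; set Di := (X in measurable X) in mDi.
(* On D the derivative is the measurable candidate, at b it is the single value v, and at all other
   points of [a, b] it is the default c. The end point b is apart because the candidate uses
   increments to the right. *)
pose D := Dr `&` Di `&` `[a, b[%classic.
have mD : measurable D by apply: measurableI => //; exact: measurableI.
have mb : measurable [set b] by exact: measurable_set1.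
pose c : R[i] := point; pose v := deriv_on f b.
have E x : x \in `[a, b] -> deriv_on f x =
    (\1_D x)%:C * (Lr x +i* Li x) + (1 - \1_D x - \1_[set b] x)%:C * c + (\1_[set b] x)%:C * v.
  rewrite in_itv/= => /andP[ax]; rewrite le_eqVlt => /predU1P[->|xb].
    rewrite !indicE [b \in [set b]]mem_set//.
    rewrite memNset; last by move=> [_]; rewrite /= in_itv/= ltxx andbF.
    by rewrite subr0 subrr !mul0r !add0r mul1r.
  have xab : x \in `[a, b] by rewrite in_itv/= ax ltW.
  rewrite [\1_[set b] x]indicE memNset; last by move=> /= xE; rewrite xE ltxx in xb.
  rewrite !subr0 mul0r addr0 indicE.
  have [xD|xD] := pselect (D x).
    rewrite mem_set//= subrr mul0r addr0 mul1r.
    by apply: (proj2 (chasder_deriv_on hab xab _)); split; case: xD => [[[_ ?] [_ ?]] _].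
  rewrite memNset//= mul0r add0r subr0 mul1r; apply: deriv_on_default => // /derivable_on_chasder.
  move=> [hr hi]; apply: xD; split; last by rewrite /= in_itv/= ax xb.
  have axb : a <= x < b by rewrite ax.
  by split; split => //=; rewrite ?(uLr _ _ axb hr) ?(uLi _ _ axb hi).
apply: (@cmeas_eq _ _ _ (fun x => (\1_D x)%:C * (Lr x +i* Li x) +
    (1 - \1_D x - \1_[set b] x)%:C * c + (\1_[set b] x)%:C * v)) => [x xab|]; first by rewrite E.
have mi (A : set R) : measurable A -> measurable_fun `[a, b] (\1_A : R -> R).
  by move=> mA; exact: measurable_indic.
apply: cmeasD; first apply: cmeasD; apply: cmeasM; try exact: cmeas_cst.
- by split => //=; exact: mi.
- by split.
- by split => //=; apply: measurable_funB; [apply: measurable_funB|] => //; exact: mi.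
- by split => //=; exact: mi.
Qed.

Lemma rhasder_eq (f g : R -> R) x l : x \in `[a, b] -> (forall t, t \in `[a, b] -> f t = g t) ->
  rhasder f x l -> rhasder g x l.
Proof.
move=> xab fg H e /H[d d0 Hd]; exists d => // t tab td.
by rewrite -!fg//; exact: Hd.
Qed.

Lemma rcont_eq (f g : R -> R) x : x \in `[a, b] -> (forall t, t \in `[a, b] -> f t = g t) ->
  rcont f x -> rcont g x.
Proof.
move=> xab fg H e /H[d d0 Hd]; exists d => // t tab td.
by rewrite -!fg//; exact: Hd.
Qed.

Lemma ac_primitive y g : abs_cont_on a b y -> cL1 g ->
  {ae mu, forall x, x \in `[a, b] -> chasder y x (g x)} -> primitive y g.
Proof.
move=> /abs_cont_onP[yr yi] [gr gi] yg t tab.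
have yr' : {ae mu, forall x, x \in `[a, b] -> rhasder (fun t => complex.Re (y t)) x (complex.Re (g x))}.
  by apply: ae_imp yg => x H /H[].
have yi' : {ae mu, forall x, x \in `[a, b] -> rhasder (fun t => complex.Im (y t)) x (complex.Im (g x))}.
  by apply: ae_imp yg => x H /H[].
have := FTC_rabs_cont hab yr gr yr' tab; have := FTC_rabs_cont hab yi gi yi' tab.
by move: (y t) (y a) => [? ?] [? ?] /= -> ->.
Qed.

Lemma cont_primitive y g : (forall x, x \in `[a, b] -> ccont g x) ->
  (forall x, x \in `[a, b] -> chasder y x (g x)) -> primitive y g.
Proof.
move=> gc yg t tab; have [gr gi] := ccont_cL1 gc.
have := FTC_cont hab gr (fun x xab => (gc x xab).1) (fun x xab => (yg x xab).1) tab.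
have := FTC_cont hab gi (fun x xab => (gc x xab).2) (fun x xab => (yg x xab).2) tab.
by move: (y t) (y a) => [? ?] [? ?] /= -> ->.
Qed.

Lemma rint_shift_hasder k (f : R -> R) x l : rhasder (fun t => rint a t f) x l ->
  rhasder (fun t => k + rint a t f) x l.
Proof. by move=> H; rewrite -[l]add0r; apply: rhasderD => //; exact: rhasder_cst. Qed.

Lemma primitive_ac y g : cL1 g -> primitive y g -> abs_cont_on a b y.
Proof.
move=> [gr gi] /primitive_ReIm[yr yi]; apply/abs_cont_onP; split.
  apply: rabs_cont_le (rint_rabs_cont gr); first exact: ler01.
  by move=> u v uab vab; rewrite (yr u)// (yr v)// mul1r opprD addrACA subrr add0r.
apply: rabs_cont_le (rint_rabs_cont gi); first exact: ler01.
by move=> u v uab vab; rewrite (yi u)// (yi v)// mul1r opprD addrACA subrr add0r.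
Qed.

Lemma primitive_chasder_ae y g : cL1 g -> primitive y g ->
  {ae mu, forall x, x \in `[a, b] -> chasder y x (g x)}.
Proof.
move=> [gr gi] /primitive_ReIm[yr yi].
apply: ae_imp (ae_and (rint_der_ae gr) (rint_der_ae gi)) => x [hr hi] xab.
split.
  by apply: rhasder_eq (rint_shift_hasder (complex.Re (y a)) (hr xab)) => // t tab; rewrite (yr t).
by apply: rhasder_eq (rint_shift_hasder (complex.Im (y a)) (hi xab)) => // t tab; rewrite (yi t).
Qed.

Lemma primitive_chasder y g x : cL1 g -> primitive y g -> x \in `[a, b] -> ccont g x ->
  chasder y x (g x).
Proof.
move=> [gr gi] /primitive_ReIm[yr yi] xab [cr ci]; split.
  by apply: rhasder_eq (rint_shift_hasder (complex.Re (y a)) (rint_der_cont hab gr xab cr)) => // t tab; rewrite (yr t).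
by apply: rhasder_eq (rint_shift_hasder (complex.Im (y a)) (rint_der_cont hab gi xab ci)) => // t tab; rewrite (yi t).
Qed.

Lemma primitive_ccont y g x : cL1 g -> primitive y g -> x \in `[a, b] -> ccont y x.
Proof.
move=> [gr gi] /primitive_ReIm[yr yi] xab.
have H k (f : R -> R) : rcont f x -> rcont (fun t => k + f t) x.
  move=> fc e /fc[d d0 Hd]; exists d => // t tab td.
  by rewrite opprD addrACA subrr add0r; exact: Hd.
split.
  by apply: rcont_eq (H (complex.Re (y a)) _ (rint_rcont gr xab)) => // t tab; rewrite (yr t).
by apply: rcont_eq (H (complex.Im (y a)) _ (rint_rcont gi xab)) => // t tab; rewrite (yi t).
Qed.

Variable p : \bar R.
Hypothesis p1 : (1 <= p)%E.
Local Notation sob := (sob a b p).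
Local Notation sobolev := (sobolev a b p).
Local Notation sobolev_norm := (sobolev_norm a b p).

Lemma Lpnorm_eq f g : (forall x, x \in `[a, b] -> f x = g x) -> Lpnorm p f = Lpnorm p g.
Proof.
move=> fg; rewrite /Defs.Lpnorm; congr (Lnorm _ _ (_ \o _)); apply/funext => x.
by rewrite !patchE; case: ifPn => // xab; rewrite fg//; rewrite inE in xab.
Qed.

Lemma Lp_on_sob0 y : Lp_on a b p y -> exists c, sob 0 y c.
Proof.
move=> [mr mi yoo]; exists (fine (Lpnorm p y)); split; first by split.
by rewrite fineK// ge0_fin_numE// Lnorm_ge0.
Qed.

Lemma sob0_Lp_on y c : sob 0 y c -> Lp_on a b p y.
Proof. by move=> [[mr mi] yc]; split => //; apply: le_lt_trans yc _; rewrite ltry. Qed.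

Lemma sobolev_ext s y z : (forall x, x \in `[a, b] -> y x = z x) ->
  sobolev s y -> sobolev s z.
Proof.
move=> yz; case: s => [|s] /=.
  by move=> /Lp_on_sob0[c /(sob_ext hab p1 yz) yc]; exact: sob0_Lp_on yc.
have E i x : x \in `[a, b] -> derivn_on i y x = derivn_on i z x.
  by move=> xab; exact: derivn_on_eq.
move=> [[yd yc] yac yae yL]; split; first split.
- by move=> i x is_ xab; apply: derivable_on_eq (yd i x is_ xab) => // t tab; exact: E.
- apply/ccontP => x xab; have [cr ci] := (ccontP _ _ _).1 yc x xab.
  by split; [apply: rcont_eq cr|apply: rcont_eq ci] => // t tab; rewrite E.
- move=> e /yac[d d0 Hd]; exists d => // N u v uv dj uvd.
  apply: le_lt_trans (Hd N u v uv dj uvd); apply: ler_sum => i _.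
  have [au uvi vb] := uv i.
  by rewrite !E// in_itv/= ?au ?vb ?andbT ?(le_trans uvi)// (le_trans au).
- by apply: ae_imp yae => x H xab; apply: derivable_on_eq (H xab) => // t tab; exact: E.
- by have [c /(sob_ext hab p1 (E s.+1)) yc'] := Lp_on_sob0 yL; exact: sob0_Lp_on yc'.
Qed.

Lemma sobolev_norm_ext s y z : (forall x, x \in `[a, b] -> y x = z x) ->
  sobolev_norm s y = sobolev_norm s z.
Proof.
move=> yz; apply: eq_bigr => i _; apply: Lpnorm_eq => x xab.
exact: derivn_on_eq.
Qed.

Lemma sobolev_normS s y : sobolev_norm s.+1 y =
  (Lpnorm p y + sobolev_norm s (deriv_on y))%E.
Proof.
rewrite /Defs.sobolev_norm big_ord_recl; congr (_ + _)%E.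
by apply: eq_bigr => i _; rewrite lift0 derivn_onSr.
Qed.

Lemma sobolev_norm_ge0 s y : (0 <= sobolev_norm s y)%E.
Proof. by apply: sume_ge0 => i _; exact: Lnorm_ge0. Qed.

Lemma sobolevSS s y : sobolev s.+2 y <->
  (forall x, x \in `[a, b] -> derivable_on y x) /\ sobolev s.+1 (deriv_on y).
Proof.
rewrite /Defs.sobolev /Ck_on !derivn_onSr.
split=> [[[yd yc] yac yae yL]|[yd [[yd' yc] yac yae yL]]].
  split; first by move=> x; exact: (yd 0).
  split => //; split => // i x is_ xab.
  by rewrite -derivn_onSr; exact: yd.
by split => //; split => // -[|i] x is_ xab; [exact: yd|rewrite derivn_onSr; exact: yd'].
Qed.

Lemma Ck_on_ccont k y x : Ck_on a b k y -> x \in `[a, b] -> ccont y x.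
Proof.
case: k => [|k] [yd yc] xab; first exact: (ccontP _ _ _).1.
exact: chasder_ccont (derivable_on_chasder (yd 0%N x _ xab)).
Qed.

Lemma sobolev_primitive s y : sobolev s.+1 y ->
  primitive y (deriv_on y) /\ sobolev s (deriv_on y).
Proof.
case: s => [|s].
  move=> [yc yac yae yL]; split => //.
  have [c yc'] := Lp_on_sob0 yL; apply: ac_primitive => //; first exact: sob_cL1 yc'.
  by apply: ae_imp yae => x H xab; exact: derivable_on_chasder (H xab).
move=> /sobolevSS[yd ys]; split => //; apply: cont_primitive => x xab.
  by case: ys => yc _ _ _; exact: Ck_on_ccont yc xab.
exact: derivable_on_chasder (yd x xab).
Qed.

(** The Sobolev norm contains no point value. Averaging y(a) = y(t) - [cint t g] over t in [a, b]
    bounds y(a) by the L_1 norms of y and g. *)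
Lemma primitive_start : exists2 K, 1 <= K & forall y g c, sob 0 y c -> cL1 g -> primitive y g ->
  rint a b (fun x => cabs (g x)) <= c -> cabs (y a) <= K * c.
Proof.
have [K K1 H] := sob_L1_sup hab p1 0; have ba : 0 < b - a by rewrite subr_gt0.
exists (K / (b - a) + 2); first by rewrite -[leLHS]add0r lerD// ?ler1n// divr_ge0// ltW// (lt_le_trans ltr01).
move=> y g c yc lg yg gc; have [ly yK] := H _ _ yc.
have bab : b \in `[a, b] by rewrite in_itv/= lexx ltW.
have : rint a b (fun=> cabs (y a)) <= rint a b (fun x => cabs (y x) + 2 * c).
  apply: (le_rint0 (b := b)) => //; first exact: (L1_cst hab).
    by apply: L1D; [exact: cL1_cabs|exact: (L1_cst hab)].
  move=> t tab; have -> : y a = y t - cint t g by rewrite (yg t tab) addrK.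
  apply: le_trans (cabsB _ _) _; rewrite lerD2l; apply: le_trans (cint_sup hab lg tab) _.
  by rewrite ler_wpM2l.
rewrite (rintD (b := b))//; [|exact: cL1_cabs|exact: (L1_cst hab)].
rewrite (rint_cst (cabs (y a)) (ltW hab)) (rint_cst (2 * c) (ltW hab)) => H1.
have H2 : cabs (y a) * (b - a) <= (K * c + 2 * c * (b - a)) by apply: le_trans H1 _; rewrite lerD2r.
rewrite -(ler_pM2r ba); apply: le_trans H2 _.
by rewrite (mulrDl (K / _)) [leRHS]mulrDl lerD2r mulrAC divfK// gt_eqF.
Qed.

(** Together with [sob_sobolev] this is the equivalence of the given norm with the one behind [sob];
    the initial values are supplied by [primitive_start]. *)
Lemma sobolev_sob s : exists2 K, 1 <= K & forall y c, sobolev s y ->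
  (sobolev_norm s y <= c%:E)%E -> sob s y (K * c).
Proof.
elim: s => [|s [K K1 IH]].
  exists 1 => // y c yL; rewrite /Defs.sobolev_norm big_ord1 => yc.
  by have [d [my _]] := Lp_on_sob0 yL; split => //; rewrite mul1r.
have [K' K'1 H'] := sob_L1_sup hab p1 s; have [S S1 HS] := primitive_start.
exists (S * (K' * K)); first by rewrite !mulr_ege1.
move=> y c /sobolev_primitive[yg ys]; rewrite sobolev_normS => yc.
have c0 : 0 <= c.
  by rewrite -lee_fin; apply: le_trans yc; rewrite adde_ge0 ?sobolev_norm_ge0// Lnorm_ge0.
have gc : (sobolev_norm s (deriv_on y) <= c%:E)%E.
  by apply: le_trans yc; rewrite leeDr// Lnorm_ge0.
have {}gc := IH _ _ ys gc; have [lg lgK] := H' _ _ gc.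
have yc0 : sob 0 y c.
  split; first exact: primitive_cmeas lg yg.
  by apply: le_trans yc; rewrite leeDl// sobolev_norm_ge0.
have KK : 1 <= K' * K by rewrite mulr_ege1.
split.
  rewrite -mulrA; apply: HS lg yg _; last by rewrite -mulrA.
  by apply: (sob_le (p := p)) yc0; rewrite ler_peMl.
exists (deriv_on y) => //; apply: (sob_le (p := p)) gc; rewrite -!mulrA mulrCA [leRHS]mulrA.
rewrite ler_peMl ?mulr_ge0 ?mulr_ege1//; exact: le_trans K1.
Qed.

Lemma sob_ccont s y c x : sob s.+1 y c -> x \in `[a, b] -> ccont y x.
Proof.
by move=> [_ [g gc yg]]; apply: (primitive_ccont _ yg); exact: sob_cL1 gc.
Qed.

Lemma primitive_deriv_on y g x : cL1 g -> primitive y g -> x \in `[a, b] -> ccont g x ->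
  deriv_on y x = g x.
Proof.
by move=> lg yg xab gc; have [] := chasder_deriv_on hab xab (primitive_chasder lg yg xab gc).
Qed.

Lemma sob_sobolev s : exists2 K, 1 <= K & forall y c, sob s y c ->
  sobolev s y /\ (sobolev_norm s y <= (K * c)%:E)%E.
Proof.
elim: s => [|s [K K1 IH]].
  exists 1 => // y c yc; split; first exact: sob0_Lp_on yc.
  by rewrite /Defs.sobolev_norm big_ord1 mul1r; case: yc.
have [C C1 HC] := sob_incl hab p1 (leq0n s.+1).
exists (C + K); first by rewrite -[leLHS]addr0 lerD// (le_trans ler01).
move=> y c yc; have c0 := sob_ge0 yc; have [_ yC] := HC _ _ yc.
case: (yc) => [ya [g gc yg]]; have lg := sob_cL1 hab p1 gc.
have [gs gK] := IH _ _ gc.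
have yct x : x \in `[a, b] -> ccont y x by exact: primitive_ccont lg yg.
suff [ys yK] : sobolev s.+1 y /\ (sobolev_norm s (deriv_on y) <= (K * c)%:E)%E.
  split => //; rewrite sobolev_normS mulrDl EFinD; exact: leeD.
(* For s = 0 the pointwise derivative equals g only almost everywhere, and its measurability comes
   from [deriv_on_cmeas]. For larger s the function g is continuous and equality holds on all of
   [a, b]. *)
case: s {IH HC yc} gc gs gK => [|s] gc gs gK.
  have ae_der : {ae mu, forall x, x \in `[a, b] -> chasder y x (g x)} by exact: primitive_chasder_ae.
  have dc : sob 0 (deriv_on y) c.
    case: gc => mg gc; split; first exact: deriv_on_cmeas.
    apply: (Lpnorm_le_ae hab p1 c0 _ mg _ gc); first exact: deriv_on_cmeas.
    apply: ae_imp ae_der => x H xab.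
    by have [_ ->] := chasder_deriv_on hab xab (H xab).
  split; last first.
    rewrite /Defs.sobolev_norm big_ord1/=; case: dc => _ dc; apply: le_trans dc _.
    by rewrite lee_fin ler_peMl.
  split; [split=> //; exact/ccontP| exact: primitive_ac lg yg | | exact: sob0_Lp_on dc].
  by apply: ae_imp ae_der => x H xab; have [] := chasder_deriv_on hab xab (H xab).
have gct x : x \in `[a, b] -> ccont g x by exact: sob_ccont gc.
have dE x : x \in `[a, b] -> g x = deriv_on y x.
  by move=> xab; rewrite (primitive_deriv_on lg yg xab (gct _ xab)).
split; last by rewrite -(sobolev_norm_ext _ dE).
apply/sobolevSS; split; last exact: sobolev_ext gs.
by move=> x xab; have [] := chasder_deriv_on hab xab (primitive_chasder lg yg xab (gct _ xab)).
Qed.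

Lemma sobolev_sob_ex s y : sobolev s y -> exists c, sob s y c.
Proof.
elim: s y => [|s IH] y; first exact: Lp_on_sob0.
move=> /sobolev_primitive[yg /IH[c gc]]; exists (Num.max (cabs (y a)) c).
split; first by rewrite le_max lexx.
by exists (deriv_on y) => //; apply: (sob_le (p := p)) gc; rewrite le_max lexx orbT.
Qed.

Lemma sobolev_derivn s j y : sobolev (s + j) y -> sobolev s (derivn_on j y).
Proof.
elim: j y => [|j IH] y; first by rewrite addn0.
by rewrite addnS => /sobolev_primitive[_ /IH]; rewrite derivn_onSr.
Qed.

Lemma sobolev_chain s r y j : sobolev (s + r) y -> (j < r)%N ->
  primitive (derivn_on j y) (derivn_on j.+1 y).
Proof.
move=> ys jr; have : sobolev (s + (r - j)) (derivn_on j y).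
  by apply: sobolev_derivn; rewrite -addnA subnK// ltnW.
by rewrite -(subnSK jr) addnS => /sobolev_primitive[].
Qed.

Lemma chain_cL1 r (Z : nat -> R -> R[i]) :
  (forall j, (j < r)%N -> primitive (Z j) (Z j.+1)) -> cL1 (Z r) ->
  forall j, (j <= r)%N -> cL1 (Z j).
Proof.
move=> Zp Zr j jr; rewrite -(subKn jr); move: (r - j)%N (leq_subr j r) => k.
elim: k => [|k IH] kr; first by rewrite subn0.
have := Zp (r - k.+1)%N; rewrite -subSn// subSS => H.
by apply: ccont_cL1 => x xab; apply: primitive_ccont (H _) xab; [exact: IH (ltnW kr)|exact: leq_subr].
Qed.

(** Below the top every [Z j] is itself a primitive, hence continuous, and is the derivative at
    every point. Only at the top does the answer depend on s. *)
Lemma chain_derivn r s (Z : nat -> R -> R[i]) c :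
  (forall j, (j < r)%N -> primitive (Z j) (Z j.+1)) -> sob s (Z r) c ->
  (forall j x, (j < r)%N -> x \in `[a, b] -> derivn_on j (Z 0%N) x = Z j x) /\
  (if s is 0 then {ae mu, forall x, x \in `[a, b] -> derivn_on r (Z 0%N) x = Z r x}
   else forall x, x \in `[a, b] -> derivn_on r (Z 0%N) x = Z r x).
Proof.
move=> Zp Zr.
have lZ := chain_cL1 Zp (sob_cL1 hab p1 Zr).
have H j x : (j < r)%N -> x \in `[a, b] -> derivn_on j (Z 0%N) x = Z j x.
  elim: j x => [//|j IH] x jr xab.
  rewrite /= (deriv_on_eq xab (fun t => IH t (ltnW jr))).
  apply: primitive_deriv_on => //; [exact: lZ (ltnW jr)|exact: Zp (ltnW jr)|].
  by apply: primitive_ccont (Zp _ jr) xab; exact: lZ.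
split => //; case: r Zp Zr lZ H => [|r] Zp Zr lZ H.
  by case: s Zr => // Zr; exact: aeW.
case: s Zr => [|s] Zr.
  apply: ae_imp (primitive_chasder_ae (lZ _ (leqnn _)) (Zp r (ltnSn r))) => x Hx xab.
  rewrite /= (deriv_on_eq xab (fun t => H r t (ltnSn r))).
  by have [] := chasder_deriv_on hab xab (Hx xab).
move=> x xab; rewrite /= (deriv_on_eq xab (fun t => H r t (ltnSn r))).
apply: primitive_deriv_on => //; [exact: lZ|exact: Zp|].
exact: sob_ccont Zr xab.
Qed.

Lemma chain_sob r s (Z : nat -> R -> R[i]) c :
  (forall j, (j < r)%N -> primitive (Z j) (Z j.+1)) ->
  (forall j, (j < r)%N -> cabs (Z j a) <= c) ->
  sob s (Z r) c -> sob (s + r) (Z 0%N) c.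
Proof.
elim: r Z => [|r IH] Z Zp Za Zr; first by rewrite addn0.
rewrite addnS; split; first exact: Za.
exists (Z 1%N); last exact: Zp.
by apply: (IH (fun j => Z j.+1)) => // j jr; [exact: Zp|exact: Za].
Qed.

End SobolevSob.

Lemma sum_pair (I J : finType) (V : nmodType) (F : I * J -> V) :
  \sum_q F q = \sum_i \sum_j F (i, j).
Proof.
rewrite (eq_bigr (fun q => F (q.1, q.2))); last by case.
by rewrite -(pair_bigA _ (fun i j => F (i, j))).
Qed.

(** * Linear differential equations *)

Section LinearODE.
Context {R : realType}.
Notation mu := (@lebesgue_measure R).
Variables a b : R.
Hypothesis hab : a < b.
Implicit Types (f g y z : R -> R[i]) (c d : R) (s : nat) (x t : R).
Local Notation cmeas := (cmeas a b).
Local Notation cL1 := (cL1 a b).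
Local Notation Lpnorm := (Lpnorm a b).
Local Notation primitive := (primitive a b).
Local Notation cint := (cint a).
Local Notation L1 := (integrable_on a b).

Lemma complex_linear_system_exists (I : finType) (Q : I -> I -> R -> R[i]) (u0 : I -> R[i]) :
  (forall i j, cL1 (Q i j)) ->
  exists u : I -> R -> R[i],
    (forall i, cL1 (fun x => \sum_j Q i j x * u j x)) /\
    forall i t, t \in `[a, b] ->
      u i t = u0 i + cint t (fun x => \sum_j Q i j x * u j x).
Proof.
move=> lQ.
(* Complex multiplication as a real 2 x 2 matrix; the boolean [true] marks imaginary parts. *)
pose Q' (p q : I * bool) x : R := let z := Q p.1 q.1 x in
  if p.2 then if q.2 then complex.Re z else complex.Im z
  else if q.2 then - complex.Im z else complex.Re z.
pose w0 (p : I * bool) : R := if p.2 then complex.Im (u0 p.1) else complex.Re (u0 p.1).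
have lQ' p q : L1 (Q' p q).
  rewrite /Q'; have [lr li] := lQ p.1 q.1.
  by case: (p.2); case: (q.2) => //=; exact: L1N.
have [v [lv [_ Hv]]] := linear_system_exists hab w0 lQ'.
pose u i t := v (i, false) t +i* v (i, true) t.
have sumE (F : I * bool -> R) : \sum_q F q = \sum_j (F (j, false) + F (j, true)).
  rewrite sum_pair; apply: eq_bigr => j _.
  by rewrite big_bool addrC.
have rE i : (fun x => \sum_q Q' (i, false) q x * v q x) =
    (fun x => complex.Re (\sum_j Q i j x * u j x)).
  apply/funext => x; rewrite sumE Re_sum; apply: eq_bigr => j _.
  by rewrite cReM /Q'/= mulNr.
have iE i : (fun x => \sum_q Q' (i, true) q x * v q x) =
    (fun x => complex.Im (\sum_j Q i j x * u j x)).
  apply/funext => x; rewrite sumE Im_sum; apply: eq_bigr => j _.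
  by rewrite cImM /Q'/= addrC.
exists u; split=> [i|i t tab].
  by split; [rewrite -rE|rewrite -iE]; exact: lv.
rewrite /u !Hv// rE iE /w0/=; case: (u0 i) => x y.
by apply/eqP; rewrite eq_complex/= !eqxx.
Qed.

Lemma ode_exists (m r : nat) (A : 'I_r -> 'I_m -> 'I_m -> R -> R[i])
    (z0 : 'I_r -> 'I_m -> R[i]) :
  (0 < r)%N -> (forall j i k, cL1 (A j i k)) ->
  exists Z : nat -> 'I_m -> R -> R[i],
    [/\ forall j i, (j < r)%N -> primitive (Z j i) (Z j.+1 i),
        forall i, cL1 (Z r i),
        forall i t, Z r i t = - \sum_(j < r) \sum_k A j i k t * Z j k t &
        forall (j : 'I_r) i, Z j i a = z0 j i].
Proof.
move=> r0 lA.
(* The companion matrix: a row below the last selects the next derivative, the last row carries the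
   negated coefficients. *)
pose Q (p q : 'I_r * 'I_m) t : R[i] := if (p.1.+1 < r)%N
  then ((q.1 == p.1.+1 :> nat) && (q.2 == p.2))%:R else - A q.1 p.2 q.2 t.
have lQ p q : cL1 (Q p q).
  rewrite /Q; case: (_ < r)%N; first exact: cL1_cst.
  exact: cL1N.
have [u [lu Hu]] := complex_linear_system_exists (fun p => z0 p.1 p.2) lQ.
(* Index r is the right-hand side itself, so the equation for [Z r] holds at every point and not
   just almost everywhere. *)
pose Z j i : R -> R[i] := if insub j is Some j' then u (j', i)
  else (fun t => - \sum_j \sum_k A j i k t * u (j, k) t).
have ZE (j : 'I_r) i : Z j i = u (j, i) by rewrite /Z valK.
have ZrE i : Z r i = (fun t => - \sum_j \sum_k A j i k t * u (j, k) t).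
  by rewrite /Z insubN// -leqNgt.
have gE (j : 'I_r) i : (fun t => \sum_q Q (j, i) q t * u q t) = Z j.+1 i.
  apply/funext => t; rewrite /Q/=; case: ltnP => jr.
    rewrite (ZE (Ordinal jr)) (bigD1 (Ordinal jr, i))//= !eqxx mul1r big1 ?addr0//.
    move=> [j' i'] /=; rewrite xpair_eqE -val_eqE/= => /negbTE ->; exact: mul0r.
  have -> : j.+1 = r by apply/anti_leq; rewrite jr ltn_ord.
  rewrite ZrE sum_pair -sumrN.
  by apply: eq_bigr => j' _; rewrite -sumrN; apply: eq_bigr => k _; rewrite mulNr.
have aab : a \in `[a, b] by rewrite in_itv/= lexx ltW.
have Ha (j : 'I_r) i : u (j, i) a = z0 j i by rewrite Hu// cint0 addr0.
exists Z; split.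
- move=> j i jr t tab; rewrite -(gE (Ordinal jr)) (ZE (Ordinal jr)).
  by rewrite Ha Hu.
- by move=> i; rewrite -(prednK r0) -(gE (Ordinal (_ : r.-1 < r)%N)) ?prednK//; exact: lu.
- by move=> i t; rewrite ZrE; congr (- _); apply: eq_bigr => j _; apply: eq_bigr => k _; rewrite ZE.
- by move=> j i; rewrite ZE Ha.
Qed.

(** [gronwall] applied to the sum of all moduli, with kernel 2 #|I| al. The inner factors 2 come
    from [cint_bnd], the outer 2 and the 4 from [gronwall]. *)
Lemma system_bound (I : finType) (u g : I -> R -> R[i]) (al be : R -> R) c c' :
  (forall i, cL1 (g i)) -> (forall i, primitive (u i) (g i)) ->
  L1 al -> L1 be -> (forall x, x \in `[a, b] -> 0 <= al x) ->
  (forall x, x \in `[a, b] -> 0 <= be x) ->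
  (forall i x, x \in `[a, b] -> cabs (g i x) <= al x * (\sum_j cabs (u j x)) + be x) ->
  0 <= c -> (forall i, cabs (u i a) <= c) -> rint a b be <= c' ->
  forall i t, t \in `[a, b] ->
    cabs (u i t) <= 2 * (#|I|%:R * (c + 2 * c')) * expR (4 * (2 * #|I|%:R * rint a b al)).
Proof.
move=> lg ug lal lbe al0 be0 gle c0 uac bec i t tab.
have bab : b \in `[a, b] by rewrite in_itv/= lexx ltW.
pose N : R := #|I|%:R; pose phi x := \sum_j cabs (u j x).
have uc j x : x \in `[a, b] -> ccont a b (u j) x by exact: primitive_ccont (lg j) (ug j).
have c'0 : 0 <= c' by apply: le_trans bec; exact: rint_ge0 be0 (lexx b).
have um j : cmeas (u j) by apply: ccont_cmeas => // x; exact: uc.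
have mphi : measurable_fun `[a, b] phi.
  by apply: measurable_sum => j; exact: cmeas_cabs.
have ub j x : x \in `[a, b] -> cabs (u j x) <= c + 2 * rint a x (fun v => cabs (g j v)).
  move=> xab; rewrite (ug j x xab); apply: le_trans (cabsD _ _) _.
  by apply: lerD => //; exact: cint_bnd.
have phi0 x : 0 <= phi x by apply: sumr_ge0 => j _; exact: cabs_ge0.
pose M := \sum_j (c + 2 * rint a b (fun v => cabs (g j v))).
have phiM x : x \in `[a, b] -> `|phi x| <= M.
  move=> xab; rewrite ger0_norm//; apply: ler_sum => j _; apply: le_trans (ub j x xab) _.
  rewrite lerD2l ler_wpM2l//; apply: le_trans (ler_norm _) _.
  apply: le_trans (rint_bnd hab (cL1_cabs (lg j)) xab) _.
  by apply: (le_rint0 (b := b)) => // [||v _]; rewrite ?ger0_norm ?cabs_ge0//; [apply: L1_norm|]; exact: cL1_cabs.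
have lap : L1 (fun x => al x * phi x) by exact: L1M lal mphi phiM.
pose h x := 2 * N * al x.
have lh : L1 h by exact: L1Z.
have N0 : 0 <= N by [].
have Hphi x : x \in `[a, b] -> phi x <= N * (c + 2 * c') + rint a x (fun v => h v * phi v).
  move=> xab; have /andP[ax xb] : a <= x <= b by move: xab; rewrite in_itv.
  have -> : rint a x (fun v => h v * phi v) = 2 * N * rint a x (fun v => al v * phi v).
    by rewrite -(rintZ _ xb)//; congr rint; apply/funext => v; rewrite /h mulrA.
  have bx : rint a x be <= c'.
    apply: le_trans bec; apply: le_trans (ler_norm _) _; apply: le_trans (rint_bnd hab lbe xab) _.
    by apply: (le_rint0 (b := b)) => // [|v vab]; [exact: L1_norm|rewrite ger0_norm// be0].
  have -> : N * (c + 2 * c') + 2 * N * rint a x (fun v => al v * phi v) =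
     \sum_(j : I) (c + 2 * (c' + rint a x (fun v => al v * phi v))).
    by rewrite sumr_const -mulr_natl /N; ring.
  apply: ler_sum => j _; apply: le_trans (ub j x xab) _; rewrite lerD2l ler_wpM2l//.
  apply: (@le_trans _ _ (rint a x (fun v => al v * phi v + be v))).
    by apply: (le_rint0 (b := b)) => //; [exact: cL1_cabs|exact: L1D|move=> v; exact: gle].
  by rewrite (rintD xb)// addrC lerD2r.
have c1 : 0 <= N * (c + 2 * c') by rewrite mulr_ge0// addr_ge0// mulr_ge0.
have h0 x : x \in `[a, b] -> 0 <= h x by move=> xab; rewrite mulr_ge0 ?mulr_ge0// al0.
have := gronwall hab lh h0 mphi (ex_intro _ M phiM) c1 Hphi tab.
rewrite (rintZ _ (lexx b))//; apply: le_trans.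
by rewrite /phi (bigD1 i)//= lerDl sumr_ge0// => j _; exact: cabs_ge0.
Qed.

Variable p : \bar R.
Hypothesis p1 : (1 <= p)%E.
Local Notation sob := (sob a b p).

Variables n r m : nat.

(* Z i = (Z_0, ..., Z_r) are the successive derivatives of the i-th component
   of a solution of L Z_0 = phi; d and c bound the coefficients and the data. *)
Definition ode_solution d (A : 'I_r -> 'I_m -> 'I_m -> R -> R[i])
    (phi : 'I_m -> R -> R[i]) (Z : nat -> 'I_m -> R -> R[i]) c :=
  [/\ forall j i k, sob n (A j i k) d, forall i, sob n (phi i) c,
      forall j i, (j < r)%N -> primitive (Z j i) (Z j.+1 i),
      forall i t, Z r i t = phi i t - \sum_(j < r) \sum_k A j i k t * Z j k t &
      (forall i, cL1 (Z r i)) /\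
      forall (j : nat) i, (j < r)%N -> cabs (Z j i a) <= c].

(** K is chosen before the coefficients and sees them only through d, so one constant serves the
    equations of all large k. Gronwall needs just their L_1 norms, which [sob_L1_sup] bounds for
    every n. *)
Lemma ode_sup_bound d : exists2 K, 1 <= K & forall A phi Z c,
  ode_solution d A phi Z c -> forall j i t, (j < r)%N -> t \in `[a, b] -> cabs (Z j i t) <= K * c.
Proof.
have [K K1 HK] := sob_L1_sup hab p1 n.
pose N : R := #|{: 'I_r * 'I_m}|%:R.
pose a1 : R := (b - a) + \sum_(j < r) \sum_(i < m) \sum_(k < m) K * d.
pose S := 2 * (N * (1 + 2 * (\sum_(i < m) K))) * expR (4 * (2 * N * a1)).
exists (`|S| + 1); first by rewrite lerDr.
move=> A phi Z c [Ad phic Zp Zr [lZ Za]] j i t jr tab.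
have c0 : 0 <= c by exact: sob_ge0 (phic i).
have /andP[at_ tb] : a <= t <= b by move: tab; rewrite in_itv.
have ba : a <= b by exact: ltW.
have bab : b \in `[a, b] by rewrite in_itv/= lexx ltW.
have lA j' i' k := sob_cL1 hab p1 (Ad j' i' k).
have lphi i' := sob_cL1 hab p1 (phic i').
(* The summand 1 covers the companion rows, where the derivative of one unknown is another; the
   remaining sum dominates each coefficient. *)
pose al x := 1 + \sum_j \sum_i \sum_k cabs (A j i k x).
pose be x := \sum_i cabs (phi i x).
have lal : L1 al.
  apply: L1D; first exact: (L1_cst hab).
  by do 3! (apply: (L1_sum hab) => ? _); exact: cL1_cabs.
have lbe : L1 be by apply: (L1_sum hab) => ? _; exact: cL1_cabs.
pose u (q : 'I_r * 'I_m) := Z q.1 q.2; pose g (q : 'I_r * 'I_m) := Z q.1.+1 q.2.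
have lZj j' i' : (j' <= r)%N -> cL1 (Z j' i').
  by apply: (chain_cL1 (Z := fun j => Z j i')) => // l; exact: Zp.
have A_le j' i' k x : cabs (A j' i' k x) <= al x - 1.
  rewrite /al addrC addKr (bigD1 j')//= (bigD1 i')//= (bigD1 k)//= -!addrA lerDl.
  by rewrite !addr_ge0// sumr_ge0// => ? _; rewrite ?cabs_ge0// sumr_ge0// => ? _; rewrite ?cabs_ge0// sumr_ge0// => ? _; rewrite cabs_ge0.
have al1 x : 1 <= al x.
  by rewrite lerDl; do 3! (apply: sumr_ge0 => ? _); exact: cabs_ge0.
have := @system_bound _ u g al be c (\sum_(i < m) K * c) _ _ lal lbe _ _ _ c0 _ _ (Ordinal jr, i) t tab.
rewrite /u/= => H; apply: le_trans (H _ _ _ _ _ _ _) _.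
- by move=> q; exact: lZj (ltn_ord q.1).
- by move=> q; exact: Zp.
- by move=> x _; exact: le_trans (al1 x).
- by move=> x _; apply: sumr_ge0 => ? _; exact: cabs_ge0.
- move=> q x xab.
  have be0 : 0 <= be x by apply: sumr_ge0 => ? _; exact: cabs_ge0.
  pose ph := \sum_j cabs (u j x).
  have ph0 : 0 <= ph by apply: sumr_ge0 => ? _; exact: cabs_ge0.
  rewrite -/ph /g; have [qr|qr] := ltnP q.1.+1 r.
    apply: (@le_trans _ _ ph); last by rewrite -[leLHS]addr0 lerD// ler_peMl.
    rewrite /ph (bigD1 (Ordinal qr, q.2))//= lerDl sumr_ge0// => ? _; exact: cabs_ge0.
  have -> : q.1.+1 = r by apply/anti_leq; rewrite qr ltn_ord.
  rewrite Zr; apply: le_trans (cabsB _ _) _; rewrite addrC; apply: lerD; last first.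
    by rewrite /be (bigD1 q.2)//= lerDl sumr_ge0// => ? _; exact: cabs_ge0.
  apply: le_trans (cabs_sum _ _ _) _; rewrite /ph /u sum_pair mulr_sumr.
  apply: ler_sum => j' _; apply: le_trans (cabs_sum _ _ _) _; rewrite mulr_sumr.
  apply: ler_sum => k _; rewrite cabsM ler_wpM2r ?cabs_ge0//.
  by apply: le_trans (A_le _ _ _ _) _; rewrite gerBl.
- by move=> q; exact: Za.
- rewrite /be (rint_sum hab)//; last by move=> ? _; exact: cL1_cabs.
  by apply: ler_sum => i' _; have [] := HK _ _ (phic i').
have ral : rint a b al <= a1.
  rewrite /al (rintD (b := b))//; [|exact: (L1_cst hab)|by do 3! (apply: (L1_sum hab) => ? _); exact: cL1_cabs].
  rewrite (rint_cst 1 ba) mul1r lerD2l.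
  rewrite (rint_sum hab)//; last by move=> ? _; do 2! (apply: (L1_sum hab) => ? _); exact: cL1_cabs.
  apply: ler_sum => j' _.
  rewrite (rint_sum hab)//; last by move=> ? _; (apply: (L1_sum hab) => ? _); exact: cL1_cabs.
  apply: ler_sum => i' _.
  rewrite (rint_sum hab)//; last by move=> ? _; exact: cL1_cabs.
  by apply: ler_sum => k _; have [] := HK _ _ (Ad j' i' k).
apply: (@le_trans _ _ (S * c)); last first.
  by rewrite ler_wpM2r//; apply: le_trans (ler_norm _) _; rewrite lerDl.
rewrite /S -mulr_suml.
have -> : 2 * (N * (1 + 2 * (\sum_(i < m) K))) * expR (4 * (2 * N * a1)) * c =
  2 * (N * (c + 2 * ((\sum_(i < m) K) * c))) * expR (4 * (2 * N * a1)) by ring.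
have N0 : 0 <= N by [].
have sK : 0 <= \sum_(i < m) K by apply: sumr_ge0 => ? _; exact: le_trans K1.
rewrite ler_wpM2l ?ler_expR ?ler_wpM2l ?mulr_ge0// ?addr_ge0// ?mulr_ge0//.
Qed.

(** Bootstrapping on the top derivative: if [Z r] has order s < n, the equation expresses it through
    data and products of order s + 1. *)
Lemma ode_bound d : exists2 K, 1 <= K & forall A phi Z c,
  ode_solution d A phi Z c ->
  forall i, sob n (Z r i) (K * c) /\ sob (n + r) (Z 0%N i) (K * c).
Proof.
suff [K K1 H] : exists2 K, 1 <= K & forall A phi Z c,
    ode_solution d A phi Z c -> forall i, sob n (Z r i) (K * c).
  exists K => // A phi Z c HZ i; have [_ phic Zp _ [_ Za]] := HZ.
  have c0 : 0 <= c by exact: sob_ge0 (phic i).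
  split; first exact: H HZ _.
  apply: (@chain_sob _ _ _ _ r n (fun j => Z j i)) => [j jr|j jr|]; [exact: Zp| |exact: H HZ _].
  by apply: le_trans (Za j i jr) _; rewrite ler_peMl.
suff H s : (s <= n)%N -> exists2 K, 1 <= K & forall A phi Z c,
    ode_solution d A phi Z c -> forall i, sob s (Z r i) (K * c) by exact: H.
elim: s => [_|s IH sn].
  have [S S1 HS] := ode_sup_bound d.
  have [J J1 HJ] := sob_incl hab p1 (leq0n n).
  (* The absolute value is taken because the constant is chosen before any coefficient is at hand to
     show d >= 0. *)
  exists (J + \sum_(j < r) \sum_(k < m) S * (J * `|d|)).
    rewrite -[leLHS]addr0 lerD//; apply: sumr_ge0 => ? _; apply: sumr_ge0 => ? _.
    by rewrite !mulr_ge0// (le_trans ler01).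
  move=> A phi Z c HZ i; have [Ad phic Zp Zr [lZ Za]] := HZ.
  have c0 : 0 <= c by exact: sob_ge0 (phic i).
  have d0 (j : 'I_r) : 0 <= d by exact: sob_ge0 (Ad j i i).
  apply: (sob_ext hab p1 (y := fun t => phi i t - \sum_(j < r) \sum_k A j i k t * Z j k t)).
    by move=> x _; rewrite Zr.
  rewrite mulrDl; apply: (sobB hab p1); first exact: HJ.
  rewrite mulr_suml; apply: (sob_sum hab p1) => j; rewrite mulr_suml; apply: (sob_sum hab p1) => k.
  have [mA A0] := HJ _ _ (Ad j i k).
  have SK : 0 <= S * c by rewrite mulr_ge0// (le_trans ler01).
  have mZ : cmeas (Z j k).
    apply: ccont_cmeas => // x; apply: primitive_ccont (Zp j k (ltn_ord j)).
    by apply: (chain_cL1 (Z := fun j => Z j k)) (ltn_ord j) => // l; exact: Zp.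
  have mAZ : cmeas (fun x => A j i k x * Z j k x) by exact: cmeasM.
  split => //; apply: (Lpnorm_le hab p1 _ mAZ _ _ _).
  - by rewrite !mulr_ge0// (le_trans ler01).
  - exact: (cmeasM (cmeas_cst a b ((S * c)%:C)) mA).
  - move=> x xab; rewrite !cabsM mulrC ler_wpM2r ?cabs_ge0// cabs_real ger0_norm//.
    exact: HS HZ _ _ _ (ltn_ord j) xab.
  - have := LpnormZ hab ((S * c)%:C) p1 _ mA A0.
    rewrite cabs_real ger0_norm// ger0_norm ?(d0 j)//.
    have -> : S * (J * d) * c = S * c * (J * d) by ring.
    by apply; rewrite mulr_ge0 ?(d0 j)// (le_trans ler01).
have [K K1 HK] := IH (ltnW sn).
have [J J1 HJ] := sob_incl hab p1 sn.
have [P P1 HP] := sob_alg hab p1 s.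
(* Since j < r, at least one integration separates [Z j] from [Z r]; this is the order gained in
   each round. *)
have HI (j : 'I_r) : exists2 C, 1 <= C & forall y c, sob (s + (r - j)) y c -> sob s.+1 y (C * c).
  by apply: (sob_incl hab p1); rewrite -addn1 leq_add2l subn_gt0.
exists (J + \sum_(j < r) \sum_(k < m) P * (J * `|d|) * (s2val (cid2 (HI j)) * K)).
  rewrite -[leLHS]addr0 lerD//; apply: sumr_ge0 => j _; apply: sumr_ge0 => ? _.
  case: (cid2 (HI j)) => Cj Cj1 _ /=.
  by rewrite !mulr_ge0// (le_trans ler01).
move=> A phi Z c HZ i; have [Ad phic Zp Zr [lZ Za]] := HZ.
have c0 : 0 <= c by exact: sob_ge0 (phic i).
apply: (sob_ext hab p1 (y := fun t => phi i t - \sum_(j < r) \sum_k A j i k t * Z j k t)).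
  by move=> x _; rewrite Zr.
rewrite mulrDl; apply: (sobB hab p1); first exact: HJ.
rewrite mulr_suml; apply: (sob_sum hab p1) => j; rewrite mulr_suml; apply: (sob_sum hab p1) => k.
case: (cid2 (HI j)) => Cj Cj1 HCj /=.
have d0 : 0 <= d by exact: sob_ge0 (Ad j i i).
have -> : P * (J * `|d|) * (Cj * K) * c = P * (J * d) * (Cj * (K * c)).
  by rewrite ger0_norm//; ring.
apply: HP; first exact: HJ.
apply: HCj.
have := @chain_sob _ a b p (r - j)%N s (fun l => Z (j + l)%N k) (K * c).
rewrite addn0 => H; apply: H => [l lr|l lr|].
- by rewrite addnS; apply: Zp; rewrite -ltn_subRL.
- by apply: le_trans (Za _ _ _) _; rewrite -?ltn_subRL// ler_peMl.
- by rewrite subnKC ?(ltnW (ltn_ord j))//; exact: HK HZ _.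
Qed.

End LinearODE.

(* The gliding hump argument: if N_k (z_k) did not tend to 0, a sparse enough
   subseries of the z_k would converge to some y with N_k y not tending to 0. *)
Lemma gliding_hump (R : realType) (V : zmodType) (W : V -> R -> Prop) (N : nat -> V -> R)
    (z : nat -> V) :
  W 0 0 ->
  (forall x y s t, W x s -> W y t -> W (x + y) (s + t)) ->
  (forall x s, W x s -> W (- x) s) ->
  (forall (u : nat -> V) (e : nat -> R), (forall i, W (u i) (e i)) ->
     (forall i, e i.+1 <= e i / 2) ->
     exists y, forall J, W (y - \sum_(i < J) u i) (2 * e J)) ->
  (forall k x y s t, W x s -> W y t -> N k (x + y) <= N k x + N k y) ->
  (forall k x s, W x s -> N k (- x) = N k x) ->
  (forall k, exists C : R, 0 < C /\ forall x (s : R), 0 < s -> W x s -> N k x <= C * s) ->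
  (forall x s, W x s -> forall e : R, 0 < e -> \forall k \near \oo, N k x <= e) ->
  (forall e : R, 0 < e -> \forall k \near \oo, W (z k) e) ->
  forall e : R, 0 < e -> \forall k \near \oo, N k (z k) <= e.
Proof.
move=> W0 WD WN Wc ND NN NC Nx zW eps eps0.
apply: contrapT => H.
have {}H K : exists2 k, (K <= k)%N & eps < N k (z k).
  apply: contrapT => h; apply: H; exists K => // k Kk.
  by rewrite leNgt; apply/negP => ?; apply: h; exists k.
have [C HC] := choice NC.
have C0 k : 0 < C k by have [] := HC k.
have {}HC k x s : 0 < s -> W x s -> N k x <= C k * s by have [_] := HC k; exact.
(* A state holds the partial sum, the size allowed to the next term, and the least admissible index.
   The conditional form makes [good] satisfiable at every state, so that [choice] yields a total
   function. *)
pose good (st : V * R * nat) k := (exists s, W st.1.1 s) -> 0 < st.1.2 ->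
  [/\ (st.2 <= k)%N, W (z k) st.1.2, eps < N k (z k) & N k st.1.1 <= eps / 4].
have /choice[next Hnext] : forall st, exists k, good st k.
  move=> [[Y e] k0]; have [[[s Ys] e0]|h] := pselect ((exists s, W Y s) /\ 0 < e); last first.
    by exists 0%N => Ys e0; case: h.
  have eps40 : 0 < eps / 4 by rewrite divr_gt0.
  have [K1 _ HK1] := zW _ e0; have [K2 _ HK2] := Nx _ _ Ys _ eps40.
  have [k] := H (maxn k0 (maxn K1 K2)); rewrite !geq_max => /and3P[k0k K1k K2k] epsk.
  by exists k => _ _; split => //; [exact: HK1|exact: HK2].
(* Halving makes the subseries converge. The cap eps / (8 C_k) makes the tail after the chosen term,
   of size at most twice the next bound, contribute at most eps / 4 to N_k. *)
pose step (st : V * R * nat) := let k := next st in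
  (st.1.1 + z k, Num.min (st.1.2 / 2) (eps / (8 * C k)), k.+1).
pose st i := iter i step (0, 1, 0%N).
pose kp i := next (st i); pose e i := (st i).1.2.
have e0 i : 0 < e i.
  elim: i => [|i IH]; first exact: ltr01.
  by rewrite /e/= lt_min !divr_gt0// mulr_gt0.
have YE i : (st i).1.1 = \sum_(j < i) z (kp j).
  by elim: i => [|i IH]; rewrite ?big_ord0// big_ord_recr/= -IH.
have gd i : good (st i) (kp i) by exact: Hnext.
have WY i : (exists s, W (st i).1.1 s) /\ W (z (kp i)) (e i).
  elim: i => [|i [[s IHs] IHz]].
    by split; [exists 0|have [] := gd 0%N (ex_intro _ _ W0) ltr01].
  suff h : exists s, W (st i.+1).1.1 s by split => //; have [] := gd i.+1 h (e0 i.+1).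
  by exists (s + e i); exact: WD.
have G i := gd i (WY i).1 (e0 i).
have kpi i : (i <= kp i)%N.
  have kS j : (kp j < kp j.+1)%N by have [] := G j.+1.
  by elim: i => // i IH; exact: leq_ltn_trans (kS i).
have [y Hy] := Wc (fun i => z (kp i)) e (fun i => (WY i).2) (fun i => ltac:(by rewrite /e/= ge_min lexx)).
have Wy : W y (2 * e 0%N) by have := Hy 0%N; rewrite big_ord0 subr0.
have eps40 : 0 < eps / 4 by rewrite divr_gt0.
have [K _ HK] := Nx _ _ Wy _ eps40.
have {HK} := HK (kp K) (kpi K); have [_ _ GK1 GK2] := G K.
have [s Ws] := (WY K).1; have WzK := (WY K).2.
pose rest := y - \sum_(i < K.+1) z (kp i).
have Wr : W rest (2 * e K.+1) by exact: Hy.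
(* The chosen term is the limit minus the tail minus the earlier partial sum. At index [kp K] each
   has N at most eps / 4, by pointwise convergence, by the cap on sizes and by [good] respectively,
   whereas N of the term exceeds eps. *)
have zE : z (kp K) = y + (- rest + - (st K).1.1).
  have E (S w : V) : w = y + (- (y - (S + w)) + - S).
    by rewrite opprB addrC (addrAC _ (- S)) subrK addrAC subrr add0r.
  by rewrite YE /rest big_ord_recr/=; exact: E.
have Nr : N (kp K) rest <= eps / 4.
  apply: le_trans (HC _ _ _ _ Wr) _; first by rewrite mulr_gt0.
  have : e K.+1 <= eps / (8 * C (kp K)) by rewrite /e/= ge_min lexx orbT.
  rewrite ler_pdivlMr ?mulr_gt0// => h.
  have -> : C (kp K) * (2 * e K.+1) = (e K.+1 * (8 * C (kp K))) / 4 by field.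
  by rewrite ler_pM2r// invr_gt0.
have : N (kp K) (z (kp K)) <= N (kp K) y + (N (kp K) rest + N (kp K) (st K).1.1).
  rewrite zE; apply: le_trans (ND _ _ _ _ _ Wy (WD _ _ _ _ (WN _ _ Wr) (WN _ _ Ws))) _.
  rewrite lerD2l; apply: le_trans (ND _ _ _ _ _ (WN _ _ Wr) (WN _ _ Ws)) _.
  by rewrite (NN _ _ _ Wr) (NN _ _ _ Ws).
lra.
Qed.

Lemma mx_cvgP (R : realType) (m n : nat) (u : nat -> 'M[R[i]]_(m, n)) (M : 'M[R[i]]_(m, n)) :
  u @ \oo --> M <-> forall i j (e : R), 0 < e -> \forall k \near \oo, cabs (u k i j - M i j) <= e.
Proof.
split=> [uM i j e e0|H].
  have : nbhs M [set N : 'M[R[i]]_(m, n) | cabs (N i j - M i j) <= e].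
    exists (fun i' j' => [set z | cabs (z - M i' j') <= e]) => [i' j'|N]; last exact.
    apply/nbhs_ballP; exists e%:C => /=; first by rewrite ltcR.
    move=> z; rewrite -ball_normE/= -cabsC ltcR cabs_distC => /ltW; exact.
  exact: uM.
move=> A [P PM PA].
have : \forall k \near \oo, forall i j, P i j (u k i j).
  apply: filter_forall => i; apply: filter_forall => j.
  have /nbhs_ballP[_ /pos_complex[e e0 ->]] := PM i j.
  rewrite -ball_normE/= => eP.
  have e20 : 0 < e / 2 by rewrite divr_gt0.
  apply: filterS (H i j _ e20) => k uk; apply: eP => /=.
  rewrite -cabsC ltcR cabs_distC; apply: le_lt_trans uk _; lra.
by apply: filterS => k Pk; apply: PA => i j; exact: Pk.
Qed.

(** * Convergence to 0 in W_p^s, test polynomials, bounded operators *)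

Section StrongConvergence.
Context {R : realType}.
Notation mu := (@lebesgue_measure R).
Variables a b : R.
Hypothesis hab : a < b.
Implicit Types (f g y z : R -> R[i]) (c d : R) (s : nat) (x t : R).
Local Notation cL1 := (cL1 a b).
Local Notation primitive := (primitive a b).
Local Notation cint := (cint a).
Local Notation derivn_on := (derivn_on a b).
Variable p : \bar R.
Hypothesis p1 : (1 <= p)%E.
Local Notation sob := (sob a b p).
Local Notation sobolev := (sobolev a b p).
Local Notation sobolev_norm := (sobolev_norm a b p).

Definition sob_cvg0 s (f : nat -> R -> R[i]) :=
  forall e : R, 0 < e -> \forall k \near \oo, sob s (f k) e.

Lemma sob_cvg0_ext s (f g : nat -> R -> R[i]) :
  (forall k x, x \in `[a, b] -> f k x = g k x) -> sob_cvg0 s f -> sob_cvg0 s g.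
Proof.
move=> fg H e e0; apply: filterS (H e e0) => k.
by apply: (sob_ext hab p1) => x; exact: fg.
Qed.

Lemma sob_cvg0D s (f g : nat -> R -> R[i]) : sob_cvg0 s f -> sob_cvg0 s g -> sob_cvg0 s (fun k x => f k x + g k x).
Proof.
move=> H H' e e0; have e20 : 0 < e / 2 by rewrite divr_gt0.
apply: filterS2 (H _ e20) (H' _ e20) => k fk gk.
by rewrite [e]splitr; exact: (sobD hab p1).
Qed.

Lemma sob_cvg0N s (f : nat -> R -> R[i]) : sob_cvg0 s f -> sob_cvg0 s (fun k x => - f k x).
Proof.
by move=> H e e0; apply: filterS (H _ e0) => k; exact: (sobN hab p1).
Qed.

Lemma sob_cvg0_0 s : sob_cvg0 s (fun _ _ => 0).
Proof.
move=> e e0; apply: nearW => k; apply: sob_le (sob0 hab p1 s); exact: ltW.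
Qed.

Lemma sob_cvg0_sum (I : Type) (r : seq I) (P : pred I) s (F : I -> nat -> R -> R[i]) :
  (forall i, P i -> sob_cvg0 s (F i)) -> sob_cvg0 s (fun k x => \sum_(i <- r | P i) F i k x).
Proof.
move=> H; elim: r => [|i r IH].
  by apply: sob_cvg0_ext (sob_cvg0_0 s) => k x _; rewrite big_nil.
case Pi : (P i); last by apply: sob_cvg0_ext IH => k x _; rewrite big_cons Pi.
by apply: sob_cvg0_ext (sob_cvg0D (H i Pi) IH) => k x _; rewrite big_cons Pi.
Qed.

Lemma sob_cvg0M s (f : nat -> R -> R[i]) g c : sob_cvg0 s f -> sob s.+1 g c ->
  sob_cvg0 s (fun k x => f k x * g x).
Proof.
move=> H gc e e0; have [K K1 HK] := sob_mul hab p1 s.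
have c0 : 0 <= c by exact: sob_ge0 gc.
have c1 : 0 < K * (c + 1) by rewrite mulr_gt0 ?ltr_wpDl// (lt_le_trans ltr01).
apply: filterS (H _ (divr_gt0 e0 c1)) => k fk.
have gc1 : sob s.+1 g (c + 1) by apply: sob_le gc; rewrite lerDl.
have := HK _ _ _ _ fk gc1; congr (sob _ _ _).
by rewrite mulrAC mulrC divfK// gt_eqF.
Qed.

(** On [a, b] this is (t - a)^q / q!. Iterated integration makes the chain of primitives immediate,
    without differentiating powers. *)
Fixpoint pol (q : nat) : R -> R[i] := if q is q'.+1 then fun t => cint t (pol q') else fun=> 1.

Definition pol_deriv q j : R -> R[i] := if (j <= q)%N then pol (q - j) else fun=> 0.

Lemma pol_chain q j : primitive (pol_deriv q j) (pol_deriv q j.+1).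
Proof.
move=> t tab; rewrite /pol_deriv; have /andP[_ tb] : a <= t <= b by move: tab; rewrite in_itv.
have c0 : cint t (fun=> 0 : R[i]) = 0.
  have := cintN tb (cL1_cst hab 0); rewrite oppr0 => /eqP; rewrite -addr_eq0 -mulr2n mulrn_eq0/=.
  by move=> /eqP.
have [jq|jq] := ltnP j q; first by rewrite (ltnW jq) -(subnSK jq)/= cint0 add0r.
case: ifP => jq'; last by rewrite c0 add0r.
by have -> : (q - j = 0)%N; [apply/eqP; rewrite subn_eq0|rewrite c0 addr0].
Qed.

Lemma derivn_pol q j x : x \in `[a, b] -> derivn_on j (pol q) x = pol_deriv q j x.
Proof.
(* The chain is prolonged past q, so that it ends in 0, and past j, since [chain_derivn] gives
   equality at every point strictly below the top. *)
have Z0 : pol_deriv q (j + q).+1 = fun=> 0 by rewrite /pol_deriv ltnNge leq_addl.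
have Z0s : sob 0 (pol_deriv q (j + q).+1) 0 by rewrite Z0; exact: sob0.
have [+ _] := chain_derivn hab p1 (fun j _ => pol_chain q j) Z0s.
move=> /(_ j x) H xab; rewrite -H ?ltnS ?leq_addr//.
by rewrite /pol_deriv/= subn0.
Qed.

Lemma sob_pol q s : exists c, sob s (pol q) c.
Proof.
have Z0s : sob 0 (pol_deriv q (s + q).+1) 1.
  apply: sob_le ler01 _; rewrite /pol_deriv ltnNge leq_addl; exact: (sob0 hab p1 0).
have [K _ HK] : exists2 K, 1 <= K & forall y c, sob (0 + (s + q).+1) y c -> sob s y (K * c).
  by apply: (sob_incl hab p1); rewrite add0n -addnS leq_addr.
exists (K * 1); apply: HK; rewrite (_ : pol q = pol_deriv q 0); last by rewrite /pol_deriv subn0.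
apply: (@chain_sob _ a b p _ 0 (pol_deriv q)) => // [j _|j _]; first exact: pol_chain.
rewrite /pol_deriv; case: ifP => _; last by rewrite cabs0.
case: (q - j)%N => [|q']/=; first by rewrite (cabs_real 1) normr1.
by rewrite cint0 cabs0.
Qed.

Lemma sobolev0 s : sobolev s (fun=> 0).
Proof. by have [K _ H] := sob_sobolev hab p1 s; have [] := H _ _ (sob0 hab p1 s). Qed.

Lemma derivn_on0 j x : x \in `[a, b] -> derivn_on j (fun=> 0) x = 0.
Proof.
move=> xab.
have p0 (l : nat) : (l < j.+1)%N -> primitive (fun=> 0) (fun=> 0).
  move=> _ t tab; have := @pol_chain 0 1 t tab; rewrite /pol_deriv/=; exact.
have [/(_ j x (ltnSn j) xab)] := chain_derivn hab p1 (Z := fun=> fun=> 0) p0 (sob0 hab p1 0).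
by [].
Qed.

Section Norms.
Variables m s : nat.
Implicit Types Y : R -> 'cV[R[i]]_m.

Definition vsob Y c := forall i, sob s (fun t => Y t i 0) c.

Lemma vsob_sobolev : exists2 K, 0 < K & forall Y c, 0 <= c -> vsob Y c ->
  sobolev_mx a b p s Y /\ (sobolev_mx_norm a b p s Y <= (K * c)%:E)%E.
Proof.
have [K K1 HK] := sob_sobolev hab p1 s.
exists (1 + \sum_(i < m) K) => [|Y c c0 Yc].
  by rewrite ltr_wpDr// sumr_ge0// => _ _; rewrite (le_trans ler01).
split; first by move=> i j; rewrite ord1; have [] := HK _ _ (Yc i).
apply: (@le_trans _ _ ((\sum_(i < m) K * c)%:E)); last first.
  by rewrite lee_fin mulrDl mul1r -mulr_suml lerDr.
rewrite /sobolev_mx_norm -sumEFin; apply: lee_sum => i _.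
by rewrite big_ord1; have [] := HK _ _ (Yc i).
Qed.

Lemma sobolev_vsob Y : sobolev_mx a b p s Y -> exists2 c, 0 <= c & vsob Y c.
Proof.
move=> Ys; have /choice[c Hc] i := sobolev_sob_ex hab p1 (Ys i 0).
have c0 i : 0 <= c i by exact: sob_ge0 (Hc i).
exists (\sum_i c i); first exact: sumr_ge0.
by move=> i; apply: sob_le (Hc i); rewrite (bigD1 i)//= lerDl sumr_ge0.
Qed.

Lemma vsobD Y Z c d : vsob Y c -> vsob Z d -> vsob (Y + Z) (c + d).
Proof.
move=> Yc Zd i; apply: (sob_ext hab p1) (sobD hab p1 (Yc i) (Zd i)) => x _.
by rewrite fctE mxE.
Qed.

Lemma vsobN Y c : vsob Y c -> vsob (- Y) c.
Proof.
move=> Yc i; apply: (sob_ext hab p1) (sobN hab p1 (Yc i)) => x _.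
by rewrite fctE mxE.
Qed.

Lemma vsob0 : vsob 0 0.
Proof. by move=> i; apply: (sob_ext hab p1) (sob0 hab p1 s) => x _; rewrite mxE. Qed.

Lemma vsob_complete (Z : nat -> R -> 'cV[R[i]]_m) (c : nat -> R) :
  (forall i, vsob (Z i) (c i)) -> (forall i, c i.+1 <= c i / 2) ->
  exists Y, forall J, vsob (Y - \sum_(i < J) Z i) (2 * c J).
Proof.
move=> Zc cc.
have /choice[y Hy] i := sob_complete hab p1 (fun k => Zc k i) cc.
exists (fun t => \col_i y i t) => J i; apply: (sob_ext hab p1) (Hy i J) => x _.
by rewrite fctE/= !mxE fct_sumE summxE.
Qed.

Section ContinuousLinear.
Variables (l : nat) (B : (R -> 'cV[R[i]]_m) -> 'cV[R[i]]_l).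
Hypothesis hB : continuous_linear a b p s B.

Lemma cl_D Y Z c d : 0 <= c -> 0 <= d -> vsob Y c -> vsob Z d -> B (Y + Z) = B Y + B Z.
Proof.
move=> c0 d0 Yc Zd; have [K _ HK] := vsob_sobolev.
have := hB.1 1 Y Z (HK _ _ c0 Yc).1 (HK _ _ d0 Zd).1; rewrite scale1r => <-.
by congr B; apply/funext => t; rewrite scale1r.
Qed.

Lemma cl_0 : B 0 = 0.
Proof.
have := cl_D (lexx 0) (lexx 0) vsob0 vsob0; rewrite addr0 => /eqP.
by rewrite -subr_eq subrr => /eqP <-.
Qed.

Lemma cl_N Y c : 0 <= c -> vsob Y c -> B (- Y) = - B Y.
Proof.
move=> c0 Yc; apply/eqP; rewrite -addr_eq0 -(cl_D c0 c0 (vsobN Yc) Yc).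
by rewrite addNr cl_0.
Qed.

(** Continuity at 0 for the single tolerance 1 gives boundedness by homogeneity. *)
Lemma cl_bound : exists C : R, 0 < C /\ forall Y c, 0 < c -> vsob Y c ->
  \sum_j cabs (B Y j 0) <= C * c.
Proof.
have [K K0 HK] := vsob_sobolev.
have s0 := (HK _ _ (lexx 0) vsob0).1.
have [d d0 Hd] := hB.2 _ s0 1 ltr01.
exists (2 * K / d); split; first by rewrite divr_gt0 ?mulr_gt0.
(* The factor la brings the Sobolev norm of la Y down to at most K la c = d / 2 < d. *)
move=> Y c c0 Yc; pose la := d / (2 * K * c).
have la0 : 0 < la by rewrite divr_gt0 ?mulr_gt0.
have sla : vsob (fun t => la%:C *: Y t + (0 : R -> 'cV[R[i]]_m) t) (la * c).
  move=> i; have := sobZ hab p1 la%:C (Yc i); rewrite cabs_real gtr0_norm//.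
  by apply: (sob_ext hab p1) => x _; rewrite !mxE addr0.
have lac : 0 <= la * c by rewrite mulr_ge0 ?ltW.
have [s1 _] := HK _ _ lac sla.
have sla' : vsob (fun t => (la%:C *: Y t + (0 : R -> 'cV[R[i]]_m) t) - (0 : R -> 'cV[R[i]]_m) t) (la * c).
  by move=> i; apply: (sob_ext hab p1) (sla i) => x _; rewrite !mxE subr0.
have [_ n1] := HK _ _ lac sla'.
have := Hd _ s1; rewrite cl_0 (hB.1 _ _ _ (HK _ _ (ltW c0) Yc).1 s0) cl_0.
have h : K * (la * c) < d.
  have -> : K * (la * c) = d / 2 by rewrite /la; field; rewrite !gt_eqF.
  lra.
move=> /(_ (le_lt_trans n1 _)); rewrite lte_fin => /(_ h) H.
have {H} : la * (\sum_j cabs (B Y j 0)) < 1.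
  apply: le_lt_trans H; rewrite mulr_sumr; apply: ler_sum => j _.
  by rewrite !mxE subr0 addr0 cabsM cabs_real gtr0_norm.
rewrite mulrC -ltr_pdivlMr// => /ltW; congr (_ <= _).
by rewrite /la; field; rewrite !gt_eqF.
Qed.

End ContinuousLinear.

End Norms.

End StrongConvergence.

(** * Convergence of the coefficients *)

Section CoefficientConvergence.
Context {R : realType}.
Variables a b : R.
Hypothesis hab : a < b.
Variable p : \bar R.
Hypothesis p1 : (1 <= p)%E.
Local Notation sob := (sob a b p).
Local Notation sobolev := (sobolev a b p).
Local Notation sob_cvg0 := (sob_cvg0 a b p).

Lemma sob_pol_deriv q j s : exists c, sob s (pol_deriv a q j) c.
Proof.
rewrite /pol_deriv; case: ifP => _; first exact: (sob_pol hab p1).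
by exists 0; exact: (sob0 hab p1).
Qed.

Variables n m r l : nat.
Variables (A : 'I_r -> R -> 'M[R[i]]_m) (Ak : nat -> 'I_r -> R -> 'M[R[i]]_m).
Variables (B : (R -> 'cV[R[i]]_m) -> 'cV[R[i]]_l)
  (Bk : nat -> (R -> 'cV[R[i]]_m) -> 'cV[R[i]]_l).
Hypothesis hA : forall j, sobolev_mx a b p n (A j).
Hypothesis hAk : forall k j, sobolev_mx a b p n (Ak k j).
Hypothesis hcvg : strong_cvg a b p n A B Ak Bk.

Let test q k : R -> 'cV[R[i]]_m := fun t => pol a q t *: delta_mx k 0.

Let testE q k i : (fun t => test q k t i 0) = if i == k then pol a q else fun=> 0.
Proof.
apply/funext => t; rewrite !mxE eqxx andbT.
by case: eqP => _; rewrite ?mulr1 ?mulr0.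
Qed.

Let derivn_test q k i j t : t \in `[a, b] ->
  derivn_on a b j (fun t => test q k t i 0) t = (if i == k then pol_deriv a q j t else 0).
Proof.
move=> tab; rewrite testE; case: ifP => _; first exact: derivn_pol.
exact: (derivn_on0 hab p1).
Qed.

Let sobolev_test q k : sobolev_mx a b p (n + r) (test q k).
Proof.
move=> i j; rewrite ord1 testE; case: ifP => _; last exact: (sobolev0 hab p1).
have [c Hc] := sob_pol hab p1 q (n + r); have [K _ HK] := sob_sobolev hab p1 (n + r).
by have [] := HK _ _ Hc.
Qed.

(** The derivatives of order r cancel in the difference, and the basis vector selects column k of
    each coefficient. *)
Let diffop_test q k i kk t : t \in `[a, b] ->
  (diffop a b (Ak kk) (test q k) t - diffop a b A (test q k) t) i 0 =
  \sum_(j < r) (Ak kk j t i k - A j t i k) * pol_deriv a q j t.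
Proof.
move=> tab; rewrite /diffop opprD addrACA subrr add0r -sumrB summxE.
apply: eq_bigr => j _; rewrite -mulmxBl mxE (bigD1 k)//= big1 ?addr0.
  by rewrite !mxE derivn_test// eqxx.
by move=> k' kk'; rewrite [X in _ * X]mxE derivn_test// (negbTE kk') mulr0.
Qed.

Lemma sobolev_mx_sob (D : 'I_r -> R -> 'M[R[i]]_m) :
  (forall j, sobolev_mx a b p n (D j)) -> exists d, forall j i k, sob n (fun t => D j t i k) d.
Proof.
move=> hD.
have /choice[d Hd] (x : 'I_r * 'I_m * 'I_m) : exists c, sob n (fun t => D x.1.1 t x.1.2 x.2) c.
  exact: (sobolev_sob_ex hab p1 (hD _ _ _)).
exists (\sum_x d x) => j i k; apply: sob_le (Hd (j, i, k)).
rewrite (bigD1 (j, i, k))//= lerDl; apply: sumr_ge0 => x _; exact: sob_ge0 (Hd x).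
Qed.

Let diffop_cvg q k i :
  sob_cvg0 n (fun kk t => \sum_(j < r) (Ak kk j t i k - A j t i k) * pol_deriv a q j t).
Proof.
move=> e e0; have [K K1 HK] := sobolev_sob hab p1 n.
have K0 : 0 < K by exact: lt_le_trans K1.
have [H _] := hcvg (sobolev_test q k).
have e1 : (0 < (e / K)%:E)%E by rewrite lte_fin divr_gt0.
have {}H : \forall kk \near \oo, (sobolev_mx_norm a b p n (fun t =>
    diffop a b (Ak kk) (test q k) t - diffop a b A (test q k) t)%R < (e / K)%:E)%E.
  exact: (H [set y | (y < (e / K)%:E)%E] (open_nbhs_nbhs (conj (@open_ereal_lt_ereal _ _) e1))).
apply: filterS H => kk Hkk.
pose F t := (diffop a b (Ak kk) (test q k) t - diffop a b A (test q k) t).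
have E x : x \in `[a, b] -> F x i 0 = \sum_(j < r) (Ak kk j x i k - A j x i k) * pol_deriv a q j x.
  by move=> xab; exact: diffop_test.
apply: (sob_ext hab p1 E); rewrite -[e](divfK (lt0r_neq0 K0)) mulrC; apply: HK.
  (* A small norm alone does not give membership in W_p^n, which [sobolev_sob] also asks for; it
     comes from the product bound [sob_mul]. *)
  have [dA HA] := sobolev_mx_sob hA; have [dAk HAk] := sobolev_mx_sob (hAk kk).
  have /choice[c Hc] (j : 'I_r) : exists c,
      sob n (fun x => (Ak kk j x i k - A j x i k) * pol_deriv a q j x) c.
    have [P _ HP] := sob_mul hab p1 n; have [c Hc] := sob_pol_deriv q j n.+1.
    by eexists; apply: HP Hc; exact: (sobB hab p1 (HAk j i k) (HA j i k)).
  have [P _ HP] := sob_sobolev hab p1 n.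
  have [+ _] := HP _ _ (sob_sum hab p1 (index_enum _) Hc).
  by apply: (sobolev_ext hab p1) => x xab; rewrite E.
apply: le_trans (ltW Hkk); rewrite /sobolev_mx_norm (bigD1 i)//= big_ord1.
rewrite leeDl//; apply: sume_ge0 => i' _; apply: sume_ge0 => j' _; exact: sobolev_norm_ge0.
Qed.

(* Testing on (t - a)^q / q! isolates the coefficient A_q, once those of index
   smaller than q are known to converge. *)
Lemma coef_cvg (q : 'I_r) i k : sob_cvg0 n (fun kk t => Ak kk q t i k - A q t i k).
Proof.
suff H q' : forall q : 'I_r, (q < q')%N -> sob_cvg0 n (fun kk t => Ak kk q t i k - A q t i k).
  exact: (H q.+1).
elim: q' => // q' IH {}q qq'.
have H j : j != q -> sob_cvg0 n (fun kk t => (Ak kk j t i k - A j t i k) * pol_deriv a q j t).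
  move=> jq; have [jltq|qltj] := ltnP j q.
    have [c Hc] := sob_pol_deriv q j n.+1.
    by apply: (sob_cvg0M hab p1 _ Hc); apply: IH; exact: leq_trans jltq _.
  (* For j > q the j-th derivative of the test polynomial vanishes. *)
  apply: (sob_cvg0_ext hab p1) (sob_cvg0_0 hab p1 n) => kk x _.
  rewrite /pol_deriv leqNgt ltn_neqAle qltj andbT eq_sym.
  by rewrite (_ : (j == q :> nat) = false) ?mulr0//; exact: negbTE.
have := sob_cvg0D hab p1 (diffop_cvg q k i)
  (sob_cvg0N hab p1 (@sob_cvg0_sum _ a b hab p p1 _ (index_enum _) _ n _ H)).
apply: (sob_cvg0_ext hab p1) => kk x _.
rewrite (bigD1 q)//= addrK /pol_deriv leqnn subnn/= mulr1//.
Qed.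

End CoefficientConvergence.

Lemma ae_forall (R : realType) (I : finType) (P : I -> R -> Prop) :
  (forall i, {ae @lebesgue_measure R, forall x, P i x}) ->
  {ae @lebesgue_measure R, forall x, forall i, P i x}.
Proof. by apply: filter_forall; exact: (ae_filter_ringOfSetsType lebesgue_measure). Qed.

(** * Cauchy problems and their chains of primitives *)

Section CauchyProblem.
Context {R : realType}.
Notation mu := (@lebesgue_measure R).
Variables a b : R.
Hypothesis hab : a < b.
Variable p : \bar R.
Hypothesis p1 : (1 <= p)%E.
Local Notation sob := (sob a b p).
Local Notation sobolev := (sobolev a b p).
Local Notation cL1 := (cL1 a b).
Local Notation primitive := (primitive a b).
Local Notation derivn_on := (derivn_on a b).
Variables n m r : nat.
Hypothesis r0 : (0 < r)%N.

Definition coef (A : 'I_r -> R -> 'M[R[i]]_m) j i k t := A j t i k.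

Lemma diffop_entry (A : 'I_r -> R -> 'M[R[i]]_m) (Y : R -> 'M[R[i]]_m) t i q :
  diffop a b A Y t i q = derivn_on r (fun t => Y t i q) t +
   \sum_(j < r) \sum_k A j t i k * derivn_on j (fun t => Y t k q) t.
Proof.
rewrite !mxE summxE; congr (_ + _); apply: eq_bigr => j _; rewrite mxE.
by apply: eq_bigr => k _; rewrite mxE.
Qed.

(** Passage from a solution in the sense of [cauchy_problem] to a chain. The last clause records one
    order beyond n for the derivatives below r, which is what [sob_cvg0M] needs to multiply them by
    coefficients small in W_p^n. *)
Lemma cauchy_ode (A : 'I_r -> R -> 'M[R[i]]_m) d (i0 : 'I_r) Y (q : 'I_m) :
  (forall j i k, sob n (coef A j i k) d) -> cauchy_problem a b p n A i0 Y ->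
  exists Z, [/\ ode_solution a b p n d (coef A) (fun=> fun=> 0) Z 1,
    forall i, Z 0%N i = fun t => Y t i q,
    forall (j : 'I_r) i, Z j i a = ((i0 == j) && (i == q))%:R &
    forall (j : nat) i, (j < r)%N -> exists c, sob n.+1 (Z j i) c].
Proof.
move=> Ad [Ys Yeq Ya].
pose G j i : R -> R[i] := derivn_on j (fun t => Y t i q).
pose rhs i t : R[i] := 0 - \sum_(j < r) \sum_k coef A j i k t * G j k t.
(* At index r the right-hand side replaces the true derivative: they agree almost everywhere, which
   integrals do not notice, and the equation becomes an identity. *)
pose Z j i := if (j < r)%N then G j i else rhs i.
have ZG j i : (j < r)%N -> Z j i = G j i by rewrite /Z => ->.
have Zr i : Z r i = rhs i by rewrite /Z ltnn.
have Gs j i : (j <= r)%N -> sobolev (n + (r - j)) (G j i).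
  by move=> jr; apply: (sobolev_derivn hab p1); rewrite -addnA subnK.
have Gs1 j i : (j < r)%N -> exists c, sob n.+1 (G j i) c.
  move=> jr; have [c Hc] := sobolev_sob_ex hab p1 (Gs j i (ltnW jr)).
  have [K _ HK] : exists2 K, 1 <= K & forall y c, sob (n + (r - j)) y c -> sob n.+1 y (K * c).
    by apply: (sob_incl hab p1); rewrite -addn1 leq_add2l subn_gt0.
  by exists (K * c); exact: HK.
have lr i : cL1 (rhs i).
  have /choice[c Hc] (x : 'I_r * 'I_m) : exists c, sob n (fun t => coef A x.1 i x.2 t * G x.1 x.2 t) c.
    have [P _ HP] := sob_mul hab p1 n; have [c Hc] := Gs1 x.1 x.2 (ltn_ord x.1).
    by eexists; apply: HP Hc; exact: Ad.
  have Hs := sobB hab p1 (sob0 hab p1 n) (sob_sum hab p1 (index_enum _) (fun j =>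
    sob_sum hab p1 (index_enum _) (fun k => Hc (j, k)))).
  exact: (sob_cL1 hab p1 Hs).
have lG i : cL1 (G r i).
  have := Gs r i (leqnn r); rewrite subnn addn0 => /(sobolev_sob_ex hab p1)[c].
  exact: (sob_cL1 hab p1).
have GE i : {ae mu, forall t, t \in `[a, b] -> G r i t = rhs i t}.
  have Yae : {ae mu, forall t, t \in `]a, b[ -> diffop a b A Y t = 0}.
    by case: ifP Yeq => _ // H; exact: aeW.
  (* The equation is given on the open interval; the two end points join the null set. *)
  apply: ae_imp (ae_and Yae (ae_and (ae_neq a) (ae_neq b))) => t [Yt [ta tb]] tab.
  have : t \in `]a, b[.
    by move: tab; rewrite !in_itv/= => /andP[h1 h2]; rewrite !lt_neqAle eq_sym ta tb h1 h2.
  move=> /Yt/matrixP/(_ i q); rewrite diffop_entry [RHS]mxE => /eqP; rewrite addr_eq0 => /eqP.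
  by rewrite /rhs sub0r.
have Zp j i : (j < r)%N -> primitive (Z j i) (Z j.+1 i).
  move=> jr; rewrite (ZG j)//.
  have Gp : primitive (G j i) (G j.+1 i) by exact: (sobolev_chain hab p1 (Ys i q) jr).
  have [jr'|jr'] := ltnP j.+1 r; first by rewrite ZG.
  have E : j.+1 = r by apply/anti_leq; rewrite jr jr'.
  move=> t tab; rewrite Gp// E Zr; congr (_ + _).
  have /andP[_ tb] : a <= t <= b by move: tab; rewrite in_itv.
  exact: (ae_eq_cint tb).
have Za (j : 'I_r) i : Z j i a = ((i0 == j) && (i == q))%:R.
  rewrite ZG// /G; have /matrixP/(_ i q) := Ya j; rewrite !mxE => ->.
  by case: eqP => _; case: eqP.
exists Z; split => //.
- split => //.
  + by move=> i; exact: (sob_le ler01 (sob0 hab p1 n)).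
  + move=> i t; rewrite Zr /rhs; congr (_ - _); apply: eq_bigr => j _.
    by apply: eq_bigr => k _; rewrite ZG.
  + split; first by move=> i; rewrite Zr.
    move=> j i jr; rewrite (Za (Ordinal jr)); case: (_ && _); rewrite ?cabs0//.
    by rewrite (cabs_real 1) normr1.
- by move=> i; rewrite ZG.
- by move=> j i jr; rewrite ZG//; exact: Gs1.
Qed.

(** The columns are solved separately. The construction provides r integrations; the regularity of
    order n of the top derivative comes from [ode_bound]. *)
Lemma cauchy_exists (A : 'I_r -> R -> 'M[R[i]]_m) (i0 : 'I_r) :
  (forall j, sobolev_mx a b p n (A j)) -> exists Y, cauchy_problem a b p n A i0 Y.
Proof.
move=> hA; have [d Hd] := sobolev_mx_sob hab p1 hA.
have lA j i k : cL1 (coef A j i k) by exact: (sob_cL1 hab p1 (Hd j i k)).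
have /choice[Z HZ] (q : 'I_m) :=
  ode_exists hab (fun j i => ((i0 == j) && (i == q))%:R) r0 lA.
pose Y t : 'M[R[i]]_m := \matrix_(i, q) Z q 0%N i t.
have YE i q : (fun t => Y t i q) = Z q 0%N i by apply/funext => t; rewrite mxE.
have [K _ HK] := ode_bound hab p1 n r m d.
have sol q : ode_solution a b p n d (coef A) (fun=> fun=> 0) (Z q) 1.
  have [Zp lZ Zr Za] := HZ q; split => //.
  - by move=> i; exact: (sob_le ler01 (sob0 hab p1 n)).
  - by move=> i t; rewrite Zr sub0r.
  - split => // j i jr; rewrite (Za (Ordinal jr)); case: (_ && _); rewrite ?cabs0//.
    by rewrite (cabs_real 1) normr1.
have Zs q i := HK _ _ _ _ (sol q) i.
have dZ q i : (forall j x, (j < r)%N -> x \in `[a, b] -> derivn_on j (Z q 0%N i) x = Z q j i x) /\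
  (if n is 0 then {ae mu, forall x, x \in `[a, b] -> derivn_on r (Z q 0%N i) x = Z q r i x}
   else forall x, x \in `[a, b] -> derivn_on r (Z q 0%N i) x = Z q r i x).
  have [Zp _ _ _] := HZ q.
  by apply: (chain_derivn hab p1 (Z := fun j => Z q j i)) => [j|]; [exact: Zp|exact: (Zs q i).1].
have eqn t : t \in `[a, b] -> (forall i q, derivn_on r (Z q 0%N i) t = Z q r i t) ->
    diffop a b A Y t = 0.
  move=> tab Ht; apply/matrixP => i q; rewrite diffop_entry [RHS]mxE YE Ht.
  have [_ _ -> _] := HZ q; apply/eqP; rewrite addrC subr_eq0; apply/eqP.
  apply: eq_bigr => j _; apply: eq_bigr => k _; rewrite YE.
  by rewrite (dZ q k).1.
have itvW t : t \in `]a, b[ -> t \in `[a, b].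
  by rewrite !in_itv/= => /andP[/ltW -> /ltW ->].
exists Y; split.
- move=> i q; rewrite YE; have [P _ HP] := sob_sobolev hab p1 (n + r).
  by have [] := HP _ _ (Zs q i).2.
- case: n dZ => [|n'] dZ /=.
    have : {ae mu, forall t, forall i q, t \in `[a, b] -> derivn_on r (Z q 0%N i) t = Z q r i t}.
      apply: ae_forall => i; apply: ae_forall => q; exact: (dZ q i).2.
    by apply: ae_imp => t Ht tab; apply: eqn; [exact: itvW|move=> i q; apply: Ht; exact: itvW].
  by move=> t tab; apply: eqn; [exact: itvW|move=> i q; apply: (dZ q i).2; exact: itvW].
- move=> j; apply/matrixP => i q; rewrite mxE YE (dZ q i).1 ?ltn_ord//; last first.
    by rewrite in_itv/= lexx ltW.
  have [_ _ _ ->] := HZ q; rewrite !mxE.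
  by case: eqP => _; case: eqP.
Qed.

End CauchyProblem.

(** * Convergence of the solutions and of the boundary values *)

Section CharacteristicMatrix.
Context {R : realType}.
Notation mu := (@lebesgue_measure R).
Variables a b : R.
Hypothesis hab : a < b.
Variable p : \bar R.
Hypothesis p1 : (1 <= p)%E.
Local Notation sob := (sob a b p).
Local Notation vsob := (vsob a b p).
Local Notation cL1 := (cL1 a b).
Local Notation primitive := (primitive a b).
Variables n m r l : nat.
Hypothesis m0 : (0 < m)%N.
Hypothesis r0 : (0 < r)%N.
Variables (A : 'I_r -> R -> 'M[R[i]]_m) (Ak : nat -> 'I_r -> R -> 'M[R[i]]_m).
Variables (B : (R -> 'cV[R[i]]_m) -> 'cV[R[i]]_l)
  (Bk : nat -> (R -> 'cV[R[i]]_m) -> 'cV[R[i]]_l).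
Hypothesis hA : forall j, sobolev_mx a b p n (A j).
Hypothesis hAk : forall k j, sobolev_mx a b p n (Ak k j).
Hypothesis hB : continuous_linear a b p (n + r) B.
Hypothesis hBk : forall k, continuous_linear a b p (n + r) (Bk k).
Hypothesis hcvg : strong_cvg a b p n A B Ak Bk.

Lemma primitiveB (f g f' g' : R -> R[i]) : cL1 f' -> cL1 g' -> primitive f f' -> primitive g g' ->
  primitive (fun t => f t - g t) (fun t => f' t - g' t).
Proof.
move=> lf lg ff gg t tab; have /andP[_ tb] : a <= t <= b by move: tab; rewrite in_itv.
by rewrite (cintB tb)// ff// gg// opprD addrACA.
Qed.

(** Stated for arbitrary solutions, so that it applies to whichever ones [xget] selects. The bound
    dA + 1 leaves room for the coefficients of every large k, so a single K from [ode_bound] serves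
    them all. *)
Lemma solution_cvg (i0 : 'I_r) (q : 'I_m) (Y : R -> 'M[R[i]]_m) (Yk : nat -> R -> 'M[R[i]]_m) :
  cauchy_problem a b p n A i0 Y -> (forall k, cauchy_problem a b p n (Ak k) i0 (Yk k)) ->
  forall e : R, 0 < e -> \forall k \near \oo,
    vsob (n + r) ((fun t => col q (Yk k t)) - (fun t => col q (Y t))) e.
Proof.
move=> HY HYk e e0; have [dA HA] := sobolev_mx_sob hab p1 hA.
have cc := coef_cvg hab p1 hA hAk hcvg; pose d := dA + 1.
have HAd j i k : sob n (coef A j i k) d by apply: sob_le (HA j i k); rewrite lerDl.
have [K K1 HK] := ode_bound hab p1 n r m d.
have [Z [[_ _ Zp Zr [lZ _]] Z0 Za Zs]] := cauchy_ode hab p1 r0 q HAd HY.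
(* Only derivatives of order below r of the fixed limit solution occur, so convergence of the
   coefficients alone makes phi tend to 0. *)
pose phi k i t := - \sum_(j < r) \sum_k' (Ak k j t i k' - A j t i k') * Z j k' t.
have phic i : sob_cvg0 a b p n (phi^~ i).
  apply: (sob_cvg0N hab p1); apply: (sob_cvg0_sum hab p1) => j _.
  apply: (sob_cvg0_sum hab p1) => k' _.
  have [c Hc] := Zs j k' (ltn_ord j); exact: (sob_cvg0M hab p1 (cc j i k') Hc).
have K0 : 0 < K by exact: lt_le_trans K1.
have phie : \forall k \near \oo, forall i, sob n (phi k i) (e / K).
  by apply: filter_forall => i; apply: phic; rewrite divr_gt0.
have Ake : \forall k \near \oo, forall x : 'I_r * 'I_m * 'I_m,
    sob n (fun t => Ak k x.1.1 t x.1.2 x.2 - A x.1.1 t x.1.2 x.2) 1.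
  by apply: filter_forall => x; exact: cc.
apply: filterS2 phie Ake => k phik Akk.
have HAkd j i k' : sob n (coef (Ak k) j i k') d.
  have := sobD hab p1 (HA j i k') (Akk (j, i, k')).
  by apply: (sob_ext hab p1) => x _; rewrite addrC subrK.
have [W [[_ _ Wp Wr [lW _]] W0 Wa _]] := cauchy_ode hab p1 r0 q HAkd (HYk k).
pose D j i t := W j i t - Z j i t.
have lZj i j : (j <= r)%N -> cL1 (Z j i).
  by apply: (chain_cL1 (Z := fun j => Z j i)) => // j'; exact: Zp.
have lWj i j : (j <= r)%N -> cL1 (W j i).
  by apply: (chain_cL1 (Z := fun j => W j i)) => // j'; exact: Wp.
have sol : ode_solution a b p n d (coef (Ak k)) (phi k) D (e / K).
  split => //.
  - move=> j i jr; apply: primitiveB; [exact: lWj|exact: lZj|exact: Wp|exact: Zp].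
  - move=> i t; rewrite /D Wr Zr /phi !sub0r opprK -!sumrN -!big_split/=.
    apply: eq_bigr => j _; rewrite -!sumrN -!big_split/=; apply: eq_bigr => k' _.
    by rewrite /coef; ring.
  - split; first by move=> i; exact: (cL1D (lWj i r (leqnn r)) (cL1N (lZj i r (leqnn r)))).
    move=> j i jr; rewrite /D (Wa (Ordinal jr)) (Za (Ordinal jr)) subrr cabs0.
    by rewrite divr_ge0 ?ltW.
move=> i; have [_] := HK _ _ _ _ sol i; rewrite mulrC divfK ?gt_eqF//.
by apply: (sob_ext hab p1) => x _; rewrite /D W0 Z0 !mxE.
Qed.

(** For m = 0 the relation [vsob] would be vacuous and c of any sign; an actual component, provided
    by 0 < m, forces c >= 0. *)
Let vsob_ge0 (Y : R -> 'cV[R[i]]_m) c : vsob (n + r) Y c -> 0 <= c.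
Proof. by move=> /(_ (Ordinal m0)) /sob_ge0. Qed.

Lemma boundary_cvg (y : R -> 'cV[R[i]]_m) (yk : nat -> R -> 'cV[R[i]]_m) i :
  sobolev_mx a b p (n + r) y ->
  (forall e : R, 0 < e -> \forall k \near \oo, vsob (n + r) (yk k - y) e) ->
  forall e : R, 0 < e -> \forall k \near \oo, cabs (Bk k (yk k) i 0 - B y i 0) <= e.
Proof.
move=> ys zc e e0.
(* The seminorms measure [Bk k - B] rather than [Bk k], so that they tend to 0 at each fixed
   argument, as the gliding hump requires. *)
pose N k (x : R -> 'cV[R[i]]_m) := \sum_j cabs ((Bk k x - B x) j 0).
have BD : forall Y Z c d, vsob (n + r) Y c -> vsob (n + r) Z d -> B (Y + Z) = B Y + B Z.
  by move=> Y Z c d Yc Zd; apply: (cl_D hab p1 hB (vsob_ge0 Yc) (vsob_ge0 Zd)).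
have BkD k : forall Y Z c d, vsob (n + r) Y c -> vsob (n + r) Z d -> Bk k (Y + Z) = Bk k Y + Bk k Z.
  by move=> Y Z c d Yc Zd; apply: (cl_D hab p1 (hBk k) (vsob_ge0 Yc) (vsob_ge0 Zd)).
have Ny (Y : R -> 'cV[R[i]]_m) : sobolev_mx a b p (n + r) Y ->
    forall e : R, 0 < e -> \forall k \near \oo, N k Y <= e.
  move=> Ys e' e'0; have [_ /mx_cvgP H] := hcvg Ys.
  (* The denominator l + 1 is nonzero for every l, and l terms of this size sum to at most e'. *)
  have e1 : 0 < e' / (l.+1)%:R by rewrite divr_gt0// ltr0n.
  have : \forall k \near \oo, forall j, cabs (Bk k Y j 0 - B Y j 0) <= e' / (l.+1)%:R.
    by apply: filter_forall => j; exact: H.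
  apply: filterS => k Hk; apply: (@le_trans _ _ (\sum_(j < l) e' / (l.+1)%:R)).
    by apply: ler_sum => j _; rewrite !mxE.
  rewrite sumr_const card_ord -[_ *+ l]mulr_natr mulrAC ler_pdivrMr ?ltr0n//.
  by rewrite ler_wpM2l ?(ltW e'0)// ler_nat.
have gh := @gliding_hump R (R -> 'cV[R[i]]_m)%type (vsob (n + r)) N (fun k => yk k - y)
  (@vsob0 _ a b hab p p1 m (n + r)%N).
have {gh}Nz : forall e : R, 0 < e -> \forall k \near \oo, N k (yk k - y) <= e.
  apply: gh => //.
  - by move=> Y Z c d; exact: vsobD.
  - by move=> Y c; exact: vsobN.
  - by move=> u c; exact: vsob_complete.
  - move=> k Y Z c d Yc Zd; rewrite /N -big_split/=; apply: ler_sum => j _.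
    rewrite (BD _ _ _ _ Yc Zd) (BkD k _ _ _ _ Yc Zd) opprD addrACA mxE.
    exact: cabsD.
  - move=> k Y c Yc; apply: eq_bigr => j _.
    rewrite (cl_N hab p1 hB (vsob_ge0 Yc) Yc) (cl_N hab p1 (hBk k) (vsob_ge0 Yc) Yc) -opprD mxE.
    exact: cabsN.
  - move=> k; have [C [C0 HC]] := cl_bound hab p1 hB; have [C' [C'0 HC']] := cl_bound hab p1 (hBk k).
    exists (C' + C); split; first exact: addr_gt0.
    move=> Y c c0 Yc; rewrite mulrDl; apply: le_trans (lerD (HC' _ _ c0 Yc) (HC _ _ c0 Yc)).
    by rewrite /N -big_split/=; apply: ler_sum => j _; rewrite mxE [X in cabs (_ + X)]mxE; exact: cabsB.
  - move=> Y c Yc; apply: Ny; have [K _ HK] := vsob_sobolev hab p1 m (n + r).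
    by have [] := HK _ _ (vsob_ge0 Yc) Yc.
have [C [C0 HC]] := cl_bound hab p1 hB.
have e30 : 0 < e / 3 by rewrite divr_gt0.
have [cy _ yc] := sobolev_vsob hab p1 ys.
apply: filterS3 (Nz _ e30) (Ny _ ys _ e30) (zc _ (divr_gt0 e30 C0)) => k H1 H2 H3.
have H4 := HC _ _ (divr_gt0 e30 C0) H3.
have ykE : yk k = (yk k - y) + y by rewrite subrK.
have -> : Bk k (yk k) i 0 - B y i 0 = (Bk k (yk k - y) - B (yk k - y)) i 0 +
    (B (yk k - y) i 0 + (Bk k y - B y) i 0).
  by rewrite {1}ykE (BkD k _ _ _ _ H3 yc) !mxE; ring.
have le_sum (F : 'I_l -> R[i]) : cabs (F i) <= \sum_j cabs (F j).
  by rewrite (bigD1 i)//= lerDl sumr_ge0// => j _; exact: cabs_ge0.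
apply: le_trans (cabsD _ _) _.
have -> : e = e / 3 + (e / 3 + e / 3) by field.
apply: lerD; first exact: le_trans (le_sum _) H1.
apply: le_trans (cabsD _ _) _; apply: lerD; last exact: le_trans (le_sum _) H2.
by apply: le_trans (le_sum (fun j => B (yk k - y) j 0)) _; rewrite mulrC divfK ?gt_eqF// in H4.
Qed.

End CharacteristicMatrix.

Theorem theorem3 (R : realType) (a b : R) (n m r l : nat) (p : \bar R)
    (hab : a < b) (hm : (0 < m)%N) (hr : (0 < r)%N) (hl : (0 < l)%N)
    (hp : (1 <= p)%E)
    (A : 'I_r -> R -> 'M[R[i]]_m) (Ak : nat -> 'I_r -> R -> 'M[R[i]]_m)
    (hA : forall j, sobolev_mx a b p n (A j))
    (hAk : forall k j, sobolev_mx a b p n (Ak k j))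
    (B : (R -> 'cV[R[i]]_m) -> 'cV[R[i]]_l)
    (Bk : nat -> (R -> 'cV[R[i]]_m) -> 'cV[R[i]]_l)
    (hB : continuous_linear a b p (n + r) B)
    (hBk : forall k, continuous_linear a b p (n + r) (Bk k))
    (hcvg : strong_cvg a b p n A B Ak Bk) :
  (fun k => charmx a b p n (Ak k) (Bk k)) @ \oo --> charmx a b p n A B.
Proof.
apply/mx_cvgP => i j e e0.
have sol (A' : 'I_r -> R -> 'M[R[i]]_m) (i0 : 'I_r) : (forall j, sobolev_mx a b p n (A' j)) ->
    cauchy_problem a b p n A' i0 (fundamental_solution a b p n A' i0).
  by move=> hA'; have [Y HY] := cauchy_exists hab hp hr i0 hA'; apply: xgetPex; exists Y.
under eq_near do rewrite !castmxE !mxE.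
(* Column j of the row of blocks is column q of block i0, so each entry is a component of the
   boundary operator at one column of a fundamental solution. *)
set i0 := tagnat.sig1 _; set q := tagnat.sig2 _.
have Ys : sobolev_mx a b p (n + r) (fun t => col q (fundamental_solution a b p n A i0 t)).
  have [Y's _ _] := sol A i0 hA; move=> i' j'.
  by under eq_fun do rewrite mxE; exact: Y's.
have H := solution_cvg hab hp hr hA hAk hcvg q (sol A i0 hA) (fun k => sol (Ak k) i0 (hAk k)).
exact: (boundary_cvg hab hp hm hB hBk hcvg _ Ys H e0).
Qed.
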